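(* Let $\Gamma$ be a finitely generated sofic group, $\mathcal X$ a sofic approximation of $\Gamma$, and let $X$ be the space of graphs constructed from $\mathcal X$. Then: (1) if $X$ has property A, then $\Gamma$ is amenable; (2) if $X$ admits an asymptotic coarse embedding into Hilbert space, then $\Gamma$ is a-T-menable; (3) if $X$ has boundary geometric property (T) (i.e. geometric property (T) for boundary representations), then $\Gamma$ has property (T).
   Context: **Sofic approximations.** $\Gamma$ is a group with finite generating set $S$. For a finite $F\subset\Gamma$ and $\varepsilon\ge 0$, a map $\sigma:\Gamma\to \mathrm{Sym}(V)$, $V$ a nonempty finite set, is an $(F,\varepsilon)$-injective almost action if there is $Y\subset V$ with $|Y|\ge(1-\varepsilon)|V|$, $\sigma(g)\sigma(h)(y)=\sigma(gh)(y)$ for all $g,h\in F$, $y\in Y$, and $\sigma(g)(y)\ne y$ for all $g\in F\setminus\{e\}$, $y\in Y$. $\Gamma$ is sofic if such almost actions exist for every finite $F$ and every $\varepsilon>0$. A sofic approximation $\mathcal X=\{X_i,\sigma_i\}_{i\in\mathbb N}$ consists of finite sets $X_i$ with $(F_i,\varepsilon_i)$-injective almost actions $\sigma_i:\Gamma\to\mathrm{Sym}(X_i)$, where $(F_i)$ is a nested sequence of finite subsets with union $\Gamma$ and $\varepsilon_i\to0$. Each $X_i$ is made an $S$-labelled graph by joining $x$ to $\sigma_i(s)(x)$ by an edge labelled $s\in S$; these graphs are always assumed connected. The space of graphs is $X=\bigsqcup_i X_i$ with any metric $d$ restricting to the edge metric on each $X_i$ and with $d(X_i,X_j)\to\infty$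 as $i+j\to\infty$, $i\neq j$ (any two such metrics are coarsely equivalent). Put $E_R=\{(x,y)\in X\times X: d(x,y)\le R\}$; an entourage is a subset of some $E_R$. **Property A.** For every $R,\varepsilon>0$ there are $S_0>0$ and a map $\eta:X\to\mathrm{Prob}(X)$, $x\mapsto\eta_x$, with $\eta_x$ supported in the ball of radius $S_0$ about $x$ and $\|\eta_x-\eta_y\|_1\le\varepsilon$ for all $(x,y)\in E_R$. **Asymptotic coarse embedding.** There are non-decreasing functions $\rho_1,\rho_2:\mathbb R_+\to\mathbb R$ tending to $+\infty$, symmetric kernels $K_i:X_i\times X_i\to\mathbb R$ that are normalised ($K_i(x,x)=0$), and non-negative reals $R_i\to\infty$ such that for all $i$: (i) $\rho_1(d(x,y))\le K_i(x,y)\le\rho_2(d(x,y))$ for all $x,y\in X_i$; (ii) for every $\{x_1,\dots,x_n\}\subset X_i$ of diameter at most $R_i$ and reals $\lambda_1,\dots,\lambda_n$ with $\sum_k\lambda_k=0$, one has $\sum_{k,l}\lambda_k\lambda_lK_i(x_k,x_l)\le0$. **a-T-menable.** A countable group is a-T-menable if it carries a proper conditionally negative definite function $\psi:\Gamma\to\mathbb R$ (with $\psi(e)=0$, $\psi(g)=\psi(g^{-1})$). **Property (T).** Every unitary representation of $\Gamma$ that has almost invariant vectors (for every $\varepsilon>0$ a unit vector $v$ with $\max_{s\in S}\|\pi(s)v-v\|\le\varepsilon$) has a nonzero invariant vector. **Boundary geometric property (T).** $\mathbb C[X]$ is the $*$-algebra of bounded operators $T$ on $\ell^2(X)$ of finite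 propagation, $\sup\{d(x,y):T_{x,y}\ne0\}<\infty$, where $T_{x,y}=\langle T\delta_x,\delta_y\rangle$. A representation of $\mathbb C[X]$ is a $*$-homomorphism $\mathbb C[X]\to B(H)$, $H$ a Hilbert space. It is a boundary representation if it vanishes on the ideal of $T\in\mathbb C[X]$ with only finitely many nonzero entries. $C^*_\partial(X)$ is the separated completion of $\mathbb C[X]$ in the seminorm $\|T\|_\partial=\sup\{\|\pi(T)\|:\pi\text{ a boundary representation}\}$, and $\mathrm{Spec}_\partial$ denotes spectrum in $C^*_\partial(X)$. For an entourage $E$, the $E$-Laplacian $\Delta^E\in\mathbb C[X]$ has entries $-1$ if $(x,y)\in(E\cup E^{-1})\setminus\mathrm{diag}$, $|\{z:(x,z)\in(E\cup E^{-1})\setminus\mathrm{diag}\}|$ if $x=y$, and $0$ otherwise. An entourage $E$ is generating (at infinity) if for every $R>0$ there are $n\in\mathbb N$ and a finite $F\subset X\times X$ with $E_R\subset (E\cup E^{-1}\cup\mathrm{diag})^{\circ n}\cup F$. $X$ has boundary geometric property (T) if there are a generating entourage $E$ and $c>0$ with $\mathrm{Spec}_\partial(\Delta^E)\subset\{0\}\cup[c,\infty)$. *)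

(* Defs.v *)
From HB Require Import structures.
From mathcomp Require Import all_boot all_order all_algebra all_fingroup complex.
From mathcomp Require Import all_classical all_reals all_analysis.

Set Implicit Arguments.
Unset Strict Implicit.
Unset Printing Implicit Defensive.

Import Order.TTheory GRing.Theory Num.Theory.
Import numFieldNormedType.Exports.

Local Open Scope classical_set_scope.
Local Open Scope ring_scope.

(** * Groups *)

Definition generates (G : groupType) (S : set G) : Prop :=
  forall P : set G, P 1%g -> S `<=` P ->
    (forall g h, P g -> P h -> P (g * h)%g) ->
    (forall g, P g -> P (g^-1)%g) -> forall g, P g.

(* Products of permutations are written as compositions, because [*%g] on
   [{perm V}] composes from left to right. *)
Definition injective_almost_action (R : realType) (G : groupType)
    (F : set G) (eps : R) (V : finType) (sigma : G -> {perm V}) : Prop :=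
  (0 < #|V|)%N /\
  exists Y : {set V},
    [/\ (1 - eps) * #|V|%:R <= #|Y|%:R,
        forall g h y, F g -> F h -> y \in Y ->
          sigma g (sigma h y) = sigma (g * h)%g y
      & forall g y, F g -> g <> 1%g -> y \in Y -> sigma g y <> y].

Definition sofic (R : realType) (G : groupType) : Prop :=
  forall (F : set G) (eps : R), finite_set F -> 0 < eps ->
    exists (V : finType) (sigma : G -> {perm V}),
      injective_almost_action F eps sigma.

(* Amenability in von Neumann's form: a left-invariant finitely additive
   probability measure on all subsets of [G]. *)
Definition amenable (R : realType) (G : groupType) : Prop :=
  exists mu : set G -> R,
    [/\ forall A, 0 <= mu A,
        mu setT = 1,
        forall A B, A `&` B = set0 -> mu (A `|` B) = mu A + mu B
      & forall g A, mu [set (g * a)%g | a in A] = mu A].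

Definition a_T_menable (R : realType) (G : groupType) : Prop :=
  exists psi : G -> R,
    [/\ psi 1%g = 0,
        forall g, psi (g^-1)%g = psi g,
        forall (n : nat) (g : 'I_n -> G) (lambda : 'I_n -> R),
          \sum_k lambda k = 0 ->
          \sum_k \sum_l lambda k * lambda l * psi ((g k)^-1 * g l)%g <= 0
      & forall M : R, finite_set [set g | `|psi g| <= M]].

(** * Hilbert spaces *)

(* [hdot] is linear in its first argument and conjugate-linear in its second. *)
Record hilbert (R : realType) := Hilbert {
  hsort :> lmodType R[i];
  hdot : {dot hsort for Num.conj};
  hilbert_complete : forall u : nat -> hsort,
    (forall eps : R, 0 < eps -> exists N : nat, forall m n : nat,
      (N <= m)%N -> (N <= n)%N ->
      Num.sqrt (complex.Re (hdot (u m - u n) (u m - u n))) < eps) ->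
    exists v : hsort, forall eps : R, 0 < eps -> exists N : nat, forall n : nat,
      (N <= n)%N -> Num.sqrt (complex.Re (hdot (u n - v) (u n - v))) < eps }.

Definition hnorm (R : realType) (H : hilbert R) (v : H) : R :=
  Num.sqrt (complex.Re (hdot H v v)).

Definition bounded_op (R : realType) (H : hilbert R) (A : H -> H) : Prop :=
  exists M : R, forall v, hnorm (A v) <= M * hnorm v.

Definition opnorm (R : realType) (H : hilbert R) (A : H -> H) : R :=
  sup [set hnorm (A v) | v in [set v : H | hnorm v <= 1]].

(* Surjectivity of the [pi g] follows from the first two clauses. *)
Definition unitary_rep (R : realType) (G : groupType) (H : hilbert R)
    (pi : G -> {linear H -> H}) : Prop :=
  [/\ forall v, pi 1%g v = v,
      forall g h v, pi (g * h)%g v = pi g (pi h v)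
    & forall g v w, hdot H (pi g v) (pi g w) = hdot H v w].

Definition property_T (R : realType) (G : groupType) (S : set G) : Prop :=
  forall (H : hilbert R) (pi : G -> {linear H -> H}),
    unitary_rep pi ->
    (forall eps : R, 0 < eps -> exists v : H,
       hnorm v = 1 /\ forall s, S s -> hnorm (pi s v - v) <= eps) ->
    exists v : H, v <> 0 /\ forall g, pi g v = v.

(** * Spaces of graphs *)

Section SpaceOfGraphs.
Variables (R : realType) (G : groupType).
Variables (X : nat -> finType) (sigma : forall i, G -> {perm X i}).

Definition sofic_approximation : Prop :=
  exists (F : nat -> set G) (eps : nat -> R),
    [/\ forall i, finite_set (F i),
        forall i, F i `<=` F i.+1,
        \bigcup_i F i = setT,
        (forall i, 0 <= eps i) /\ eps @ \oo --> (0 : R)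
      & forall i, injective_almost_action (F i) (eps i) (sigma i)].

Variable S : set G.

(* The undirected graph underlying the S-labelled graph on [X i]. *)
Definition edge (i : nat) : rel (X i) := fun x y =>
  `[< exists2 s, S s & sigma i s x = y \/ sigma i s y = x >].

Definition graphs_connected : Prop :=
  forall (i : nat) (x y : X i), connect (@edge i) x y.

Definition edge_dist (i : nat) (x y : X i) : R :=
  inf [set n%:R | n in [set n : nat | exists p : seq (X i),
         [/\ path (@edge i) x p, last x p = y & size p = n]]].

Definition graph_space : choiceType := {i : nat & X i}.

Definition in_space (i : nat) (x : X i) : graph_space := existT _ i x.

Definition space_metric (d : graph_space -> graph_space -> R) : Prop :=
  [/\ [/\ forall x y, 0 <= d x y,
          forall x y, d x y = 0 <-> x = y,
          forall x y, d x y = d y x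
        & forall x y z, d x z <= d x y + d y z],
      forall i (x y : X i), d (in_space x) (in_space y) = edge_dist x y
    & forall M : R, exists N : nat, forall i j, i <> j -> (N <= i + j)%N ->
        forall (x : X i) (y : X j), M <= d (in_space x) (in_space y)].

Definition asymptotic_coarse_embedding (d : graph_space -> graph_space -> R) : Prop :=
  exists (rho1 rho2 : R -> R) (K : forall i, X i -> X i -> R) (Rad : nat -> R),
    [/\ (forall s t, 0 <= s -> s <= t -> rho1 s <= rho1 t) /\
          rho1 t @[t --> +oo] --> +oo,
        (forall s t, 0 <= s -> s <= t -> rho2 s <= rho2 t) /\
          rho2 t @[t --> +oo] --> +oo,
        forall i, (forall x y, K i x y = K i y x) /\ (forall x, K i x x = 0),
        (forall i, 0 <= Rad i) /\ Rad @ \oo --> +oo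
      & forall i,
          (forall x y : X i, let r := d (in_space x) (in_space y) in
             rho1 r <= K i x y <= rho2 r) /\
          (forall (n : nat) (x : 'I_n -> X i) (lambda : 'I_n -> R),
             (forall k l, d (in_space (x k)) (in_space (x l)) <= Rad i) ->
             \sum_k lambda k = 0 ->
             \sum_k \sum_l lambda k * lambda l * K i (x k) (x l) <= 0)].

End SpaceOfGraphs.

(** * Coarse geometry of a metric space [(T, d)] *)

Section CoarseGeometry.
Variables (R : realType) (T : choiceType) (d : T -> T -> R).

Definition tube (r : R) : set (T * T) := [set p | d p.1 p.2 <= r].

Definition entourage_of (E : set (T * T)) : Prop := exists r, E `<=` tube r.

Definition prob (f : T -> R) : Prop :=
  (forall x, 0 <= f x) /\ (\esum_(x in [set: T]) (f x)%:E)%E = 1%E.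

Definition property_A : Prop :=
  forall r eps : R, 0 < r -> 0 < eps ->
    exists (s : R) (eta : T -> T -> R),
      [/\ 0 < s,
          forall x, prob (eta x),
          forall x y, eta x y <> 0 -> d x y <= s
        & forall x y, tube r (x, y) ->
            (\esum_(z in [set: T]) `|eta x z - eta y z|%:E <= eps%:E)%E].

(** ** The algebra C[X] *)

(* An operator [A] on l^2(T) is encoded by its matrix
   [t x y = <A delta_x, delta_y>]; hence [(A xi)(y) = \sum_x t x y * xi x], and
   the matrix of a composition [A B] is the product of the matrix of [B] by that
   of [A]. Rows and columns of matrices of finite propagation are finitely
   supported as soon as balls are finite, so that all sums below are finite. *)
Definition mat := T -> T -> R[i].

Definition mat_app (t : mat) (xi : T -> R[i]) : T -> R[i] := fun y =>
  \sum_(x \in [set: T]) t x y * xi x.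

Definition mat_add (t u : mat) : mat := fun x y => t x y + u x y.
Definition mat_sub (t u : mat) : mat := fun x y => t x y - u x y.
Definition mat_scale (a : R[i]) (t : mat) : mat := fun x y => a * t x y.
Definition mat_one : mat := fun x y => (x == y)%:R.
Definition mat_mul (t u : mat) : mat := fun x y =>
  \sum_(z \in [set: T]) u x z * t z y.
Definition mat_adj (t : mat) : mat := fun x y => Num.conj (t y x).

Definition l2_sqnorm (xi : T -> R[i]) : \bar R :=
  (\esum_(x in [set: T]) (complex.Re `|xi x| ^+ 2)%:E)%E.

Definition l2_bounded (t : mat) : Prop :=
  exists M : R, forall xi : T -> R[i], (l2_sqnorm xi < +oo)%E ->
    (l2_sqnorm (mat_app t xi) <= M%:E * l2_sqnorm xi)%E.

Definition finite_propagation (t : mat) : Prop :=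
  exists r : R, forall x y, t x y <> 0 -> d x y <= r.

Definition CX (t : mat) : Prop := finite_propagation t /\ l2_bounded t.

(* A *-homomorphism C[X] -> B(H), not required to be unital; the values of [pi]
   outside of C[X] are irrelevant. *)
Definition CX_rep (H : hilbert R) (pi : mat -> {linear H -> H}) : Prop :=
  [/\ forall t, CX t -> bounded_op (pi t),
      forall t u v, CX t -> CX u -> pi (mat_add t u) v = pi t v + pi u v,
      forall a t v, CX t -> pi (mat_scale a t) v = a *: pi t v,
      forall t u v, CX t -> CX u -> pi (mat_mul t u) v = pi t (pi u v)
    & forall t v w, CX t -> hdot H (pi t v) w = hdot H v (pi (mat_adj t) w)].

Definition boundary_rep (H : hilbert R) (pi : mat -> {linear H -> H}) : Prop :=
  CX_rep pi /\
  forall t, CX t -> finite_set [set p : T * T | t p.1 p.2 <> 0] ->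
    forall v, pi t v = 0.

Definition boundary_norm (t : mat) : \bar R :=
  ereal_sup [set r | exists (H : hilbert R) (pi : mat -> {linear H -> H}),
    boundary_rep pi /\ r = (opnorm (pi t))%:E].

(** ** The completion C*_bd(X) and its spectra *)

(* An element of the separated completion is represented by a Cauchy sequence in
   C[X]; two Cauchy sequences represent the same element iff their difference
   tends to 0 in the seminorm. *)
Definition cstar_elt (u : nat -> mat) : Prop :=
  (forall n, CX (u n)) /\
  forall eps : R, 0 < eps -> exists N : nat, forall m n : nat,
    (N <= m)%N -> (N <= n)%N ->
    (boundary_norm (mat_sub (u m) (u n)) < eps%:E)%E.

Definition cstar_eq (u v : nat -> mat) : Prop :=
  boundary_norm (mat_sub (u n) (v n)) @[n --> \oo] --> 0%E.

Definition cstar_mul (u v : nat -> mat) : nat -> mat := fun n =>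
  mat_mul (u n) (v n).

Definition cstar_const (t : mat) : nat -> mat := fun=> t.

Definition cstar_invertible (u : nat -> mat) : Prop :=
  exists v : nat -> mat, [/\ cstar_elt v,
    cstar_eq (cstar_mul u v) (cstar_const mat_one)
  & cstar_eq (cstar_mul v u) (cstar_const mat_one)].

Definition boundary_spec (t : mat) : set R[i] :=
  [set lambda | ~ cstar_invertible
                    (cstar_const (mat_sub t (mat_scale lambda mat_one)))].

(** ** Boundary geometric property (T) *)

Definition symmetrized (E : set (T * T)) : set (T * T) := E `|` (E^-1)%relation.

Definition laplacian (E : set (T * T)) : mat := fun x y =>
  if x == y
  then \sum_(z \in [set z | (symmetrized E `\` diagonal) (x, z)]) (1 : R[i])
  else if `[< symmetrized E (x, y) >] then -1 else 0.

Definition relpow (E : set (T * T)) (n : nat) : set (T * T) :=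
  iter n (fun F => (E \; F)%relation) diagonal.

Definition generating (E : set (T * T)) : Prop :=
  entourage_of E /\
  forall r : R, 0 < r -> exists (n : nat) (F : set (T * T)),
    finite_set F /\ tube r `<=` relpow (symmetrized E `|` diagonal) n `|` F.

Definition boundary_geometric_T : Prop :=
  exists (E : set (T * T)) (c : R),
    [/\ generating E, 0 < c
      & boundary_spec (laplacian E) `<=`
          [set lambda | lambda = 0 \/ c%:C%C <= lambda]].

End CoarseGeometry.

(* Main.v *)
Require Import Defs.
From HB Require Import structures.
From mathcomp Require Import all_boot all_order all_algebra all_fingroup complex.
From mathcomp Require Import all_classical all_reals all_analysis.
From mathcomp Require Import zify ring lra.

Set Implicit Arguments.
Unset Strict Implicit.
Unset Printing Implicit Defensive.

Import Order.TTheory GRing.Theory Num.Theory.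
Import numFieldNormedType.Exports.

Local Open Scope classical_set_scope.
Local Open Scope ring_scope.

(** Along a sofic approximation the group and the graphs are locally the same:
there are radii [m i] tending to infinity and sets [Y i] of density tending to 1
in [X i] such that, for [x] in [Y i], the map [g |-> sigma i g x] identifies a
ball of [G] with the ball of the graph around [x] (a [frame]). Inside such a
ball, two points [y] and [z] determine a group element [chart y z], the short
[g] which moves [y] to [z]. A coarse structure on the graphs is carried to the
group through these charts, points are averaged over [X i], and the limit is
taken along a free ultrafilter [w] on the indices; the exceptional set
[~: Y i] disappears from the averages.

Property A: for the maps [eta] of property A, averaging over [x] the masses
[eta_x {y | chart x y ^-1 in A}] gives a finitely additive probability on [G].
Translating [A] by a generator replaces [x] by a neighbour of [x], at the price
of the variation of [eta], so these measures are almost invariant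
([almost_invariant_mean]); their ultralimit is an invariant mean
([amenable_of_almost_invariant]).

Asymptotic embeddings: [psi g] is the limit of the averages over [x] of
[K i x (sigma i g x)]. Moving [x] by a fixed group element changes such an
average by a quantity which tends to 0 ([cvg_translate]), which turns
[psi (a^-1 * b)] into the average of [K i (a^-1 x) (b^-1 x)]; hence [psi] is
symmetric and of conditionally negative type because [K i] is so on sets of
bounded diameter. The lower control function makes [psi] proper.

Property (T): let [pi] be a unitary representation on [H] with almost invariant
vectors. The functions [xi : X -> H] whose restrictions to the [X i] have bounded
l^2 norm and which, for every [r], are supported for most [i] at points whose
[r]-neighbourhood lies inside a chart, form modulo null functions a
Hilbert space ([ultraproduct]). A matrix [t] of [C[X]] acts on it by
[(t xi)(y) = \sum_x t x y *: pi (chart x y) (xi x)] ([section_op]). Since [chart]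
is a cocycle on charts, this is a *-representation, and it kills the matrices
with finitely many nonzero entries: it is a boundary representation
([asymptotic_rep_boundary]). Let [D] be the image of the Laplacian.

The gap hypothesis says that [D - l] is bounded below for every real [l < c]
other than 0 ([resolvent_below]). In place of a spectral theorem, the absence
of spectrum in an interval ]a, b[ is exploited through the inequality
[(D - a)(D - b) >= 0] ([spectral_gap]); it yields that every vector [u] lies
within [||D u|| / c] of the kernel of [D] ([kernel_vector_near]). On the other
hand, [2 <D xi, xi>] is the limit of the energies
[\sum ||xi y - pi (chart x y) (xi x)||^2], summed over the edges of the
entourage [E] ([laplacian_energy]). For the constant function [v / sqrt #|X i|]
the energy is bounded by the displacement of [v] under a ball of [G], so if [v]
is almost invariant, then there is [k] in the kernel of [D] near this function.
A vector in the kernel has energy 0 along [E], hence along every entourage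
because [E] is generating and the variation along a composite of two charts is
controlled by the variations along each of them ([energy_comp]); so it is
invariant under the diagonal translations [xi |-> pi g (xi (g^-1 x))] by
generators [g]. On constant functions this translation is [v |-> pi g v]. The
projection of [k] to the space of constant functions is therefore an invariant
vector of [H]; it is nonzero because [k] is near a constant function of norm 1.
*)

(** * Word balls *)

Section Balls.
Variables (G : groupType) (S : set G).

Definition letter : set G := [set t | t = 1%g \/ S t \/ S (t^-1)%g].

Fixpoint word_ball (k : nat) : set G :=
  if k is l.+1 then [set (t * g)%g | t in letter & g in word_ball l] else [set 1%g].

Lemma letterV t : letter t -> letter (t^-1)%g.
Proof.
move=> [->|[St|St]]; [by left; rewrite invg1 | |by right; left].
by right; right; rewrite invgK.
Qed.

Lemma word_ball_id k : word_ball k 1%g.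
Proof.
elim: k => //= k IH; exists 1%g; first by left.
by exists 1%g => //; rewrite mulg1.
Qed.

Lemma word_ball_letter t : letter t -> word_ball 1 t.
Proof. by move=> Lt; exists t => //; exists 1%g => //; rewrite mulg1. Qed.

Lemma word_ballM a b g h : word_ball a g -> word_ball b h -> word_ball (a + b) (g * h)%g.
Proof.
elim: a g => [|a IH] g /=; first by move=> -> Bh; rewrite mul1g.
move=> [t Lt [g' Bg' <-]] Bh; rewrite -mulgA.
by exists t => //; exists (g' * h)%g => //; exact: IH.
Qed.

Lemma word_ball_sub a b : (a <= b)%N -> word_ball a `<=` word_ball b.
Proof.
move=> leab g Bg; rewrite -(mulg1 g) -(subnKC leab).
by apply: word_ballM => //; exact: word_ball_id.
Qed.

Lemma word_ballV a g : word_ball a g -> word_ball a (g^-1)%g.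
Proof.
elim: a g => [|a IH] g /=; first by move=> ->; rewrite /= invg1.
move=> [t Lt [g' Bg' <-]]; rewrite invgM.
have := word_ballM (IH _ Bg') (word_ball_letter (letterV Lt)); by rewrite addn1.
Qed.

Lemma finite_word_ball k : finite_set S -> finite_set (word_ball k).
Proof.
move=> fS; elim: k => [|k IH] /=; first exact: finite_set1.
apply: finite_image2 => //.
have -> : letter = [set 1%g] `|` (S `|` [set (t^-1)%g | t in S]).
  apply/seteqP; split=> [t [->|[St|St]]|t [->|[St|[s Ss <-]]]].
  - by left.
  - by right; left.
  - by right; right; exists (t^-1)%g => //; rewrite invgK.
  - by left.
  - by right; left.
  - by right; right; rewrite invgK.
rewrite !finite_setU; split; first exact: finite_set1.
by split => //; exact: finite_image.
Qed.

Lemma word_ball_cover g : generates S -> exists k, word_ball k g.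
Proof.
move=> genS; apply: (genS [set g | exists k, word_ball k g]).
- by exists 0%N.
- by move=> s Ss; exists 1%N; apply: word_ball_letter; right; left.
- by move=> a b [k Ba] [l Bb]; exists (k + l)%N; exact: word_ballM.
- by move=> a [k Ba]; exists k; exact: word_ballV.
Qed.

End Balls.

(** * Frames of a sofic approximation *)

(** A filter is stable under finite intersections only, so that finitely many
properties can be required at the same index. *)
Lemma near_finite_set (I : eqType) (F : set_system nat) (A : set I)
    (P : I -> nat -> Prop) :
  Filter F -> finite_set A -> (forall a, A a -> \forall i \near F, P a i) ->
  \forall i \near F, forall a, A a -> P a i.
Proof.
move=> FF /finite_seqP[s ->]; elim: s => [|a s IH] evP.
  by apply: nearW => i a; rewrite /= in_nil.
have evs : \forall i \near F, forall b, [set` s] b -> P b i.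
  by apply: IH => b sb; apply: evP; rewrite /= in_cons sb orbT.
have eva : \forall i \near F, P a i by apply: evP; rewrite /= mem_head.
apply: filterS2 eva evs => i Pai Psi b; rewrite /= in_cons => /orP[/eqP->//|].
exact: Psi.
Qed.

(** Countably many eventual properties need not hold at a common index, but [J i] can be
the largest [j <= i] whose property holds at [i]; it tends to infinity along [F].
This is the diagonal argument behind the choice of the radii of a frame and
behind the completeness of the ultraproduct. *)
Lemma diagonal_index (F : set_system nat) (P : nat -> nat -> Prop) :
  Filter F -> \oo `<=` F -> (forall k, \forall i \near F, P k i) ->
  exists J : nat -> nat, forall k, \forall i \near F, (k <= J i)%N /\ P (J i) i.
Proof.
move=> FF ooF evP.
pose Q i k := (k <= i)%N && `[< P k i >].
have /choice[J HJ] : forall i, exists j, (exists k, Q i k) ->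
    Q i j /\ forall k, Q i k -> (k <= j)%N.
  move=> i; case: (pselect (exists k, Q i k)) => [ex|nex]; last by exists 0%N.
  have bnd k : Q i k -> (k <= i)%N by case/andP.
  by exists (ex_maxn ex bnd) => _; case: ex_maxnP => j Qj maxj.
exists J => k; have ik : \forall i \near F, (k <= i)%N.
  by apply: ooF; exact: nbhs_infty_ge.
apply: filterS2 (evP k) ik => i Pki leki.
have Qik : Q i k by rewrite /Q leki; apply/asboolP.
have [/andP[_ /asboolP PJ] maxJ] := HJ i (ex_intro _ k Qik).
by split => //; exact: maxJ.
Qed.

Section Frame.
Variables (R : realType) (G : groupType) (S : set G).
Variables (X : nat -> finType) (sigma : forall i, G -> {perm X i}).
Arguments sigma : clear implicits.

(** [Y i] is the set of points at which the action is multiplicative and free on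
words of length [4 * m i]. The factor 4 leaves room for the charts, which join
two points at distance at most [m i] from a point of [Y i]: such points are moved
by words of length [2 * m i], and two of these are compared through a quotient of
length [4 * m i]. *)
Record frame (m : nat -> nat) (Y : forall i, {set X i}) : Prop := Frame {
  frame_radius : forall k, \forall i \near \oo, (k <= m i)%N;
  frame_mul : forall i x g h, x \in Y i -> word_ball S (4 * m i) g ->
    word_ball S (4 * m i) h -> sigma i g (sigma i h x) = sigma i (g * h)%g x;
  frame_free : forall i x g, x \in Y i -> word_ball S (4 * m i) g ->
    sigma i g x = x -> g = 1%g;
  frame_card : forall i, (0 < #|X i|)%N;
  frame_density : #|~: Y i|%:R / #|X i|%:R @[i --> \oo] --> (0 : R) }.

(** The sets [F i] exhaust the group, so they contain larger and larger balls;
[diagonal_index] picks for each [i] a ball contained in [F i]. *)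
Lemma exists_frame : finite_set S -> sofic_approximation R sigma ->
  exists m Y, frame m Y.
Proof.
move=> fS [F [eps [fF subF covF [eps0 epsto] act]]].
have monoF i j : (i <= j)%N -> F i `<=` F j.
  move=> /subnKC <-; elim: (j - i)%N => [|n IH]; first by rewrite addn0.
  by rewrite addnS; apply: subset_trans IH (subF _).
have evF k : \forall i \near \oo, word_ball S (4 * k) `<=` F i.
  apply: near_finite_set; first exact: finite_word_ball.
  move=> g _; have [n _ Fng] : (\bigcup_i F i) g by rewrite covF.
  exists n => // i /= leni; exact: monoF leni _ Fng.
have [m Hm] := @diagonal_index _ (fun k i => word_ball S (4 * k) `<=` F i) _
  (fun _ => id) evF.
have [Y0 HY0] : exists Y : forall i, {set X i}, forall i,
    [/\ (1 - eps i) * #|X i|%:R <= #|Y i|%:R,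
        forall g h y, F i g -> F i h -> y \in Y i ->
          sigma i g (sigma i h y) = sigma i (g * h)%g y
      & forall g y, F i g -> g <> 1%g -> y \in Y i -> sigma i g y <> y].
  by exists (fun i => sval (cid (act i).2)) => i; exact: svalP (cid (act i).2).
pose Y i := if `[< word_ball S (4 * m i) `<=` F i >] then Y0 i else finset.set0.
have YE i x : x \in Y i -> word_ball S (4 * m i) `<=` F i /\ x \in Y0 i.
  by rewrite /Y; case: ifP => [/asboolP //|_]; rewrite finset.in_set0.
exists m, Y; split.
- by move=> k; apply: filterS (Hm k) => i [].
- move=> i x g h /YE[BF xY] Bg Bh; have [_ mulY _] := HY0 i.
  by apply: mulY => //; exact: BF.
- move=> i x g /YE[BF xY] Bg gx; have [_ _ freeY] := HY0 i.
  by apply: contrapT => /(freeY _ _ (BF _ Bg))/(_ xY).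
- by move=> i; have [] := act i.
- have epsto' : eps i @[i --> \oo] --> (0 : R) := epsto.
  apply: (@squeeze_cvgr _ _ _ _ (fun=> 0) eps) => //; last exact: cvg_cst.
  apply: filterS (Hm 0%N) => i [_ BF]; have [cY _ _] := HY0 i.
  have X0 : (0 : R) < #|X i|%:R by rewrite ltr0n; have [] := act i.
  rewrite divr_ge0 // ?ler0n //= ler_pdivrMr //.
  rewrite /Y; case: ifPn => [_|/asboolPn//].
  have cardE : #|~: Y0 i|%:R = #|X i|%:R - #|Y0 i|%:R :> R.
    by rewrite -(cardsC (Y0 i)) natrD addrC addKr.
  by rewrite cardE lerBlDr -lerBlDl; move: cY; rewrite mulrBl mul1r.
Qed.

End Frame.

(** * Charts and the graph metric *)

Section Charts.
Variables (R : realType) (G : groupType) (S : set G).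
Variables (X : nat -> finType) (sigma : forall i, G -> {perm X i}).
Arguments sigma : clear implicits.
Variables (m : nat -> nat) (Y : forall i, {set X i}).
Hypothesis fr : frame R S sigma m Y.

Lemma frame_id i x : x \in Y i -> sigma i 1%g x = x.
Proof.
move=> Yx; apply: (@perm_inj _ (sigma i 1%g)).
by rewrite (frame_mul fr Yx) ?mulg1 //; exact: word_ball_id.
Qed.

(** Freeness is required at the identity only; it gives injectivity of the orbit map
through the quotient [h^-1 * g], twice as long as [g] and [h]. *)
Lemma orbit_inj i x g h : x \in Y i -> word_ball S (2 * m i) g ->
  word_ball S (2 * m i) h -> sigma i g x = sigma i h x -> g = h.
Proof.
move=> Yx Bg Bh gh.
have B4 k : word_ball S (2 * m i) k -> word_ball S (4 * m i) k.
  by apply: word_ball_sub; rewrite leq_mul2r orbT.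
suff /(congr1 (mulg h)) : (h^-1 * g = 1)%g by rewrite mulKVg mulg1.
apply: (frame_free fr Yx).
  rewrite (_ : (4 * m i = 2 * m i + 2 * m i)%N); last by rewrite -mulnDl.
  by apply: word_ballM => //; exact: word_ballV.
rewrite -(frame_mul fr Yx) ?gh; [|exact/B4/word_ballV|exact/B4].
rewrite (frame_mul fr Yx) ?mulVg ?(frame_id Yx) //; last exact/B4.
exact/B4/word_ballV.
Qed.

(** A point in a charted region is reached from a nearby one by exactly one short
group element; the default value 1 is met outside these regions only. *)
Definition chart i (x y : X i) : G :=
  xget 1%g [set h | word_ball S (m i) h /\ sigma i h x = y].

Lemma chartE i x g h : x \in Y i -> word_ball S (m i) g -> word_ball S (m i) h ->
  chart (sigma i g x) (sigma i (h * g)%g x) = h.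
Proof.
move=> Yx Bg Bh.
have B4 k : word_ball S (m i) k -> word_ball S (4 * m i) k.
  by apply: word_ball_sub; rewrite leq_pmull.
have B2 k : word_ball S (m i) k -> word_ball S (2 * m i) (k * g)%g.
  by move=> Bk; rewrite mul2n -addnn; exact: word_ballM.
rewrite /chart; case: xgetP => [h' -> /= [Bh' h'E]|/(_ h) /=]; last first.
  by case; split => //; rewrite (frame_mul fr Yx) //; exact: B4.
apply: (mulIg g); apply: (orbit_inj Yx (B2 _ Bh') (B2 _ Bh)).
by rewrite -(frame_mul fr Yx) //; exact: B4.
Qed.

Hypothesis conn : graphs_connected sigma S.
Variable d : graph_space X -> graph_space X -> R.
Hypothesis dP : space_metric sigma S d.

Lemma dist_sym p q : d p q = d q p.
Proof. by case: dP => -[]. Qed.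

Lemma dist_path i (x : X i) p : path (edge sigma S (i := i)) x p ->
  d (in_space x) (in_space (last x p)) <= (size p)%:R.
Proof.
case: dP => _ dE _ pp; rewrite dE /edge_dist; apply: ge_inf.
  by exists 0 => _ [n _ <-]; exact: ler0n.
by exists (size p) => //; exists p.
Qed.

Lemma path_dist i (x y : X i) (k : nat) :
  d (in_space x) (in_space y) <= k%:R ->
  exists p, [/\ path (edge sigma S (i := i)) x p, last x p = y &
    (size p <= k)%N].
Proof.
case: dP => _ dE _; rewrite dE /edge_dist => dk.
set A := (X in inf X) in dk.
have [p0 pp0 lp0] := connectP (conn x y).
have A0 : has_inf A.
  split; first by exists (size p0)%:R, (size p0) => //; exists p0.
  by exists 0 => _ [n _ <-]; exact: ler0n.
have [_ [n [p [pp lp sp]] <-] ltn] := inf_adherent (ltr01 : (0 : R) < 1) A0.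
exists p; split => //; rewrite sp -ltnS -(ltr_nat R) -[k.+1]addn1 natrD.
by apply: lt_le_trans ltn _; rewrite lerD2r.
Qed.

(** Each letter of [h] labels an edge or a loop of the orbit, because the action is
multiplicative along the way. *)
Lemma dist_orbit i x a b g h : x \in Y i -> (a + b <= 4 * m i)%N ->
  word_ball S a g -> word_ball S b h ->
  d (in_space (sigma i g x)) (in_space (sigma i (h * g)%g x)) <= b%:R.
Proof.
move=> Yx + Bg; have [[d_ge0 d_eq0 _ tri] _ _] := dP.
elim: b h => [|b IH] h ab /=.
  by move=> ->; rewrite mul1g (d_eq0 _ _).2.
move=> [t Lt [h' Bh' <-]].
have ab' : (a + b <= 4 * m i)%N by lia.
apply: (le_trans (tri _ (in_space (sigma i (h' * g)%g x)) _)).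
rewrite -natr1 lerD //; first exact: IH.
have [m0|m_gt0] := posnP (m i).
  by move: ab; rewrite m0 muln0; case: (a) => //; lia.
have Bhg : word_ball S (a + b) (h' * g)%g by rewrite addnC; exact: word_ballM.
have Bthg : word_ball S (a + b).+1 (t * (h' * g))%g.
  exact: (word_ballM (word_ball_letter Lt) Bhg).
have Bt : word_ball S (4 * m i) t by apply: word_ball_sub (word_ball_letter Lt); lia.
have B4hg : word_ball S (4 * m i) (h' * g)%g by exact: word_ball_sub Bhg.
have B4thg : word_ball S (4 * m i) (t * (h' * g))%g by apply: word_ball_sub Bthg; lia.
rewrite -mulgA; case: Lt => [t1|Lt].
  by rewrite t1 mul1g (d_eq0 _ _).2.
have e : edge sigma S (sigma i (h' * g)%g x) (sigma i (t * (h' * g))%g x).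
  apply/asboolP; case: Lt => St; [exists t => //; left|exists (t^-1)%g => //; right].
    by rewrite (frame_mul fr Yx).
  by rewrite (frame_mul fr Yx) ?mulKg //; exact: word_ballV.
by apply: (@dist_path i _ [:: _]); rewrite /= e.
Qed.

(** Conversely a path of edges that starts in a charted region spells a word, letter
by letter. Together with [dist_orbit], this identifies balls of the graph with
balls of the group. *)
Lemma orbit_dist i x a b g y : x \in Y i -> (a + b <= 4 * m i)%N ->
  word_ball S a g -> d (in_space (sigma i g x)) (in_space y) <= b%:R ->
  exists2 h, word_ball S b h & y = sigma i (h * g)%g x.
Proof.
move=> Yx ab Bg /path_dist[p [pp <- sp]] {y}.
suff [h Bh ->] : exists2 h, word_ball S (size p) h &
    last (sigma i g x) p = sigma i (h * g)%g x.
  by exists h => //; exact: word_ball_sub Bh.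
have {sp}ab : (a + size p <= 4 * m i)%N by lia.
elim: p a g Bg pp ab => [|y p IH] a g Bg /=.
  by exists 1%g => //; rewrite mul1g.
move=> /andP[/asboolP[s Ss sy] pp ab].
have B4g : word_ball S (4 * m i) g by apply: word_ball_sub Bg; lia.
have [t Lt yE] : exists2 t, letter S t & y = sigma i (t * g)%g x.
  have Bs : word_ball S 1 s by apply: word_ball_letter; right; left.
  have B4s : word_ball S (4 * m i) s by apply: word_ball_sub Bs; lia.
  have BV : word_ball S (4 * m i) (s^-1 * g)%g.
    by apply: (@word_ball_sub _ _ (1 + a)); [lia|apply: word_ballM => //; exact: word_ballV].
  case: sy => sy; [exists s|exists (s^-1)%g].
  - by right; left.
  - by rewrite -sy (frame_mul fr Yx).
  - by right; right; rewrite invgK.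
  - apply: (@perm_inj _ (sigma i s)); rewrite sy (frame_mul fr Yx) //.
    by rewrite mulKVg.
have Btg : word_ball S a.+1 (t * g)%g := word_ballM (word_ball_letter Lt) Bg.
rewrite yE in pp *; have [|h Bh ->] := IH _ _ Btg pp; first lia.
exists (h * t)%g; last by rewrite mulgA.
by have := word_ballM Bh (word_ball_letter Lt); rewrite addn1.
Qed.

(** The distance between different graphs tends to infinity, so a ball of radius [r]
around a point of [X i] stays in [X i] once [i] is large. *)
Lemma near_separated (r : R) : \forall i \near \oo, forall (x : X i) q,
  d (in_space x) q <= r -> exists y : X i, q = in_space y.
Proof.
case: dP => _ _ /(_ (r + 1))[N sepN].
apply: filterS (nbhs_infty_ge N) => i leNi x [j y] dxy.
have [ij|ij] := eqVneq i j; first by subst j; exists y.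
have := sepN i j (elimN eqP ij) (leq_trans leNi (leq_addr _ _)) x y.
by rewrite leNgt (le_lt_trans dxy) // ltrDl.
Qed.

(** The degrees of the graphs are bounded by the number of generators and of their
inverses. *)
Lemma card_metric_ball (k : nat) : finite_set S -> exists D : nat,
  forall i (x : X i), (#|[set y : X i | (d (in_space x) (in_space y) <= k%:R)%R]%SET| <= D)%N.
Proof.
move=> /finite_seqP[s SE].
pose nb i (x : X i) : {set X i} :=
  [set y in x :: [seq sigma i g x | g <- s] ++ [seq (sigma i g)^-1%g x | g <- s]]%SET.
have nb_card i x : (#|nb i x| <= (size s + size s).+1)%N.
  by rewrite cardsE (leq_trans (card_size _)) //= size_cat !size_map.
have nb_edge i x y : edge sigma S x y -> y \in nb i x.
  move=> /asboolP[g]; rewrite SE /= => sg gxy; rewrite inE in_cons mem_cat.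
  case: gxy => gxy; apply/orP; right; apply/orP; [left|right]; apply/mapP.
    by exists g.
  by exists g => //; rewrite -gxy permK.
pose fix reach k i (x : X i) {struct k} : {set X i} :=
  if k is l.+1 then (\bigcup_(y in nb i x) reach l i y)%SET else [set x]%SET.
exists ((size s + size s).+1 ^ k)%N => i x.
apply: (@leq_trans #|reach k i x|).
  apply: subset_leq_card; apply/fintype.subsetP => y; rewrite inE => /path_dist.
  move=> [p [pp <- sp]] {y}.
  elim: k p x pp sp => [|k IH] [|y p] x //=; rewrite ?inE //.
    move=> _ _; apply/bigcupP; exists x; first by rewrite inE mem_head.
    exact: (IH [::] x).
  move=> /andP[xy pp] sp; apply/bigcupP; exists y; first exact: nb_edge.
  exact: IH.
elim: k x => [|k IH] x /=; first by rewrite cards1.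
apply: (@leq_trans (\sum_(y in nb i x) #|reach k i y|)).
  elim/big_rec2: _ => [|y n A _ IHA]; first by rewrite cards0.
  by rewrite (leq_trans (leq_card_setU _ _)) // leq_add2l.
apply: (@leq_trans (\sum_(y in nb i x) (size s + size s).+1 ^ k)).
  by apply: leq_sum => y _; exact: IH.
by rewrite sum_nat_const expnS leq_mul2r nb_card orbT.
Qed.

End Charts.

(** * Ultralimits of real sequences *)

Section UltraLimit.
Variables (R : realType) (w : set_system nat).
Hypothesis wU : UltraFilter w.

(** An interval is compact, so the image ultrafilter of a bounded sequence has a
cluster point, and an ultrafilter converges to each of its cluster points. *)
Lemma ultra_cvg (u : nat -> R) (M : R) :
  (\forall i \near w, `|u i| <= M) -> exists l : R, u i @[i --> w] --> l.
Proof.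
move=> uM; have cM := @segment_compact R (- M) M.
have /cM[l [_ cl]] : (u i @[i --> w]) [set` `[- M, M]].
  by apply: filterS uM => i; rewrite /= in_itv /= -ler_norml.
exists l => A Al /=; have [//|nA] := in_ultra_setVsetC (u @^-1` A) wU.
have [y [nAy Ay]] := cl (~` A) A nA Al; by [].
Qed.

Definition ulim (u : nat -> R) : R := xget 0 [set l : R | u i @[i --> w] --> l].

Lemma cvg_ulim (u : nat -> R) (M : R) :
  (\forall i \near w, `|u i| <= M) -> u i @[i --> w] --> ulim u.
Proof.
by move=> /ultra_cvg[l ul]; rewrite /ulim; case: xgetP => [x _ //|/(_ l)].
Qed.

Lemma ulimE (u : nat -> R) (l : R) : u i @[i --> w] --> l -> ulim u = l.
Proof.
move=> ul; rewrite /ulim; case: xgetP => [x _ /= ux|/(_ l)//].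
exact: cvg_unique ux ul.
Qed.

End UltraLimit.

Lemma near_eq_lim (R : realType) (F : set_system nat) (u v : nat -> R) (l : R) :
  Filter F -> (\forall i \near F, u i = v i) -> v i @[i --> F] --> l ->
  u i @[i --> F] --> l.
Proof.
by move=> FF uv; apply: cvg_trans; apply: near_eq_cvg; apply: filterS uv => i ->.
Qed.

(** * Averages over the finite sets *)

Section Averages.
Variables (R : realType) (G : groupType) (S : set G).
Variables (X : nat -> finType) (sigma : forall i, G -> {perm X i}).
Arguments sigma : clear implicits.
Variables (m : nat -> nat) (Y : forall i, {set X i}).
Hypothesis fr : frame R S sigma m Y.

Lemma sum_subset_close (T : finType) (A B : {set T}) (f : T -> R) (C : R) :
  0 <= C -> (forall x, x \in A -> `|f x| <= C) ->
  (forall x, x \in B -> `|f x| <= C) ->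
  `|\sum_(x in A) f x - \sum_(x in B) f x| <= C * (#|~: A| + #|~: B|)%:R.
Proof.
move=> C0 fA fB.
have bd (D : {set T}) (E : {set T}) : (forall x, x \in D -> `|f x| <= C) ->
    `|\sum_(x in D :\: E) f x| <= C * #|~: E|%:R.
  move=> fD; apply: le_trans (ler_norm_sum _ _ _) _.
  apply: (@le_trans _ _ (\sum_(x in D :\: E) C)).
    by apply: ler_sum => x; rewrite inE => /andP[_ Dx]; exact: fD.
  rewrite sumr_const -[leLHS]mulr_natr ler_wpM2l // ler_nat subset_leq_card //.
  by apply/fintype.subsetP => x; rewrite !inE => /andP[].
rewrite (big_setID B) [X in _ - X](big_setID A) /= (finset.setIC B A).
rewrite opprD addrACA subrr add0r natrD mulrDr addrC.
rewrite (le_trans (ler_normD _ _)) // lerD //; last exact: bd.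
by rewrite normrN; exact: bd.
Qed.

(** The two sums range over [sigma i h @: Y i] and [Y i], which both have density
tending to 1; they can differ only on the complements. *)
Lemma cvg_translate (h : G) (f : forall i, X i -> R) (C : R) : 0 <= C ->
  (\forall i \near \oo, forall x, x \in Y i ->
    `|f i x| <= C /\ `|f i (sigma i h x)| <= C) ->
  (\sum_(x in Y i) f i (sigma i h x) - \sum_(x in Y i) f i x) / #|X i|%:R
    @[i --> \oo] --> (0 : R).
Proof.
move=> C0 fC; apply/cvgr0Pnorm_le => e e0.
have e' : 0 < e / (2 * (C + 1)) by rewrite divr_gt0 // mulr_gt0 // ltr_wpDl.
apply: filterS2 fC (cvgr0_norm_le _ (frame_density fr) _ e') => i fiC.
have X0 : (0 : R) < #|X i|%:R by rewrite ltr0n (frame_card fr).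
rewrite /= !normrM !normfV (ger0_norm (ltW X0)) (ger0_norm (ler0n _ _)).
rewrite !ler_pdivrMr // => dens.
have -> : \sum_(x in Y i) f i (sigma i h x) =
    \sum_(x in sigma i h @: Y i) f i x.
  by rewrite big_imset //= => x y _ _; exact: perm_inj.
have cardE : #|~: (sigma i h @: Y i)| = #|~: Y i|.
  have := cardsC (Y i); rewrite -(cardsC (sigma i h @: Y i)).
  by rewrite (card_imset _ (@perm_inj _ (sigma i h))) => /addnI ->.
apply: le_trans (sum_subset_close C0 _ _) _ => [x|x|].
- by move=> /imsetP[y Yy ->]; have [] := fiC y Yy.
- by move=> Yx; have [] := fiC x Yx.
rewrite cardE natrD.
set n := #|~: Y i|%:R in dens *; set N := #|X i|%:R in dens X0 *.
have n0 : 0 <= n := ler0n _ _.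
have eE : e / (2 * (C + 1)) * N = e * N / (2 * (C + 1)) by rewrite mulrAC.
move: dens; rewrite eE ler_pdivlMr; last by rewrite mulr_gt0 // ltr_wpDl.
nra.
Qed.

End Averages.

(** * Sums supported in one graph *)

Section Components.
Variable X : nat -> finType.

Lemma in_space_inj i : injective (@in_space X i).
Proof. by move=> x y xy; exact: existT_inj2 xy. Qed.

(** The sums over the whole space which define the product and the action of
matrices reduce to finite sums over a single graph. *)
Lemma fsbig_component (T : Type) (idx : T) (op : Monoid.com_law idx) i
    (F : graph_space X -> T) :
  (forall q, F q <> idx -> exists y : X i, q = in_space y) ->
  \big[op/idx]_(q \in [set: graph_space X]) F q =
    \big[op/idx]_(y : X i) F (in_space y).
Proof.
move=> Fsupp; rewrite (@fsbigE _ _ _ _ _ [seq in_space y | y <- index_enum (X i)]) //.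
- by rewrite big_map; apply: eq_bigl => y; rewrite in_setT.
- by rewrite map_inj_uniq ?index_enum_uniq //; exact: in_space_inj.
- move=> q _ /negP nq; apply: contrapT => /Fsupp[y qE]; apply: nq.
  by rewrite qE map_f // mem_index_enum.
Qed.

Lemma esum_component (R : realType) i (f : graph_space X -> R) :
  (forall q, 0 <= f q) -> (forall q, f q <> 0 -> exists y : X i, q = in_space y) ->
  (\esum_(q in [set: graph_space X]) (f q)%:E)%E = (\sum_(y : X i) f (in_space y))%:E.
Proof.
move=> f0 fsupp; pose A : set (graph_space X) := range (@in_space X i).
have finA : finite_set A by exact/finite_image/finite_finset.
rewrite (_ : esum _ _ = esum A (fun q => (f q)%:E)); last first.
  rewrite [RHS]esum_mkcond; apply: eq_esum => q _; case: ifPn => // /negP nAq.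
  have [//|/eqP/fsupp[y qE]] := eqVneq (f q) 0; first by move=> ->.
  by exfalso; apply: nAq; rewrite inE qE; exists y.
rewrite esum_fset //; last by move=> q _; rewrite lee_fin.
rewrite fsbig_image; last by move=> x y _ _; exact: in_space_inj.
rewrite -sumEFin (@fsbigE _ _ _ _ _ (index_enum (X i))) ?index_enum_uniq //.
  by apply: eq_bigl => y; rewrite in_setT.
by move=> y _ /negP[]; rewrite mem_index_enum.
Qed.

End Components.

(** * Property A and amenability *)

Section Amenable.
Variables (R : realType) (G : groupType) (S : set G).
Variables (X : nat -> finType) (sigma : forall i, G -> {perm X i}).
Arguments sigma : clear implicits.
Variables (m : nat -> nat) (Y : forall i, {set X i}).
Hypothesis fr : frame R S sigma m Y.
Hypotheses (finS : finite_set S) (genS : generates S).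
Hypothesis conn : graphs_connected sigma S.
Variable d : graph_space X -> graph_space X -> R.
Hypothesis dP : space_metric sigma S d.

Record finitely_additive_probability (mu : set G -> R) : Prop := {
  fap_ge0 : forall A, 0 <= mu A;
  fap_setT : mu setT = 1;
  fap_additive : forall A B, A `&` B = set0 -> mu (A `|` B) = mu A + mu B }.

(** The measure of [A] is the average over [x] of
[\sum_(y | A (chart x y)^-1) eta x y]. If [x' = h^-1 x], then
[chart x' y = chart x y * h], so that the term of [h A] at [x] counts the same [y]
as the term of [A] at [x'], and the two differ by the distance from [eta x] to
[eta x'] at most. Averaging over [x] and over [x'] is the same since [sigma i h^-1]
is a permutation. *)
Lemma almost_invariant_mean (e : R) : 0 < e -> property_A d ->
  exists2 mu, finitely_additive_probability mu &
    forall h A, letter S h ->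
      `|mu [set (h * a)%g | a in A] - mu A| <= e.
Proof.
move=> e0 /(_ 1 (e / 2) ltr01 (divr_gt0 e0 (ltr0Sn _ 1))).
move=> [s [eta [s0 eta_prob eta_supp eta_lip]]].
have [k sk] : exists k : nat, s <= k%:R.
  by exists (Num.trunc `|s|).+1; rewrite (le_trans (ler_norm s)) // ltW // truncnS_gt.
have [i [km [sep dens]]] : exists i, (k.+1 <= m i)%N /\
    (forall (x : X i) q, d (in_space x) q <= s -> exists y : X i, q = in_space y) /\
    #|~: Y i|%:R / #|X i|%:R <= e / 2.
  have dens : \forall i \near \oo, `|#|~: Y i|%:R / #|X i|%:R| <= e / 2.
    exact: cvgr0_norm_le (frame_density fr) _ (divr_gt0 e0 (ltr0Sn _ 1)).
  apply: (@filter_ex _ \oo).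
  apply: filterS3 (frame_radius fr k.+1) (near_separated dP s) dens => i km sep.
  by move=> /(le_trans (ler_norm _)).
have X0 : (0 : R) < #|X i|%:R by rewrite ltr0n (frame_card fr).
pose eta' (x y : X i) := eta (in_space x) (in_space y).
have eta0 p q : 0 <= eta p q := (eta_prob p).1 q.
have eta'0 x y : 0 <= eta' x y by exact: eta0.
have eta'1 x : \sum_y eta' x y = 1.
  have := (eta_prob (in_space x)).2.
  rewrite (@esum_component X R i) // => [[]//|q /eta_supp]; exact: sep.
have eta'_lip x y : d (in_space x) (in_space y) <= 1 ->
    \sum_z `|eta' x z - eta' y z| <= e / 2.
  move=> /(eta_lip (in_space x) (in_space y)).
  rewrite (@esum_component X R i) ?lee_fin // => q /eqP.
  rewrite normr_eq0 subr_eq0 => neq.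
  have [xq0|/eqP/eta_supp/sep//] := eqVneq (eta (in_space x) q) 0.
  by move: neq; rewrite xq0 eq_sym => /eqP/eta_supp/sep.
pose f (A : set G) x : R := \sum_y eta' x y * `[< A (chart S sigma m x y)^-1%g >]%:R.
have f0 A x : 0 <= f A x by apply: sumr_ge0 => y _; rewrite mulr_ge0.
have f1 A x : f A x <= 1.
  rewrite -(eta'1 x); apply: ler_sum => y _; rewrite ler_piMr //.
  by case: `[< _ >].
exists (fun A => (\sum_x f A x) / #|X i|%:R).
  split=> [A||A B AB].
  - by rewrite divr_ge0 ?(ltW X0) //; apply: sumr_ge0.
  - rewrite (eq_bigr (fun=> 1)) => [|x _]; last first.
      by rewrite -(eta'1 x); apply: eq_bigr => y _; rewrite asboolT ?mulr1.
    by rewrite sumr_const -[#|_| in LHS]/#|X i| divff // gt_eqF.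
  - rewrite -mulrDl -big_split /=; congr (_ / _); apply: eq_bigr => x _.
    rewrite -big_split /=; apply: eq_bigr => y _; rewrite -mulrDr; congr (_ * _).
    rewrite asbool_or; set a := (X in `[< A X >]).
    have [Aa|nAa] := asboolP (A a); have [Ba|nBa] := asboolP (B a);
      rewrite ?addr0 ?add0r //.
    by have : (A `&` B) a by []; rewrite AB.
move=> h A Lh.
have -> : \sum_x f A x = \sum_x f A (sigma i h^-1%g x).
  by rewrite (reindex_inj (@perm_inj _ (sigma i h^-1%g))).
rewrite -mulrBl -sumrB normrM normfV (gtr0_norm X0) ler_pdivrMr //.
have good x : x \in Y i ->
    `|f [set (h * a)%g | a in A] x - f A (sigma i h^-1%g x)| <= e / 2.
  move=> Yx; pose x' := sigma i h^-1%g x.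
  have dxx' : d (in_space x) (in_space x') <= 1.
    rewrite -{1}(frame_id fr Yx) /x' -(mulg1 h^-1%g).
    apply: (dist_orbit fr dP (a := 0) (b := 1) Yx) => //; first by lia.
    exact/word_ball_letter/letterV.
  apply: le_trans (eta'_lip _ _ dxx'); rewrite -sumrB.
  apply: le_trans (ler_norm_sum _ _ _) _; apply: ler_sum => y _.
  have [ex0|/eqP/eta_supp dxy] := eqVneq (eta' x y) 0.
    rewrite ex0 mul0r !sub0r !normrN normrM ler_piMr //.
    by case: `[< _ >]; rewrite ?normr1 ?normr0.
  have dxyk := le_trans dxy sk.
  have d1 : d (in_space (sigma i 1%g x)) (in_space y) <= k%:R.
    by rewrite (frame_id fr Yx).
  have k4 : (0 + k <= 4 * m i)%N by lia.
  have [g Bg] := orbit_dist fr conn dP Yx k4 (erefl 1%g) d1; rewrite mulg1 => yE.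
  have cxy : chart S sigma m x y = g.
    rewrite yE -{1}(frame_id fr Yx) -(mulg1 g) (chartE fr) ?mulg1 //.
      exact: word_ball_id.
    by apply: word_ball_sub Bg; lia.
  have Bh : word_ball S (m i) h^-1%g.
    by apply: word_ball_sub (word_ball_letter (letterV Lh)); lia.
  have cx'y : chart S sigma m x' y = (g * h)%g.
    rewrite yE /x' -{1}(mulgK h g) (chartE fr) //.
    by have := word_ballM Bg (word_ball_letter Lh); apply: word_ball_sub; lia.
  have -> : `[< [set (h * a)%g | a in A] (chart S sigma m x y)^-1%g >] =
            `[< A (chart S sigma m x' y)^-1%g >].
    apply: asbool_equiv_eq; rewrite cxy cx'y invgM; split => [[a Aa <-]|Ahg].
      by rewrite mulKg.
    by exists (h^-1 * g^-1)%g => //; rewrite mulKVg.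
  rewrite -mulrBl normrM ler_piMr //.
  by case: `[< _ >]; rewrite ?normr1 ?normr0.
apply: le_trans (ler_norm_sum _ _ _) _; rewrite (bigID (mem (Y i))) /=.
have -> : e * #|X i|%:R = e / 2 * #|X i|%:R + e / 2 * #|X i|%:R by field.
apply: lerD.
  apply: (@le_trans _ _ (\sum_(x in Y i) e / 2)); first exact: ler_sum.
  rewrite sumr_const -[leLHS]mulr_natr ler_wpM2l ?ler_nat ?max_card //.
  by rewrite divr_ge0 ?ltW.
apply: (@le_trans _ _ (\sum_(x in ~: Y i) 1)).
  rewrite (eq_bigl (fun x => x \in ~: Y i)) => [|x]; last by rewrite inE.
  apply: ler_sum => x _; rewrite ler_norml; have := f0 A (sigma i h^-1%g x).
  have := f1 A (sigma i h^-1%g x); have := f0 [set (h * a)%g | a in A] x.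
  have := f1 [set (h * a)%g | a in A] x; lra.
by rewrite sumr_const -ler_pdivrMr.
Qed.

Variables (w : set_system nat).
Hypotheses (wU : UltraFilter w) (oow : \oo `<=` w).

(** A measure is determined by its values, which lie in [0, 1]; the limits of the
values along an ultrafilter give an exactly invariant measure. *)
Lemma amenable_of_almost_invariant :
  (forall e : R, 0 < e -> exists2 mu, finitely_additive_probability mu &
    forall h A, letter S h -> `|mu [set (h * a)%g | a in A] - mu A| <= e) ->
  amenable R G.
Proof.
move=> ex_mean; have wF : Filter w by exact: _.
have {}ex_mean (n : nat) : exists mu, finitely_additive_probability mu /\
    forall h A, letter S h ->
      `|mu [set (h * a)%g | a in A] - mu A| <= n.+1%:R^-1.
  have [|mu] := ex_mean n.+1%:R^-1; first by rewrite invr_gt0.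
  by exists mu.
have [nu nuP] := choice ex_mean.
have nu0 n A : 0 <= nu n A by have [[]] := nuP n.
have nuT n : nu n setT = 1 by have [[]] := nuP n.
have nuU n A B : A `&` B = set0 -> nu n (A `|` B) = nu n A + nu n B.
  by have [[_ _ addn] _] := nuP n; exact: addn.
have nu1 n A : nu n A <= 1.
  by rewrite -(nuT n) -(setUCr A) nuU ?setICr // lerDl.
pose mu A := ulim w (nu^~ A).
have mu_cvg A : nu n A @[n --> w] --> mu A.
  apply: (@cvg_ulim R w wU _ 1); apply: nearW => n.
  by rewrite ger0_norm.
have mu_letter h A : letter S h -> mu [set (h * a)%g | a in A] = mu A.
  move=> Lh; apply: (cvg_unique _ (mu_cvg _)) => //.
  have inv0 : (n.+1%:R^-1 : R) @[n --> w] --> (0 : R).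
    by apply: cvg_trans (@cvg_harmonic R); exact: cvg_app.
  have diff0 : nu n [set (h * a)%g | a in A] - nu n A @[n --> w] --> (0 : R).
    apply/cvgr0Pnorm_le => e e0; have := cvgr0_norm_le _ inv0 _ e0.
    move=> /(_ wF); apply: filterS => n; apply: le_trans.
    rewrite [leRHS]ger0_norm ?invr_ge0 //; exact: (nuP n).2.
  have := @cvgD _ _ _ _ wF _ _ _ _ diff0 (mu_cvg A); rewrite add0r.
  by apply: near_eq_lim; apply: nearW => n /=; rewrite subrK.
exists mu; split.
- by move=> A; apply: (cvgr_to_ge (mu_cvg A)); exact: nearW.
- by apply: (ulimE wU); under eq_fun do rewrite nuT; exact: cvg_cst.
- move=> A B AB; apply: (ulimE wU).
  have := @cvgD _ _ _ _ wF _ _ _ _ (mu_cvg A) (mu_cvg B).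
  by apply: near_eq_lim; apply: nearW => n; rewrite nuU.
- move=> g A; have [k] := word_ball_cover g genS.
  elim: k g A => [|k IH] g A /=.
    move=> ->; congr mu; apply/seteqP; split=> [a [b Ab <-]|a Aa].
      by rewrite mul1g.
    by exists a; rewrite ?mul1g.
  move=> [t Lt [g' Bg' <-]]; rewrite -(IH g' A Bg') -(mu_letter t [set (g' * a)%g | a in A] Lt).
  congr mu; apply/seteqP; split=> [x [a Aa <-]|x [y [a Aa <-] <-]].
    by exists (g' * a)%g; [exists a|rewrite mulgA].
  by exists a; rewrite ?mulgA.
Qed.

Theorem amenable_of_property_A : property_A d -> amenable R G.
Proof.
by move=> pA; apply: amenable_of_almost_invariant => e e0; exact: almost_invariant_mean.
Qed.

End Amenable.

(** * Asymptotic embeddings and a-T-menability *)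

Section ATMenable.
Variables (R : realType) (G : groupType) (S : set G).
Variables (X : nat -> finType) (sigma : forall i, G -> {perm X i}).
Arguments sigma : clear implicits.
Variables (m : nat -> nat) (Y : forall i, {set X i}).
Hypothesis fr : frame R S sigma m Y.
Hypotheses (finS : finite_set S) (genS : generates S).
Hypothesis conn : graphs_connected sigma S.
Variable d : graph_space X -> graph_space X -> R.
Hypothesis dP : space_metric sigma S d.
Variables (w : set_system nat).
Hypotheses (wU : UltraFilter w) (oow : \oo `<=` w).

(** [psi g] is the ultralimit of the averages of [K i x (sigma i g x)] over the good
points. It is finite by the upper control function, and proper by the lower one,
since a word outside the ball of radius [T] moves good points by more than [T]. *)
Theorem a_T_menable_of_embedding :
  asymptotic_coarse_embedding d -> a_T_menable R G.
Proof.
move=> [rho1 [rho2 [K [Rad [[mon1 rho1oo] [mon2 _] Ksym [_ Radoo] HK]]]]].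
have Kle i x y := (HK i).1 x y; have Kneg i := (HK i).2.
have wF : Filter w by exact: _.
have d_ge0 p q : 0 <= d p q by case: dP => -[].
pose phi g i : R := (\sum_(x in Y i) K i x (sigma i g x)) / #|X i|%:R.
have X0 i : (0 : R) < #|X i|%:R by rewrite ltr0n (frame_card fr).
have radius k : \forall i \near w, (k <= m i)%N := oow (frame_radius fr k).
have lenP g := word_ball_cover g genS.
pose bnd k := `|rho1 0| + `|rho2 k%:R| : R.
have bnd0 k : 0 <= bnd k by rewrite addr_ge0.
have Kbnd i k (x y : X i) : d (in_space x) (in_space y) <= k%:R ->
    `|K i x y| <= bnd k.
  move=> dk; have /andP[lo hi] := Kle i x y.
  have lo' := le_trans (mon1 _ _ (lexx 0) (d_ge0 (in_space x) (in_space y))) lo.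
  have hi' := le_trans hi (mon2 _ _ (d_ge0 (in_space x) (in_space y)) dk).
  have := lerNnormlW (lexx `|rho1 0|); have := ler_norm (rho2 k%:R).
  rewrite /bnd ler_norml => h1 h2; have := normr_ge0 (rho1 0).
  have := normr_ge0 (rho2 k%:R); lra.
have orbit_near i k x g h : x \in Y i -> (k <= m i)%N -> word_ball S k g ->
    word_ball S k h ->
    d (in_space (sigma i g x)) (in_space (sigma i h x)) <= (2 * k)%:R.
  move=> Yx km Bg Bh; rewrite -[in leLHS](mulgKV g h).
  apply: (dist_orbit fr dP (a := k)) => //; first lia.
  by rewrite mul2n -addnn; apply: word_ballM => //; exact: word_ballV.
have point_near i k x g : x \in Y i -> (k <= m i)%N -> word_ball S k g ->
    d (in_space x) (in_space (sigma i g x)) <= k%:R.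
  move=> Yx km Bg; rewrite -{1}(frame_id fr Yx) -(mulg1 g).
  by apply: (dist_orbit fr dP (a := 0)) => //; lia.
have phi_bnd k g : word_ball S k g -> \forall i \near w, `|phi g i| <= bnd k.
  move=> Bg; apply: filterS (radius k) => i km.
  rewrite normrM normfV (ger0_norm (ltW (X0 i))) ler_pdivrMr //.
  apply: le_trans (ler_norm_sum _ _ _) _.
  apply: (@le_trans _ _ (\sum_(x in Y i) bnd k)).
    by apply: ler_sum => x Yx; apply: Kbnd; exact: point_near.
  by rewrite sumr_const -[leLHS]mulr_natr ler_wpM2l // ler_nat max_card.
pose psi g := ulim w (phi g).
have phi_cvg g : phi g i @[i --> w] --> psi g.
  by have [k Bg] := lenP g; exact: cvg_ulim (phi_bnd k g Bg).
have translate h (f : forall i, X i -> R) C : 0 <= C ->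
    (\forall i \near \oo, forall x, x \in Y i ->
      `|f i x| <= C /\ `|f i (sigma i h x)| <= C) ->
    (\sum_(x in Y i) f i (sigma i h x) - \sum_(x in Y i) f i x) / #|X i|%:R
      @[i --> w] --> (0 : R).
  by move=> C0 fC; apply: cvg_trans (cvg_translate fr C0 fC); exact: cvg_app.
(* Substituting h x for x in the averages which define psi g does not change
   their limit; this is how psi (a^-1 * b) becomes symmetric in a and b. *)
have phi_translate g h (u : nat -> R) k : word_ball S k g -> word_ball S k h ->
    (\forall i \near \oo, u i =
      (\sum_(x in Y i) K i (sigma i h x) (sigma i g (sigma i h x))) / #|X i|%:R) ->
    u i @[i --> w] --> psi g.
  move=> Bg Bh uE.
  have := translate h (fun i x => K i x (sigma i g x)) (bnd (2 * k)%N) (bnd0 _).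
  have /[swap] /[apply] : \forall i \near \oo, forall x, x \in Y i ->
      `|K i x (sigma i g x)| <= bnd (2 * k)%N /\
      `|K i (sigma i h x) (sigma i g (sigma i h x))| <= bnd (2 * k)%N.
    apply: filterS (frame_radius fr (2 * k)) => i km x Yx; split.
      apply: Kbnd; apply: point_near => //.
      by apply: word_ball_sub Bg; rewrite leq_pmull.
    apply: Kbnd; rewrite (frame_mul fr Yx) //; last 2 first.
      by apply: word_ball_sub Bg; lia.
      by apply: word_ball_sub Bh; lia.
    apply: le_trans (dist_orbit fr dP Yx _ Bh Bg) _; first lia.
    by rewrite ler_nat leq_pmull.
  move=> diff0; have := @cvgD _ _ _ _ wF _ _ _ _ diff0 (phi_cvg g).
  rewrite add0r; apply: near_eq_lim; apply: oow.
  apply: filterS uE => i ->; rewrite /phi /=.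
  by rewrite [RHS]addrC mulrBl addrC subrK.
exists psi; split.
- have -> : psi 1%g = ulim w (phi 1%g) by [].
  rewrite (_ : phi 1%g = fun=> 0); first exact: (ulimE wU (cvg_cst _)).
  apply/funext => i; rewrite /phi big1 ?mul0r // => x Yx.
  by rewrite (frame_id fr Yx) (Ksym i).2.
- move=> g; have [k Bg] := lenP g; have BgV := word_ballV Bg.
  have /(cvg_unique _ (phi_cvg _)) : phi (g^-1)%g i @[i --> w] --> psi g; last exact.
  apply: (phi_translate _ _ _ _ Bg BgV); apply: filterS (frame_radius fr k) => i km.
  congr (_ / _); apply: eq_bigr => x Yx; rewrite (Ksym i).1.
  by rewrite (frame_mul fr Yx) ?mulgV ?(frame_id fr Yx) //;
    [apply: word_ball_sub Bg|apply: word_ball_sub BgV]; lia.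
- move=> n g lambda sum0.
  have [k Bg] : exists k, forall a, word_ball S k (g a).
    have /choice[l Bl] a := lenP (g a); exists (\max_a l a)%N => a.
    exact: word_ball_sub (leq_bigmax a) _ (Bl a).
  have BgV a : word_ball S k (g a)^-1%g := word_ballV (Bg a).
  pose u a b i : R :=
    (\sum_(y in Y i) K i (sigma i (g b)^-1%g y) (sigma i (g a)^-1%g y)) / #|X i|%:R.
  have u_cvg a b : u a b i @[i --> w] --> psi ((g a)^-1 * g b)%g.
    apply: (phi_translate _ (g b)^-1%g _ (2 * k)%N).
    - by rewrite mul2n -addnn; exact: word_ballM.
    - by apply: word_ball_sub (BgV b); rewrite leq_pmull.
    apply: filterS (frame_radius fr (2 * k)) => i km.
    congr (_ / _); apply: eq_bigr => y Yy; congr (K i _ _).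
    rewrite (frame_mul fr Yy) ?mulgK //; apply: (@word_ball_sub _ _ (k + k)); try lia.
      exact: word_ballM.
    by apply: word_ball_sub (BgV b); lia.
  have U_cvg : (\sum_a \sum_b lambda a * lambda b * u a b i) @[i --> w] -->
      \sum_a \sum_b lambda a * lambda b * psi ((g a)^-1 * g b)%g.
    apply: cvg_big; first exact: add_continuous.
    move=> a _; apply: cvg_big; first exact: add_continuous.
    by move=> b _; apply: cvgMr; exact: u_cvg.
  have RadH : \forall i \near w, (2 * k)%:R <= Rad i.
    by apply: oow; move/cvgryPge: Radoo; apply.
  apply: (cvgr_to_le U_cvg); apply: filterS2 (radius k) RadH => i km {}RadH.
  have -> : \sum_a \sum_b lambda a * lambda b * u a b i =
      (\sum_(y in Y i) \sum_a \sum_b lambda a * lambda b *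
         K i (sigma i (g a)^-1%g y) (sigma i (g b)^-1%g y)) / #|X i|%:R.
      rewrite [in RHS]exchange_big /= mulr_suml; apply: eq_bigr => a _.
      rewrite [in RHS]exchange_big /= mulr_suml; apply: eq_bigr => b _.
      rewrite -mulr_sumr -[in RHS]mulrA; congr (_ * (_ / _)).
      by apply: eq_bigr => y _; rewrite (Ksym i).1.
  rewrite pmulr_lle0 ?invr_gt0 //; apply: sumr_le0 => y Yy.
  by apply: Kneg => // a b; apply: le_trans RadH; exact: orbit_near.
- move=> M; have [T HT] : exists T : nat, `|M| + 1 <= rho1 T%:R.
    move/cvgryPge: rho1oo => /(_ (`|M| + 1))[t [_ Ht]].
    have [T tT] : exists T : nat, t < T%:R.
      by exists (Num.trunc `|t|).+1; rewrite (le_lt_trans (ler_norm t)) // truncnS_gt.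
    by exists T; exact: Ht.
  apply: (@sub_finite_set _ _ (word_ball S T)); last exact: finite_word_ball.
  move=> g /= psiM; apply: contrapT => nBg; have [k Bg] := lenP g.
  suff : `|M| + 1 <= psi g by have := ler_norm (psi g); have := ler_norm M; lra.
  have dens : (`|M| + 1) * (1 - #|~: Y i|%:R / #|X i|%:R) @[i --> w] -->
      (`|M| + 1) * (1 - 0).
    have dens0 : #|~: Y i|%:R / #|X i|%:R @[i --> w] --> (0 : R).
      by apply: cvg_trans (frame_density fr); exact: cvg_app.
    by apply: cvgMr; apply: cvgB => //; exact: cvg_cst.
  rewrite subr0 mulr1 in dens.
  apply: (ler_cvg_to dens (phi_cvg g)).
  apply: filterS2 (radius k) (radius T) => i km Tm.
  rewrite ler_pdivlMr // -mulrA mulrBl mul1r divfK ?gt_eqF //.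
  rewrite -(cardsC (Y i)) natrD addrK mulr_natr -sumr_const.
  apply: ler_sum => x Yx; apply: le_trans HT _.
  have /andP[lo _] := Kle i x (sigma i g x); apply: le_trans lo.
  apply: mon1; first exact: ler0n.
  rewrite leNgt; apply/negP => /ltW dT; apply: nBg.
  have d1T : d (in_space (sigma i 1%g x)) (in_space (sigma i g x)) <= T%:R.
    by rewrite (frame_id fr Yx).
  have T4 : (0 + T <= 4 * m i)%N by lia.
  have [h Bh] := orbit_dist fr conn dP Yx T4 (erefl 1%g) d1T.
  rewrite mulg1 => /(orbit_inj fr Yx) -> //.
    by apply: word_ball_sub Bg; lia.
  by apply: word_ball_sub Bh; lia.
Qed.

End ATMenable.

(** * Inner products and orthogonal projections *)

Lemma discriminant_le0 (R : realType) (a b c : R) : 0 <= c ->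
  (forall t, 0 <= a + 2 * b * t + c * t ^+ 2) -> b ^+ 2 <= a * c.
Proof.
rewrite le_eqVlt => /orP[/eqP <- pos|c0 pos].
  rewrite mulr0; have [->|b0] := eqVneq b 0; first by rewrite expr0n.
  have := pos (- (a + 1) / (2 * b)); rewrite mul0r addr0 mulrC divfK.
    by rewrite opprD addrA subrr add0r ler0N1.
  by rewrite mulf_neq0 // pnatr_eq0.
have := pos (- b / c).
have -> : a + 2 * b * (- b / c) + c * (- b / c) ^+ 2 = a - b ^+ 2 / c.
  by field; rewrite gt_eqF.
by rewrite subr_ge0 ler_pdivrMr.
Qed.

Section RealInner.
Variables (R : realType) (V : lmodType R[i]).
Local Notation "a *~: u" := ((a%:C)%C *: u) (at level 40).

(** Orthogonality and Cauchy-Schwarz are used for the real part of an inner product,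
which is linear over the reals; [W] is a subspace for all scalars. *)
Record semi_inner (W : set V) (q : V -> V -> R) : Prop := {
  subspace0 : W 0;
  subspaceP : forall a u v, W u -> W v -> W (a *: u + v);
  semi_innerC : forall u v, W u -> W v -> q u v = q v u;
  semi_innerP : forall a u v w, W u -> W v -> W w ->
    q (a *~: u + v) w = a * q u w + q v w;
  semi_inner_ge0 : forall u, W u -> 0 <= q u u }.

Lemma semi_inner_CS W q u v : semi_inner W q -> W u -> W v ->
  q u v ^+ 2 <= q u u * q v v.
Proof.
move=> qP Wu Wv; apply: discriminant_le0 => [|t]; first exact: semi_inner_ge0 qP _ Wv.
have Wtv : W (t *~: v + u) by exact: (subspaceP qP).
have := semi_inner_ge0 qP Wtv.
rewrite (semi_innerP qP) // (semi_innerC qP Wv) // (semi_innerC qP Wu Wtv).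
rewrite !(semi_innerP qP) // (semi_innerC qP Wv Wu).
by congr (_ <= _); ring.
Qed.

End RealInner.

Section HilbertGeometry.
Variables (R : realType) (H : hilbert R).
Local Notation "a *~: u" := ((a%:C)%C *: u) (at level 40).
Implicit Types u v w : H.

Definition rdot u v : R := complex.Re (hdot H u v).

Lemma hdotC u v : hdot H u v = Num.conj (hdot H v u).
Proof. by rewrite hermC expr0 mul1r. Qed.

Lemma Re_conj (z : R[i]) : complex.Re (Num.conj z) = complex.Re z.
Proof. by case: z. Qed.

Lemma rdotC u v : rdot u v = rdot v u.
Proof. by rewrite /rdot hdotC Re_conj. Qed.

Lemma ReM_real (a : R) (z : R[i]) : complex.Re (a%:C%C * z) = a * complex.Re z.
Proof. by case: z => x y /=; rewrite mul0r subr0. Qed.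

Lemma rdotDl u v w : rdot (u + v) w = rdot u w + rdot v w.
Proof. by rewrite /rdot linearDl raddfD. Qed.

Lemma rdotZl a u w : rdot (a *~: u) w = a * rdot u w.
Proof. by rewrite /rdot linearZl_LR ReM_real. Qed.

Lemma rdotNl u w : rdot (- u) w = - rdot u w.
Proof. by rewrite /rdot linearNl raddfN. Qed.

Lemma rdotDr u v w : rdot w (u + v) = rdot w u + rdot w v.
Proof. by rewrite !(rdotC w) rdotDl. Qed.

Lemma rdotNr u w : rdot w (- u) = - rdot w u.
Proof. by rewrite !(rdotC w) rdotNl. Qed.

Lemma rdotZr a u w : rdot w (a *~: u) = a * rdot w u.
Proof. by rewrite !(rdotC w) rdotZl. Qed.

Definition rdotE := (rdotDl, rdotDr, rdotNl, rdotNr, rdotZl, rdotZr).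

Lemma hdot_ge0 u : 0 <= hdot H u u.
Proof. exact: dnorm_ge0. Qed.

Lemma hdot_rdot u : hdot H u u = (rdot u u)%:C%C.
Proof. by have := ger0_Im (hdot_ge0 u); rewrite /rdot; case: (hdot H u u) => a b /= ->. Qed.

Lemma rdot_ge0 u : 0 <= rdot u u.
Proof. by have := hdot_ge0 u; rewrite hdot_rdot ler0c. Qed.

Lemma rdot_eq0 u : rdot u u = 0 -> u = 0.
Proof. by move=> u0; apply/eqP; rewrite -(dnorm_eq0 (hdot H)) hdot_rdot u0. Qed.

Lemma semi_inner_rdot : semi_inner setT rdot.
Proof.
split=> // [u v _ _|a u v w _ _ _|u _]; first exact: rdotC.
- by rewrite rdotDl rdotZl.
- exact: rdot_ge0.
Qed.

Lemma rdot_CS u v : rdot u v ^+ 2 <= rdot u u * rdot v v.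
Proof. exact: (semi_inner_CS semi_inner_rdot). Qed.

Lemma hnorm_sqrt u : hnorm u = Num.sqrt (rdot u u).
Proof. by []. Qed.

Lemma sqr_hnorm u : hnorm u ^+ 2 = rdot u u.
Proof. by rewrite sqr_sqrtr ?rdot_ge0. Qed.

Lemma hnorm_ge0 u : 0 <= hnorm u.
Proof. exact: sqrtr_ge0. Qed.

Lemma hnorm_opp u : hnorm (- u) = hnorm u.
Proof. by rewrite !hnorm_sqrt !rdotE opprK. Qed.

Lemma rdot_le_hnorm u v : `|rdot u v| <= hnorm u * hnorm v.
Proof.
rewrite -(@ler_pXn2r _ 2) ?nnegrE ?mulr_ge0 ?hnorm_ge0 //.
by rewrite real_normK ?num_real // exprMn !sqr_hnorm; exact: rdot_CS.
Qed.

Lemma hnorm_triangle u v : hnorm (u + v) <= hnorm u + hnorm v.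
Proof.
rewrite -(@ler_pXn2r _ 2) ?nnegrE ?addr_ge0 ?hnorm_ge0 //.
rewrite sqrrD !sqr_hnorm !rdotE (rdotC v u).
have := le_trans (ler_norm _) (rdot_le_hnorm u v); lra.
Qed.

Lemma hnorm_scale a u : hnorm (a *~: u) = `|a| * hnorm u.
Proof.
rewrite !hnorm_sqrt !rdotE mulrA -expr2 sqrtrM ?sqr_ge0 //.
by rewrite sqrtr_sqr.
Qed.

Lemma hnorm_eq0 u : hnorm u = 0 -> u = 0.
Proof. by move=> u0; apply: rdot_eq0; rewrite -sqr_hnorm u0 expr0n. Qed.

Lemma hnorm_distC u v : hnorm (u - v) = hnorm (v - u).
Proof. by rewrite -hnorm_opp opprB. Qed.

Definition hcvg (u : nat -> H) (l : H) : Prop :=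
  forall e : R, 0 < e -> exists N, forall n, (N <= n)%N -> hnorm (u n - l) < e.

Lemma hcomplete (u : nat -> H) :
  (forall e : R, 0 < e -> exists N : nat, forall m n : nat,
     (N <= m)%N -> (N <= n)%N -> rdot (u m - u n) (u m - u n) < e) ->
  exists l, hcvg u l.
Proof.
move=> cau; apply: hilbert_complete => e e0.
have [N HN] := cau (e ^+ 2) (exprn_gt0 2 e0); exists N => m n Nm Nn.
rewrite -(@ltr_pXn2r _ 2) ?nnegrE ?hnorm_ge0 ?(ltW e0) //.
by rewrite sqr_hnorm; exact: HN.
Qed.

(** A sequence in [W] which minimises the distance to [u0] is Cauchy by the
parallelogram law, and the first variation of the distance vanishes at its limit.
The approximating sequence replaces the mention of the closure of [W]. *)
Lemma orthogonal_projection (W : set H) (u0 : H) :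
  W 0 -> (forall a u v, W u -> W v -> W (a *~: u + v)) ->
  exists2 r, exists2 w : nat -> H, forall n, W (w n) & hcvg w r &
    forall v, W v -> rdot (u0 - r) v = 0.
Proof.
move=> W0 WP; pose nn u := rdot u u.
pose A := [set nn (u0 - w) | w in W]; pose dlt := inf A.
have Alb : lbound A 0 by move=> _ [w _ <-]; exact: rdot_ge0.
have Ainf : has_inf A by split; [exists (nn (u0 - 0)), 0 | exists 0].
have dlt_le w : W w -> dlt <= nn (u0 - w).
  by move=> Ww; apply: ge_inf; [exists 0|exists w].
have exw (n : nat) : exists w, W w /\ nn (u0 - w) < dlt + n.+1%:R^-1.
  have [|_ [w Ww <-] lt] := @inf_adherent _ A n.+1%:R^-1 _ Ainf.
    by rewrite invr_gt0.
  by exists w.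
have [w wP] := choice exw.
have WD u v : W u -> W v -> W (u + v).
  by move=> Wu Wv; rewrite -[u]scale1r; exact: (WP 1).
have WZ a u : W u -> W (a *~: u).
  by move=> Wu; rewrite -[_ *: u]addr0; exact: WP.
have small (e : R) : 0 < e -> exists N, forall n, (N <= n)%N -> n.+1%:R^-1 < e.
  move=> e0; exists (Num.trunc e^-1) => n Nn.
  rewrite invf_plt ?posrE //; apply: lt_le_trans (truncnS_gt _) _.
  by rewrite ler_nat.
have [r wr] : exists r, hcvg w r.
  apply: hcomplete => e e0.
  have [N HN] := small (e / 4) (divr_gt0 e0 (ltr0Sn _ 3)).
  exists N => m n /HN hm /HN hn.
  have [Wm lm] := wP m; have [Wn ln] := wP n.
  move: lm ln; set x := m.+1%:R^-1 in hm *; set y := n.+1%:R^-1 in hn *.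
  clearbody x y => lm ln.
  have Wmid : W (2^-1 *~: (w m + w n)) by apply: WZ; exact: WD.
  have := dlt_le _ Wmid; move: lm ln; rewrite /nn !rdotE.
  rewrite !(rdotC _ u0) (rdotC (w n) (w m)); lra.
exists r; first by exists w => // n; have [] := wP n.
move=> v Wv.
have ort n : rdot (u0 - w n) v ^+ 2 <= n.+1%:R^-1 * nn v.
  apply: discriminant_le0 => [|t]; first exact: rdot_ge0.
  have [Wn ln] := wP n; have := dlt_le _ (WD _ _ Wn (WZ (- t) _ Wv)).
  move: ln; rewrite /nn !rdotE !(rdotC _ u0) (rdotC v (w n)).
  set x := n.+1%:R^-1; clearbody x; nra.
apply/eqP; rewrite -normr_le0; apply/ler_addgt0Pr => e e0; rewrite add0r.
have e2 : 0 < e / 2 by rewrite divr_gt0.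
have v1 : 0 < hnorm v + 1 by rewrite ltr_wpDl ?hnorm_ge0.
have [N1 HN1] := wr (e / 2 / (hnorm v + 1)) (divr_gt0 e2 v1).
have [N2 HN2] := small ((e / 2 / (hnorm v + 1)) ^+ 2) (exprn_gt0 2 (divr_gt0 e2 v1)).
pose n := maxn N1 N2; have /HN1 h1 : (N1 <= n)%N by exact: leq_maxl.
have /HN2 h2 : (N2 <= n)%N by exact: leq_maxr.
have -> : u0 - r = (u0 - w n) + (w n - r) by rewrite addrA subrK.
rewrite rdotDl (le_trans (ler_normD _ _)) //.
have b1 : `|rdot (w n - r) v| <= e / 2.
  apply: le_trans (rdot_le_hnorm _ _) _.
  apply: (@le_trans _ _ (e / 2 / (hnorm v + 1) * (hnorm v + 1))).
    by apply: ler_pM; rewrite ?hnorm_ge0 // ?ltW // ltrDl.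
  by rewrite divfK // gt_eqF.
have b2 : `|rdot (u0 - w n) v| <= e / 2.
  rewrite -(@ler_pXn2r _ 2) ?nnegrE ?(ltW e2) // real_normK ?num_real //.
  apply: le_trans (ort n) _.
  apply: (@le_trans _ _ ((e / 2 / (hnorm v + 1)) ^+ 2 * (hnorm v + 1) ^+ 2)).
    apply: ler_pM; rewrite ?invr_ge0 ?rdot_ge0 ?(ltW h2) //.
    by rewrite /nn -sqr_hnorm ler_pXn2r ?nnegrE ?hnorm_ge0 ?(ltW v1) // lerDl.
  by rewrite -exprMn divfK // gt_eqF.
lra.
Qed.

End HilbertGeometry.

(** * Gaps in the spectrum of a symmetric operator *)

Section SpectralGap.
Variables (R : realType) (H : hilbert R).
Local Notation "a *~: u" := ((a%:C)%C *: u) (at level 40).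
Implicit Types (u v w : H) (P D : H -> H).

(** The bound is stated with squares to avoid square roots. *)
Record sym_op P : Prop := {
  sym_opP : forall a u v, P (a *~: u + v) = a *~: P u + P v;
  sym_opC : forall u v, rdot (P u) v = rdot u (P v);
  sym_op_bounded : exists2 C : R, 0 < C &
    forall u, rdot (P u) (P u) <= C ^+ 2 * rdot u u }.

Lemma sym_opD P u v : sym_op P -> P (u + v) = P u + P v.
Proof. by move=> PS; have := sym_opP PS 1 u v; rewrite !scale1r. Qed.

Lemma sym_op0 P : sym_op P -> P 0 = 0.
Proof.
move=> PS; have := sym_opD 0 0 PS; rewrite addr0 => P00.
by apply: (addrI (P 0)); rewrite -P00 addr0.
Qed.

Lemma sym_opZ P a u : sym_op P -> P (a *~: u) = a *~: P u.
Proof. by move=> PS; have := sym_opP PS a u 0; rewrite (sym_op0 PS) !addr0. Qed.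

Lemma sym_opB P u v : sym_op P -> P (u - v) = P u - P v.
Proof.
move=> PS; apply: (addIr (P v)); rewrite -(sym_opD _ _ PS) !subrK //.
Qed.

Lemma rdot_addr_le (u v : H) (A B : R) : 0 <= A -> 0 <= B ->
  rdot u u <= A ^+ 2 -> rdot v v <= B ^+ 2 -> rdot (u + v) (u + v) <= (A + B) ^+ 2.
Proof.
move=> A0 B0; rewrite -!sqr_hnorm => uA vB.
have {uA vB}[uA vB] : hnorm u <= A /\ hnorm v <= B.
  by split; rewrite -(@ler_pXn2r _ 2) ?nnegrE ?hnorm_ge0.
rewrite ler_pXn2r ?nnegrE ?addr_ge0 ?hnorm_ge0 //.
by apply: le_trans (hnorm_triangle _ _) _; exact: lerD.
Qed.

Lemma sym_op_shift P (a : R) : sym_op P -> sym_op (fun u => P u - a *~: u).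
Proof.
move=> PS; split=> [b u v|u v|].
- rewrite (sym_opP PS) !scalerDr scalerN !scalerA [(a%:C * _)%C]mulrC.
  by rewrite opprD addrACA.
- by rewrite !rdotE (sym_opC PS).
have [C C0 PC] := sym_op_bounded PS; exists (C + `|a|).
  by rewrite ltr_pwDl.
move=> u; rewrite -(sqr_hnorm u) -exprMn mulrDl.
apply: rdot_addr_le; rewrite ?mulr_ge0 ?hnorm_ge0 ?(ltW C0) //.
  by rewrite exprMn sqr_hnorm.
by rewrite !rdotE opprK exprMn sqr_hnorm real_normK ?num_real // expr2 mulrA.
Qed.

Lemma sym_op_sqr P : sym_op P -> sym_op (fun u => P (P u)).
Proof.
move=> PS; split=> [b u v|u v|]; first by rewrite !(sym_opP PS).
  by rewrite !(sym_opC PS).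
have [C C0 PC] := sym_op_bounded PS; exists (C ^+ 2); first exact: exprn_gt0.
move=> u; apply: le_trans (PC _) _.
by rewrite [(C ^+ 2) ^+ 2]expr2 -mulrA ler_wpM2l // sqr_ge0.
Qed.

(** Cauchy-Schwarz for the form [<P u, v>] gives
[||P u||^4 <= <P u, u> <P (P u), P u> <= <P u, u> * C ||P u||^2]. *)
Lemma positive_op_le P (C : R) : sym_op P -> 0 < C ->
  (forall u, rdot (P u) (P u) <= C ^+ 2 * rdot u u) ->
  (forall u, 0 <= rdot (P u) u) ->
  forall u, rdot (P u) (P u) <= C * rdot (P u) u.
Proof.
move=> PS C0 PC pos u.
have form : semi_inner setT (fun u v => rdot (P u) v).
  split=> // [x y _ _|a x y z _ _ _]; first by rewrite (sym_opC PS) rdotC.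
  by rewrite (sym_opP PS) !rdotE.
have := @semi_inner_CS _ _ _ _ u (P u) form I I.
have PPu : rdot (P (P u)) (P u) <= C * rdot (P u) (P u).
  apply: le_trans (ler_norm _) _; rewrite -(@ler_pXn2r _ 2) ?nnegrE //; last first.
    by rewrite mulr_ge0 ?rdot_ge0 ?ltW.
  rewrite real_normK ?num_real //; apply: le_trans (rdot_CS _ _) _.
  by rewrite exprMn [_ ^+ 2 in leRHS]expr2 mulrA ler_wpM2r ?rdot_ge0.
have := rdot_ge0 (P u); rewrite le_eqVlt => /orP[/eqP <- _|n0 CS].
  exact: mulr_ge0 (ltW C0) (pos u).
rewrite -(ler_pM2r n0) -expr2; apply: le_trans CS _.
by rewrite [C * _]mulrC -mulrA; apply: ler_wpM2l; [exact: pos|exact: PPu].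
Qed.

(** The claim is [||A u|| >= r ||u||] for [A = D - mid], where [mid] and [r] are the
centre and the half-length of ]a, b[. Let [s] be the best constant with
[||A u||^2 >= s ||u||^2], and suppose that [s < r^2]. The operator [P = A^2 - s] is
positive, and bounded below because it is the product of [D - mid + n] and
[D - mid - n] with [n^2 = s], both covered by the hypothesis. By [positive_op_le],
[<P u, u> >= ||P u||^2 / C], so the constant [s] can be improved. *)
Lemma spectral_gap D (a b : R) : sym_op D -> a < b ->
  (forall l, a < l -> l < b -> exists2 e : R, 0 < e &
     forall u, e * rdot u u <= rdot (D u - l *~: u) (D u - l *~: u)) ->
  forall u, 0 <= rdot (D u - a *~: u) (D u - b *~: u).
Proof.
move=> DS ab below; pose mid := (a + b) / 2; pose r := (b - a) / 2.
pose A u := D u - mid *~: u.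
have AS : sym_op A by exact: sym_op_shift.
have AE u : A u = D u - mid *~: u by [].
clearbody A.
suff key u : r ^+ 2 * rdot u u <= rdot (A u) (A u).
  by move=> u; have := key u; rewrite AE /mid /r !rdotE (rdotC u (D u)); nra.
move: u; apply: contrapT => nkey.
have [u0 u0P] : exists u, rdot (A u) (A u) < r ^+ 2 * rdot u u.
  apply: contrapT => nex; apply: nkey => u; rewrite leNgt; apply/negP => lt.
  by apply: nex; exists u.
pose E := [set s : R | forall u, s * rdot u u <= rdot (A u) (A u)].
have E0 : E 0 by move=> u; rewrite mul0r rdot_ge0.
have n0 : 0 < rdot u0 u0.
  rewrite lt_def rdot_ge0 andbT; apply: contraL u0P => /eqP ->.
  by rewrite mulr0 -leNgt rdot_ge0.
have ubE : ubound E (r ^+ 2).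
  move=> s /(_ u0) sE; rewrite -(ler_pM2r n0); exact/ltW/(le_lt_trans sE).
have supE : has_sup E by split; [exists 0|exists (r ^+ 2)].
pose s := sup E.
have s0 : 0 <= s by exact: (ub_le_sup supE.2).
have Es : E s.
  move=> u; have [->|nz] := eqVneq (rdot u u) 0; first by rewrite mulr0 rdot_ge0.
  have up : 0 < rdot u u by rewrite lt_def nz rdot_ge0.
  rewrite -ler_pdivlMr //; apply: ge_sup; first by exists 0.
  by move=> t /(_ u); rewrite ler_pdivlMr.
have s_lt : s < r ^+ 2.
  by rewrite -(ltr_pM2r n0); exact: le_lt_trans (Es u0) u0P.
pose n := Num.sqrt s.
have nE : n ^+ 2 = s by rewrite sqr_sqrtr.
have r0 : 0 < r by rewrite divr_gt0 // subr_gt0.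
have n_ge0 : 0 <= n by exact: sqrtr_ge0.
have nr : n < r by rewrite -(@ltr_pXn2r _ 2) ?nnegrE ?(ltW r0) // nE.
have [e1 e10 h1] : exists2 e : R, 0 < e & forall u, e * rdot u u <=
    rdot (D u - (mid - n) *~: u) (D u - (mid - n) *~: u).
  by apply: below; move: nr; rewrite /mid /r; lra.
have [e2 e20 h2] : exists2 e : R, 0 < e & forall u, e * rdot u u <=
    rdot (D u - (mid + n) *~: u) (D u - (mid + n) *~: u).
  by apply: below; move: nr; rewrite /mid /r; lra.
pose P u := A (A u) - s *~: u.
have PS : sym_op P by apply: sym_op_shift; exact: sym_op_sqr.
have PE u : P u = D (D u - (mid + n) *~: u) - (mid - n) *~: (D u - (mid + n) *~: u).
  have collect (a1 b1 c1 : R) (x y z : H) :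
      x - a1 *~: y - (b1 *~: y - c1 *~: z) = x - (a1 + b1) *~: y + c1 *~: z.
    by rewrite opprB rmorphD scalerDl opprD addrA [in RHS]addrA addrAC.
  rewrite /P !AE !(sym_opB _ _ DS) !(sym_opZ _ _ DS) !scalerBr !scalerA -!rmorphM.
  rewrite !collect -addrA -scalerBl -rmorphB -nE /=.
  by congr (_ - _ *~: _ + _ *~: _); ring.
have Ppos u : 0 <= rdot (P u) u.
  by rewrite /P !rdotE (sym_opC AS) subr_ge0; exact: Es.
have Plow u : e1 * e2 * rdot u u <= rdot (P u) (P u).
  rewrite PE; apply: le_trans (h1 _); rewrite -mulrA ler_wpM2l ?(ltW e10) //.
have [C C0 PC] := sym_op_bounded PS.
have better : E (s + e1 * e2 / C).
  move=> u; have := positive_op_le PS C0 PC Ppos u.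
  have -> : rdot (P u) u = rdot (A u) (A u) - s * rdot u u.
    by rewrite {1}/P !rdotE (sym_opC AS).
  have := Plow u => low up.
  rewrite mulrDl -lerBrDl mulrAC ler_pdivrMr // [leRHS]mulrC.
  exact: le_trans low up.
have := ub_le_sup supE.2 better; rewrite gerDl leNgt.
by rewrite divr_gt0 ?mulr_gt0.
Qed.

(** The gap in ]0, c[ gives [<D u, D u> >= c <D u, u>], and the gaps in ]-L, 0[ for
all [L] give [<D u, u> >= 0]. Hence [D >= c] on the range of [D], and on its closure
by continuity. If [r] is the projection of [u] to this closure, then [u - r] is
orthogonal to the range of the symmetric operator [D], so it lies in the kernel,
and [c ||r|| <= ||D r|| = ||D u||]. *)
Lemma kernel_vector_near D (c : R) : sym_op D -> 0 < c ->
  (forall l, l < c -> l != 0 -> exists2 e : R, 0 < e &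
     forall u, e * rdot u u <= rdot (D u - l *~: u) (D u - l *~: u)) ->
  forall u, exists2 v, D v = 0 & c * hnorm (u - v) <= hnorm (D u).
Proof.
move=> DS c0 below.
have Dgap u : c * rdot (D u) u <= rdot (D u) (D u).
  have := @spectral_gap D 0 c DS c0 _ u.
  rewrite scale0r subr0 !rdotE subr_ge0; apply=> l l0 lc.
  by apply: below => //; rewrite gt_eqF.
have Dpos u : 0 <= rdot (D u) u.
  have ineq L : 0 < L -> 0 <= rdot (D u) (D u) + L * rdot (D u) u.
    move=> L0; have := @spectral_gap D (- L) 0 DS _ _ u.
    rewrite scale0r subr0 !rdotE.
    rewrite mulNr opprK (rdotC u); apply; rewrite ?oppr_lt0 //.
    by move=> l _ l0; apply: below; rewrite ?(lt_trans l0) // lt_eqF.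
  rewrite leNgt; apply/negP => neg.
  have L0 : 0 < (rdot (D u) (D u) + 1) / - rdot (D u) u.
    by rewrite divr_gt0 ?oppr_gt0 // ltr_wpDl ?rdot_ge0.
  have := ineq _ L0; rewrite invrN mulrN mulNr divfK ?lt_eqF //.
  by rewrite opprD addrA subrr add0r ler0N1.
have Drange v : c * rdot (D v) (D v) <= rdot (D (D v)) (D v).
  have form : semi_inner setT (fun u v => rdot (D u) v).
    split=> // [x y _ _|a x y z _ _ _]; first by rewrite (sym_opC DS) rdotC.
    by rewrite (sym_opP DS) !rdotE.
  have CS := @semi_inner_CS _ _ _ _ v (D v) form I I.
  have := rdot_ge0 (D v); rewrite le_eqVlt => /orP[/eqP <-|n0].
    by rewrite mulr0.
  have := ler_wpM2r (Dpos (D v)) (Dgap v) => CS2.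
  rewrite -(ler_pM2r n0); apply: le_trans (_ : c * (rdot (D v) v * rdot (D (D v)) (D v)) <= _).
    by rewrite -mulrA ler_wpM2l ?(ltW c0) // -expr2.
  by rewrite mulrA [leRHS]mulrC.
move=> u.
have [r [w wR wr] ort] := @orthogonal_projection R H (range D) u
  (ex_intro2 _ _ 0 I (sym_op0 DS))
  (fun a x y '(ex_intro2 x' _ xE) '(ex_intro2 y' _ yE) =>
     ex_intro2 _ _ (a *~: x' + y') I
       (etrans (sym_opP DS a x' y') (f_equal2 (fun x y => a *~: x + y) xE yE))).
exists (u - r).
  by apply: rdot_eq0; rewrite (sym_opC DS); apply: ort; exists (D (u - r)).
have -> : u - (u - r) = r by rewrite opprB addrC subrK.
have kerD : D u = D r.
  apply/eqP; rewrite -subr_eq0 -(sym_opB _ _ DS); apply/eqP.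
  by apply: rdot_eq0; rewrite (sym_opC DS); apply: ort; exists (D (u - r)).
rewrite kerD.
have low : c * rdot r r <= rdot (D r) r.
  (* The quadratic form of D - c is continuous, and nonnegative at the w n. *)
  have [C C0 DC] := sym_op_bounded DS.
  pose q v := rdot (D v) v - c * rdot v v.
  have qw n : 0 <= q (w n).
    by have [v _ <-] := wR n; rewrite subr_ge0; exact: Drange.
  have qr z : q r = q (r + z) - 2 * (rdot (D r) z - c * rdot r z) - q z.
    rewrite /q (sym_opD _ _ DS) !rdotE (sym_opC DS z r) (rdotC z (D r)).
    by rewrite (rdotC z r); ring.
  have Dz z : rdot (D z) z <= C * hnorm z ^+ 2.
    apply: le_trans (le_trans (ler_norm _) (rdot_le_hnorm _ _)) _.
    rewrite expr2 mulrA ler_wpM2r ?hnorm_ge0 //.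
    rewrite -(@ler_pXn2r _ 2) ?nnegrE ?mulr_ge0 ?hnorm_ge0 ?(ltW C0) //.
    by rewrite exprMn !sqr_hnorm.
  rewrite -subr_ge0 -/(q r) leNgt; apply/negP => neg.
  pose K := 2 * (hnorm (D r) + c * hnorm r) + C.
  have K0 : 0 < K.
    by rewrite ltr_wpDl // mulr_ge0 // addr_ge0 ?hnorm_ge0 // mulr_ge0 ?hnorm_ge0 // ltW.
  pose e := Num.min 1 (- q r / (2 * K)).
  have e0 : 0 < e by rewrite lt_min ltr01 divr_gt0 ?oppr_gt0 // mulr_gt0.
  have [N /(_ N (leqnn N)) wNr] := wr e e0.
  pose z := w N - r.
  have qrE := qr z; rewrite [r + z]addrC subrK in qrE.
  have hz0 : 0 <= hnorm z := hnorm_ge0 z.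
  have hz1 : hnorm z <= 1.
    by apply: le_trans (ltW wNr) _; rewrite ge_min lexx.
  have hzK : hnorm z * (2 * K) <= - q r.
    rewrite -ler_pdivlMr ?mulr_gt0 //; apply: le_trans (ltW wNr) _.
    by rewrite ge_min lexx orbT.
  have b1 := le_trans (ler_norm _) (rdot_le_hnorm (D r) z).
  have b2 : - rdot r z <= hnorm r * hnorm z.
    by rewrite (le_trans (ler_norm _)) // normrN rdot_le_hnorm.
  have b3 : q z <= C * hnorm z.
    rewrite lerBlDr; apply: le_trans (Dz z) _.
    rewrite -[leLHS]addr0 lerD ?mulr_ge0 ?rdot_ge0 ?(ltW c0) //.
    by rewrite ler_wpM2l ?(ltW C0) // expr2 ler_piMr.
  have b4 := ler_wpM2l (ltW c0) b2; have qN := qw N.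
  move: hzK; rewrite /K; clear - b1 b3 b4 qN qrE neg; lra.
have [r0|r0] := eqVneq (hnorm r) 0; first by rewrite r0 mulr0 hnorm_ge0.
have rp : 0 < hnorm r by rewrite lt_def r0 hnorm_ge0.
rewrite -(ler_pM2r rp) -mulrA -expr2 sqr_hnorm; apply: le_trans low _.
exact: le_trans (ler_norm _) (rdot_le_hnorm _ _).
Qed.
End SpectralGap.

(** * The Hilbert space of a complete semi-inner product *)

(** A complete semi-inner product space. The vectors form a subset [pre_dom] of a
module instead of a module of their own, so that one computes in the ambient
module (below, a space of functions); the laws of the form hold on this subset. *)
Record prehilbert (R : realType) := Prehilbert {
  pre_sort : lmodType R[i];
  pre_dom : set pre_sort;
  pre_form : pre_sort -> pre_sort -> R[i];
  pre_dom0 : pre_dom 0;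
  pre_domP : forall a u v, pre_dom u -> pre_dom v -> pre_dom (a *: u + v);
  pre_formP : forall a u v w, pre_dom u -> pre_dom v -> pre_dom w ->
    pre_form (a *: u + v) w = a * pre_form u w + pre_form v w;
  pre_formC : forall u v, pre_dom u -> pre_dom v ->
    pre_form u v = Num.conj (pre_form v u);
  pre_form_ge0 : forall u, pre_dom u -> 0 <= pre_form u u;
  pre_complete : forall u : nat -> pre_sort, (forall n, pre_dom (u n)) ->
    (forall e : R, 0 < e -> exists N : nat, forall m n : nat,
      (N <= m)%N -> (N <= n)%N ->
      complex.Re (pre_form (u m - u n) (u m - u n)) < e) ->
    exists2 v, pre_dom v & forall e : R, 0 < e -> exists N : nat,
      forall n : nat, (N <= n)%N ->
      complex.Re (pre_form (u n - v) (u n - v)) < e }.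

Section Quotient.
Variables (R : realType) (P : prehilbert R).
Local Notation V := (pre_sort P).
Local Notation W := (@pre_dom R P).
Local Notation B := (@pre_form R P).
Implicit Types u v w : V.

Let W0 : W 0 := pre_dom0 P.

Lemma pre_domD u v : W u -> W v -> W (u + v).
Proof. by move=> Wu Wv; have := pre_domP 1 Wu Wv; rewrite scale1r. Qed.

Lemma pre_domZ a u : W u -> W (a *: u).
Proof. by move=> Wu; have := pre_domP a Wu W0; rewrite addr0. Qed.

Lemma pre_domN u : W u -> W (- u).
Proof. by move=> Wu; have := pre_domZ (-1) Wu; rewrite scaleN1r. Qed.

Lemma pre_domB u v : W u -> W v -> W (u - v).
Proof. by move=> Wu Wv; apply: pre_domD => //; exact: pre_domN. Qed.

Lemma semi_inner_pre : semi_inner W (fun u v => complex.Re (B u v)).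
Proof.
split=> //; first exact: pre_domP.
- by move=> u v Wu Wv; rewrite [in LHS]pre_formC //; case: (B v u).
- by move=> a u v w Wu Wv Ww; rewrite pre_formP // raddfD /= ReM_real.
- by move=> u /pre_form_ge0; rewrite lecE => /andP[].
Qed.

(** Cauchy-Schwarz shows that the real part vanishes; for the imaginary part it is
applied to [v] multiplied by the imaginary unit. *)
Lemma pre_null u v : W u -> W v -> B u u = 0 -> B u v = 0.
Proof.
move=> Wu Wv u0.
have re z : W z -> complex.Re (B u z) = 0.
  move=> Wz; have := semi_inner_CS semi_inner_pre Wu Wz.
  rewrite u0 /= mul0r => h; apply/eqP; rewrite -sqrf_eq0; apply/eqP/le_anti.
  by rewrite h sqr_ge0.
have := re v Wv; have := re ('i%C *: v) (pre_domZ _ Wv).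
have -> : B u ('i%C *: v) = Num.conj 'i%C * B u v.
  rewrite pre_formC //; last exact: pre_domZ.
  have := pre_formP 'i%C Wv W0 Wu; rewrite addr0 => ->.
  have -> : B 0 u = 0.
    have := pre_formP (-1) W0 W0 Wu; rewrite scaler0 addr0 mulN1r => ->.
    by rewrite addNr.
  by rewrite addr0 rmorphM /= [B u v]pre_formC.
case: (B u v) => a b /=; rewrite mul0r mulN1r sub0r opprK => -> ->.
by [].
Qed.

Definition pre_eq u v : Prop := B (u - v) (u - v) = 0.

Lemma pre_formBl u v w : W u -> W v -> W w -> B (u - v) w = B u w - B v w.
Proof.
move=> Wu Wv Ww; rewrite addrC -scaleN1r pre_formP // mulN1r addrC //.
Qed.

Lemma pre_formDl u v w : W u -> W v -> W w -> B (u + v) w = B u w + B v w.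
Proof. by move=> Wu Wv Ww; have := pre_formP 1 Wu Wv Ww; rewrite scale1r mul1r. Qed.

Lemma pre_formZl a u w : W u -> W w -> B (a *: u) w = a * B u w.
Proof.
move=> Wu Ww; have B0 : B 0 w = 0.
  have := pre_formP (-1) W0 W0 Ww; rewrite scaler0 addr0 mulN1r => ->.
  by rewrite addNr.
by have := pre_formP a Wu W0 Ww; rewrite B0 !addr0.
Qed.

Lemma pre_form_eql u v w : W u -> W v -> W w -> pre_eq u v -> B u w = B v w.
Proof.
move=> Wu Wv Ww uv; apply/eqP; rewrite -subr_eq0 -pre_formBl //.
by rewrite pre_null //; exact: pre_domB.
Qed.

Lemma pre_form_eqr u v w : W u -> W v -> W w -> pre_eq u v -> B w u = B w v.
Proof.
move=> Wu Wv Ww uv; rewrite pre_formC // [RHS]pre_formC //.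
by rewrite (pre_form_eql Wu Wv Ww uv).
Qed.

Lemma pre_eqP u v : W u -> W v ->
  pre_eq u v <-> (forall w, W w -> B u w = B v w).
Proof.
move=> Wu Wv; split=> [uv w Ww|uv]; first exact: pre_form_eql.
have Wuv := pre_domB Wu Wv.
by rewrite /pre_eq pre_formBl // uv // subrr.
Qed.

(** The choice of a representative depends on the class only, because equivalent
vectors have the same set of candidates. The quotient is then the subtype of the
chosen representatives. *)
Definition pre_canon u : V := xget 0 [set v | W v /\ pre_eq u v].

Lemma pre_canonP u : W u -> W (pre_canon u) /\ pre_eq u (pre_canon u).
Proof.
move=> Wu; rewrite /pre_canon; case: xgetP => [v _ []//|/(_ u)[]]; split=> //.
by apply/pre_eqP.
Qed.

Lemma pre_canon_eq u v : W u -> W v -> pre_eq u v -> pre_canon u = pre_canon v.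
Proof.
move=> Wu Wv uv; rewrite /pre_canon; congr (xget 0 _); apply/seteqP.
have uvP := (pre_eqP Wu Wv).1 uv.
split=> w [Ww /pre_eqP ww]; split=> //; apply/pre_eqP => // z Wz.
  by rewrite -uvP // ww.
by rewrite uvP // ww.
Qed.

Definition pre_normal : pred V := fun v => `[< W v /\ pre_canon v = v >].

Definition pre_quotient := {v : V | pre_normal v}.
HB.instance Definition _ := Choice.on pre_quotient.
Local Notation Q := pre_quotient.

(** Makes the projection to the quotient total on the ambient module. *)
Definition pre_clip u : V := if `[< W u >] then u else 0.

Fact pre_clip_dom u : W (pre_clip u).
Proof. by rewrite /pre_clip; case: asboolP. Qed.

Fact pre_class_proof u : pre_normal (pre_canon (pre_clip u)).
Proof.
have Wc := pre_clip_dom u; have [Wcc cc] := pre_canonP Wc.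
apply/asboolP; split=> //; apply: pre_canon_eq => //.
by apply/pre_eqP => // w Ww; rewrite (pre_form_eql Wc Wcc Ww cc).
Qed.

Definition pre_class u : Q := exist _ (pre_canon (pre_clip u)) (pre_class_proof u).

Lemma pre_clipE u : W u -> pre_clip u = u.
Proof. by move=> Wu; rewrite /pre_clip asboolT. Qed.

Lemma val_pre_class u : W u ->
  W (sval (pre_class u)) /\ pre_eq u (sval (pre_class u)).
Proof. by move=> Wu; rewrite /= pre_clipE //; exact: pre_canonP. Qed.

Lemma pre_class_eq u v : W u -> W v -> pre_eq u v -> pre_class u = pre_class v.
Proof.
by move=> Wu Wv uv; apply: val_inj; rewrite /= !pre_clipE //; exact: pre_canon_eq.
Qed.

Lemma pre_class_surj (x : Q) : exists2 u, W u & x = pre_class u.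
Proof.
case: x => v vP; have [Wv vE] := asboolP _ vP; exists v => //.
by apply: val_inj; rewrite /= pre_clipE.
Qed.

Definition quo_add (x y : Q) : Q := pre_class (sval x + sval y).
Definition quo_opp (x : Q) : Q := pre_class (- sval x).
Definition quo_scale (a : R[i]) (x : Q) : Q := pre_class (a *: sval x).
Definition quo_dot (x y : Q) : R[i] := B (sval x) (sval y).

Lemma pre_class_add u v : W u -> W v ->
  quo_add (pre_class u) (pre_class v) = pre_class (u + v).
Proof.
move=> Wu Wv; have [Wu' uu] := val_pre_class Wu; have [Wv' vv] := val_pre_class Wv.
apply: pre_class_eq; rewrite ?/(W _); try exact: pre_domD.
apply/pre_eqP; try exact: pre_domD.
by move=> w Ww; rewrite !pre_formDl // -(pre_form_eql Wu Wu' Ww uu) -(pre_form_eql Wv Wv' Ww vv).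
Qed.

Lemma pre_class_scale a u : W u -> quo_scale a (pre_class u) = pre_class (a *: u).
Proof.
move=> Wu; have [Wu' uu] := val_pre_class Wu.
apply: pre_class_eq; try exact: pre_domZ.
apply/pre_eqP; try exact: pre_domZ.
by move=> w Ww; rewrite !pre_formZl // -(pre_form_eql Wu Wu' Ww uu).
Qed.

Lemma pre_class_opp u : W u -> quo_opp (pre_class u) = pre_class (- u).
Proof.
by move=> Wu; have := pre_class_scale (-1) Wu; rewrite /quo_scale !scaleN1r.
Qed.

Lemma quo_addA : associative quo_add.
Proof.
move=> x y z; have [u Wu ->] := pre_class_surj x.
have [v Wv ->] := pre_class_surj y; have [w Ww ->] := pre_class_surj z.
by rewrite !pre_class_add ?addrA //; exact: pre_domD.
Qed.

Lemma quo_addC : commutative quo_add.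
Proof. by move=> x y; rewrite /quo_add addrC. Qed.

Lemma quo_add0 : left_id (pre_class 0) quo_add.
Proof.
by move=> x; have [u Wu ->] := pre_class_surj x; rewrite pre_class_add ?add0r.
Qed.

Lemma quo_addN : left_inverse (pre_class 0) quo_opp quo_add.
Proof.
move=> x; have [u Wu ->] := pre_class_surj x.
by rewrite pre_class_opp // pre_class_add ?addNr //; exact: pre_domN.
Qed.

HB.instance Definition _ := GRing.isZmodule.Build Q quo_addA quo_addC quo_add0 quo_addN.

Lemma quo_addE u v : W u -> W v -> pre_class u + pre_class v = pre_class (u + v).
Proof. exact: pre_class_add. Qed.

Lemma quo_scaleA a b x : quo_scale a (quo_scale b x) = quo_scale (a * b) x.
Proof.
have [u Wu ->] := pre_class_surj x.
by rewrite !pre_class_scale ?scalerA //; exact: pre_domZ.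
Qed.

Lemma quo_scale1 : left_id 1 quo_scale.
Proof.
by move=> x; have [u Wu ->] := pre_class_surj x; rewrite pre_class_scale ?scale1r.
Qed.

Lemma quo_scaleDr : right_distributive quo_scale +%R.
Proof.
move=> a x y; have [u Wu ->] := pre_class_surj x.
have [v Wv ->] := pre_class_surj y.
rewrite quo_addE // !pre_class_scale //; last exact: pre_domD.
by rewrite quo_addE ?scalerDr //; exact: pre_domZ.
Qed.

Lemma quo_scaleDl x : {morph quo_scale^~ x : a b / a + b}.
Proof.
move=> a b; have [u Wu ->] := pre_class_surj x.
by rewrite !pre_class_scale // quo_addE ?scalerDl //; exact: pre_domZ.
Qed.

HB.instance Definition _ := GRing.Zmodule_isLmodule.Build R[i] Q
  quo_scaleA quo_scale1 quo_scaleDr quo_scaleDl.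

Lemma quo_scaleE a u : W u -> a *: pre_class u = pre_class (a *: u).
Proof. exact: pre_class_scale. Qed.

Lemma pre_classP a u v : W u -> W v ->
  pre_class (a *: u + v) = a *: pre_class u + pre_class v.
Proof. by move=> Wu Wv; rewrite quo_scaleE // quo_addE //; exact: pre_domZ. Qed.

Lemma quo_dotE u v : W u -> W v -> quo_dot (pre_class u) (pre_class v) = B u v.
Proof.
move=> Wu Wv; have [Wu' uu] := val_pre_class Wu; have [Wv' vv] := val_pre_class Wv.
by rewrite /quo_dot -(pre_form_eql Wu Wu' Wv' uu) -(pre_form_eqr Wv Wv' Wu vv).
Qed.

Lemma quo_dot_bilinear : bilinear_for ( *%R ) (Num.conj \; *%R) quo_dot.
Proof.
split=> z a x y; have [w Ww ->] := pre_class_surj z;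
  have [u Wu ->] := pre_class_surj x; have [v Wv ->] := pre_class_surj y.
  by rewrite -pre_classP // !quo_dotE ?pre_formP //; exact: pre_domP.
rewrite -pre_classP // !quo_dotE //; last exact: pre_domP.
rewrite pre_formC //; last exact: pre_domP.
by rewrite pre_formP // rmorphD rmorphM /= -!pre_formC.
Qed.

HB.instance Definition _ := @bilinear_isBilinear.Build R[i] Q Q R[i] _ _
  quo_dot quo_dot_bilinear.

Lemma quo_dot_herm (x y : Q) : quo_dot x y = (-1) ^+ false * Num.conj (quo_dot y x).
Proof.
have [u Wu ->] := pre_class_surj x; have [v Wv ->] := pre_class_surj y.
by rewrite !quo_dotE // expr0 mul1r pre_formC.
Qed.

HB.instance Definition _ := @isHermitianSesquilinear.Build R[i] Q false Num.conj
  quo_dot quo_dot_herm.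

Lemma quo_dot_gt0 (x : Q) : x != 0 -> 0 < quo_dot x x.
Proof.
have [u Wu ->] := pre_class_surj x => nz.
rewrite quo_dotE // lt_def pre_form_ge0 // andbT; apply: contraNneq nz => u0.
by apply/eqP; apply: pre_class_eq => //; rewrite /pre_eq subr0.
Qed.

HB.instance Definition _ := @isDotProduct.Build R[i] Q quo_dot quo_dot_gt0.

Definition quo_form : {dot Q for Num.conj} := quo_dot.
End Quotient.

Section Completion.
Variables (R : realType) (P : prehilbert R).
Local Notation W := (@pre_dom R P).
Local Notation B := (@pre_form R P).

(** The classes of null vectors collapse to 0, which makes the form definite, and
completeness passes to the quotient. *)
Lemma exists_hilbert_quotient : exists (H : hilbert R) (q : pre_sort P -> H),
  [/\ forall h, exists2 u, W u & h = q u,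
      forall a u v, W u -> W v -> q (a *: u + v) = a *: q u + q v
    & forall u v, W u -> W v -> hdot H (q u) (q v) = B u v].
Proof.
have complete (h : nat -> pre_quotient P) :
    (forall eps : R, 0 < eps -> exists N : nat, forall m n : nat,
      (N <= m)%N -> (N <= n)%N ->
      Num.sqrt (complex.Re (quo_form P (h m - h n) (h m - h n))) < eps) ->
    exists l, forall eps : R, 0 < eps -> exists N : nat, forall n : nat,
      (N <= n)%N -> Num.sqrt (complex.Re (quo_form P (h n - l) (h n - l))) < eps.
  move=> cau; have /choice[u uP] n : exists u, W u /\ h n = pre_class u.
    by have [u Wu ->] := pre_class_surj (h n); exists u.
  have hB v w : W v -> W w -> pre_class v - pre_class w = pre_class (v - w).
    move=> Wv Ww; have := pre_classP (-1) Ww Wv.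
    by rewrite !scaleN1r ![- _ + _]addrC.
  have hE v w : W v -> W w -> quo_form P (pre_class v - pre_class w)
      (pre_class v - pre_class w) = B (v - w) (v - w).
    move=> Wv Ww; rewrite hB //; apply: quo_dotE; exact: pre_domB.
  have [|e e0|l Wl ul] := @pre_complete _ P u.
  - by move=> n; have [] := uP n.
  - have se0 : 0 < Num.sqrt e by rewrite sqrtr_gt0.
    have [N HN] := cau _ se0; exists N => m n Nm Nn.
    have [Wm hm] := uP m; have [Wn hn] := uP n.
    by have := HN m n Nm Nn; rewrite hm hn hE // ltr_sqrt.
  exists (pre_class l) => e e0; have [N HN] := ul (e ^+ 2) (exprn_gt0 2 e0).
  exists N => n Nn; have [Wn hn] := uP n; rewrite hn hE //.
  by rewrite -(ger0_norm (ltW e0)) -sqrtr_sqr ltr_sqrt ?HN // exprn_gt0.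
exists (Hilbert complete), (@pre_class R P); split.
- exact: pre_class_surj.
- exact: pre_classP.
- exact: quo_dotE.
Qed.

Variables (H : hilbert R) (q : pre_sort P -> H).
Hypothesis q_surj : forall h, exists2 u, W u & h = q u.
Hypothesis qP : forall a u v, W u -> W v -> q (a *: u + v) = a *: q u + q v.
Hypothesis q_dot : forall u v, W u -> W v -> hdot H (q u) (q v) = B u v.

Lemma quotient_class0 : q 0 = 0.
Proof.
have := qP (-1) (pre_dom0 P) (pre_dom0 P); rewrite scaler0 addr0 scaleN1r => ->.
by rewrite addNr.
Qed.

Lemma quotient_classD u v : W u -> W v -> q (u + v) = q u + q v.
Proof. by move=> Wu Wv; have := qP 1 Wu Wv; rewrite !scale1r. Qed.

Lemma quotient_classZ a u : W u -> q (a *: u) = a *: q u.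
Proof.
by move=> Wu; have := qP a Wu (pre_dom0 P); rewrite quotient_class0 !addr0.
Qed.

Lemma quotient_classB u v : W u -> W v -> q (u - v) = q u - q v.
Proof.
by move=> Wu Wv; have := qP (-1) Wv Wu; rewrite !scaleN1r ![- _ + _]addrC.
Qed.

Lemma quotient_class_eq u v : W u -> W v -> B (u - v) (u - v) = 0 -> q u = q v.
Proof.
move=> Wu Wv uv; apply/eqP; rewrite -subr_eq0 -quotient_classB //.
by rewrite -(dnorm_eq0 (hdot H)) q_dot ?uv //; exact: pre_domB.
Qed.

(** A bounded operator maps null vectors to null vectors, so that it acts on classes. *)
Lemma quotient_operator (A : pre_sort P -> pre_sort P) :
  (forall u, W u -> W (A u)) ->
  (forall a u v, W u -> W v -> A (a *: u + v) = a *: A u + A v) ->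
  (exists M : R, forall u, W u -> complex.Re (B (A u) (A u)) <= M * complex.Re (B u u)) ->
  exists L : {linear H -> H}, forall u, W u -> L (q u) = q (A u).
Proof.
move=> AW AP [M AM]; have /choice[s sP] h : exists u, W u /\ h = q u.
  by have [u Wu ->] := q_surj h; exists u.
have AB u v : W u -> W v -> A (u - v) = A u - A v.
  by move=> Wu Wv; have := AP (-1) _ _ Wv Wu; rewrite !scaleN1r ![- _ + _]addrC.
have Aeq u v : W u -> W v -> q u = q v -> q (A u) = q (A v).
  move=> Wu Wv uv; apply: quotient_class_eq; try exact: AW.
  have Wuv := pre_domB Wu Wv.
  have uv0 : B (u - v) (u - v) = 0.
    by rewrite -q_dot // quotient_classB // uv subrr linear0l.
  have := AM _ Wuv; rewrite uv0 mulr0 AB // => le0.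
  have := pre_form_ge0 (pre_domB (AW _ Wu) (AW _ Wv)).
  case: (B _ _) le0 => a b /= a0; rewrite lecE /= => /andP[/eqP -> a0'].
  by apply/eqP; rewrite eq_complex /= eqxx andbT eq_le a0 a0'.
pose f h := q (A (s h)).
have fE u : W u -> f (q u) = q (A u).
  by move=> Wu; have [Ws sE] := sP (q u); apply: Aeq.
have flin : linear f.
  move=> a x y; have [u Wu ->] := q_surj x; have [v Wv ->] := q_surj y.
  have Wauv := pre_domP a Wu Wv.
  by rewrite -qP // !fE // AP // qP //; exact: AW.
pose L : {linear H -> H} := HB.pack f (GRing.isLinear.Build R[i] H H *:%R f flin).
by exists L.
Qed.

End Completion.

(** * Ultralimits of complex sequences *)

Section ComplexUltraLimit.
Variables (R : realType) (w : set_system nat).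
Hypotheses (wU : UltraFilter w).
Implicit Types (z : nat -> R[i]) (l : R[i]).

Definition ccvg z l : Prop :=
  complex.Re (z i) @[i --> w] --> complex.Re l /\
  complex.Im (z i) @[i --> w] --> complex.Im l.

Definition clim z : R[i] :=
  (ulim w (fun i => complex.Re (z i)) +i* ulim w (fun i => complex.Im (z i)))%C.

Lemma ccvg_unique z l l' : ccvg z l -> ccvg z l' -> l = l'.
Proof.
case: l l' => a b [a' b'] [za zb] [za' zb'].
by congr (Complex _ _); [exact: cvg_unique za za'|exact: cvg_unique zb zb'].
Qed.

Lemma clim_cvg z (M : R) : (\forall i \near w, complex.Re `|z i| <= M) ->
  ccvg z (clim z).
Proof.
move=> zM; have ReM (c : R[i]) : complex.Re c ^+ 2 <= complex.Re `|c| ^+ 2 /\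
    complex.Im c ^+ 2 <= complex.Re `|c| ^+ 2.
  rewrite normc_def /= sqr_sqrtr ?addr_ge0 ?sqr_ge0 //.
  by rewrite lerDl lerDr !sqr_ge0.
have c0 (c : R[i]) : 0 <= complex.Re `|c| by rewrite normc_def sqrtr_ge0.
split; apply: (@cvg_ulim R w wU _ M); apply: filterS zM => i; apply: le_trans.
  rewrite -(@ler_pXn2r _ 2) ?nnegrE // real_normK ?num_real //.
  by have [] := ReM (z i).
rewrite -(@ler_pXn2r _ 2) ?nnegrE // real_normK ?num_real //.
by have [] := ReM (z i).
Qed.

Lemma ccvgP a z z' l l' : ccvg z l -> ccvg z' l' ->
  ccvg (fun i => a * z i + z' i) (a * l + l').
Proof.
have wF : Filter w by exact: _.
case: a => a b [zr zi] [zr' zi']; split.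
  have -> : (fun i => complex.Re ((a +i* b)%C * z i + z' i)) = (fun i =>
     (a * complex.Re (z i) - b * complex.Im (z i)) + complex.Re (z' i)).
    by apply/funext => i; case: (z i) => ? ?; case: (z' i).
  have -> : complex.Re ((a +i* b)%C * l + l') =
     (a * complex.Re l - b * complex.Im l) + complex.Re l'.
    by case: l {zr zi}; case: l' {zr' zi'}.
  by apply: cvgD => //; apply: cvgB; apply: cvgMr.
have -> : (fun i => complex.Im ((a +i* b)%C * z i + z' i)) = (fun i =>
   (a * complex.Im (z i) + b * complex.Re (z i)) + complex.Im (z' i)).
  by apply/funext => i; case: (z i) => ? ?; case: (z' i).
have -> : complex.Im ((a +i* b)%C * l + l') =
   (a * complex.Im l + b * complex.Re l) + complex.Im l'.
  by case: l {zr zi}; case: l' {zr' zi'}.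
by apply: cvgD => //; apply: cvgD; apply: cvgMr.
Qed.

Lemma ccvg_conj z l : ccvg z l -> ccvg (fun i => Num.conj (z i)) (Num.conj l).
Proof.
have wF : Filter w by exact: _.
move=> [zr zi]; split.
  have -> : (fun i => complex.Re (Num.conj (z i))) = (fun i => complex.Re (z i)).
    by apply/funext => i; case: (z i).
  by case: l zr {zi}.
have -> : (fun i => complex.Im (Num.conj (z i))) = (fun i => - complex.Im (z i)).
  by apply/funext => i; case: (z i).
by have -> : complex.Im (Num.conj l) = - complex.Im l; [case: l {zr zi}|exact: cvgN].
Qed.

Lemma ccvg_near z z' l : (\forall i \near w, z i = z' i) -> ccvg z' l -> ccvg z l.
Proof.
move=> zz' [zr zi]; split.
  by apply: near_eq_lim zr; apply: filterS zz' => i ->.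
by apply: near_eq_lim zi; apply: filterS zz' => i ->.
Qed.

End ComplexUltraLimit.

(** * The ultraproduct of the spaces of sections *)

Section Ultraproduct.
Variables (R : realType) (w : set_system nat).
Hypotheses (wU : UltraFilter w) (oow : \oo `<=` w).
Variables (X : nat -> finType) (H : hilbert R).
Variable deep : nat -> forall i, X i -> Prop.
Hypothesis deep_mono : forall r s i (x : X i), (r <= s)%N -> deep s x -> deep r x.

Local Notation V := (graph_space X -> H).
Implicit Types xi ze : V.

Definition sec_dot xi ze i : R[i] :=
  \sum_(x : X i) hdot H (xi (in_space x)) (ze (in_space x)).

Definition sec_norm2 xi i : R :=
  \sum_(x : X i) rdot (xi (in_space x)) (xi (in_space x)).

Definition sec_bounded xi : Prop :=
  exists M : R, \forall i \near w, sec_norm2 xi i <= M.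

(** The restriction on supports is what makes the action of matrices multiplicative:
the identities satisfied by charts hold at deep points only. *)
Definition sec_deep xi : Prop := forall r, \forall i \near w,
  forall x : X i, xi (in_space x) <> 0 -> deep r x.

Definition ultra_dom : set V := [set xi | sec_bounded xi /\ sec_deep xi].

Definition ultra_form xi ze : R[i] := clim w (sec_dot xi ze).

Lemma sec_norm2_ge0 xi i : 0 <= sec_norm2 xi i.
Proof. by apply: sumr_ge0 => x _; exact: rdot_ge0. Qed.

Lemma sec_dot_diag xi i : sec_dot xi xi i = (sec_norm2 xi i)%:C%C.
Proof.
rewrite /sec_dot /sec_norm2 rmorph_sum /=.
by apply: eq_bigr => x _; rewrite hdot_rdot.
Qed.

Lemma rdotD_le (u v : H) : rdot (u + v) (u + v) <= 2 * rdot u u + 2 * rdot v v.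
Proof.
by have := rdot_ge0 (u - v); rewrite !rdotE (rdotC v u); lra.
Qed.

Lemma rdotZ_complex (a : R[i]) (u : H) :
  rdot (a *: u) (a *: u) = complex.Re `|a| ^+ 2 * rdot u u.
Proof.
rewrite {1}/rdot dnormZ hdot_rdot -[`|a|]RRe_real ?normr_real //.
by rewrite -rmorphXn -rmorphM /=.
Qed.

Lemma sec_norm2P a xi ze i : sec_norm2 (a *: xi + ze) i <=
  2 * (complex.Re `|a| ^+ 2 * sec_norm2 xi i) + 2 * sec_norm2 ze i.
Proof.
rewrite /sec_norm2 !mulr_sumr -big_split; apply: ler_sum => x _.
by apply: le_trans (rdotD_le _ _) _; rewrite rdotZ_complex.
Qed.

Lemma sec_norm2D xi ze i :
  sec_norm2 (xi + ze) i <= 2 * sec_norm2 xi i + 2 * sec_norm2 ze i.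
Proof.
have := sec_norm2P 1 xi ze i; rewrite scale1r normr1 /= expr1n mul1r.
by [].
Qed.

Lemma sec_norm2N xi i : sec_norm2 (- xi) i = sec_norm2 xi i.
Proof. by apply: eq_bigr => x _; rewrite !rdotE opprK. Qed.

Lemma hdot_le (u v : H) : complex.Re `|hdot H u v| <= rdot u u + rdot v v.
Proof.
have [->|z0] := eqVneq (hdot H u v) 0.
  by rewrite normr0 addr_ge0 ?rdot_ge0.
(* Rotating u by c turns the product into its modulus. *)
set z := hdot H u v in z0 *; pose c := `|z| / z.
have c1 : `|c| = 1 by rewrite normrM normr_id normfV divff // normr_eq0.
have zE : `|z| = hdot H (c *: u) v by rewrite linearZl_LR -/z /c divfK.
have := rdot_ge0 (c *: u - v); rewrite zE -/(rdot (c *: u) v) !rdotE.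
rewrite (rdotC v (c *: u)) rdotZ_complex c1 expr1n mul1r.
by have := rdot_ge0 u; have := rdot_ge0 v; lra.
Qed.

Lemma sec_dot_le xi ze i :
  complex.Re `|sec_dot xi ze i| <= sec_norm2 xi i + sec_norm2 ze i.
Proof.
have h : complex.Re `|sec_dot xi ze i| <=
    complex.Re (\sum_(x : X i) `|hdot H (xi (in_space x)) (ze (in_space x))|).
  have : `|sec_dot xi ze i| <=
      \sum_(x : X i) `|hdot H (xi (in_space x)) (ze (in_space x))|.
    exact: ler_norm_sum.
  by rewrite lecE => /andP[].
apply: le_trans h _; rewrite raddf_sum -big_split /=; apply: ler_sum => x _.
exact: hdot_le.
Qed.

Lemma ultra_cvg_form xi ze : ultra_dom xi -> ultra_dom ze ->
  ccvg w (sec_dot xi ze) (ultra_form xi ze).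
Proof.
move=> [[M xiM] _] [[N zeN] _]; apply: (clim_cvg wU (M := M + N)).
by apply: filterS2 xiM zeN => i hM hN; rewrite (le_trans (sec_dot_le _ _ _)) ?lerD.
Qed.

Lemma ultra_domP a xi ze : ultra_dom xi -> ultra_dom ze -> ultra_dom (a *: xi + ze).
Proof.
move=> [[M xiM] xid] [[N zeN] zed]; split.
  exists (2 * (complex.Re `|a| ^+ 2 * M) + 2 * N).
  apply: filterS2 xiM zeN => i hM hN; apply: le_trans (sec_norm2P _ _ _ _) _.
  by rewrite lerD // ler_wpM2l // ler_wpM2l // sqr_ge0.
move=> r; apply: filterS2 (xid r) (zed r) => i hx hz x nz.
have [x0|/eqP/hx//] := eqVneq (xi (in_space x)) 0.
have [z0|/eqP/hz//] := eqVneq (ze (in_space x)) 0.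
case: nz; have -> : (a *: xi + ze) (in_space x) = a *: xi (in_space x) + ze (in_space x).
  by [].
by rewrite x0 z0 scaler0 addr0.
Qed.

Lemma ultra_dom0 : ultra_dom 0.
Proof.
split; first by exists 0; apply: nearW => i; rewrite /sec_norm2 big1 // => x _;
  rewrite /rdot linear0l.
by move=> r; apply: nearW => i x [].
Qed.

Lemma ultra_formP a xi ze th : ultra_dom xi -> ultra_dom ze -> ultra_dom th ->
  ultra_form (a *: xi + ze) th = a * ultra_form xi th + ultra_form ze th.
Proof.
move=> Wx Wz Wt; have Wxz := ultra_domP a Wx Wz.
apply: (ccvg_unique wU (ultra_cvg_form Wxz Wt)).
have -> : sec_dot (a *: xi + ze) th = (fun i => a * sec_dot xi th i + sec_dot ze th i).
  apply/funext => i; rewrite /sec_dot mulr_sumr -big_split /=.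
  by apply: eq_bigr => x _; rewrite linearDl linearZl_LR.
by apply: ccvgP; exact: ultra_cvg_form.
Qed.

Lemma ultra_formC xi ze : ultra_dom xi -> ultra_dom ze ->
  ultra_form xi ze = Num.conj (ultra_form ze xi).
Proof.
move=> Wx Wz; apply: (ccvg_unique wU (ultra_cvg_form Wx Wz)).
have -> : sec_dot xi ze = (fun i => Num.conj (sec_dot ze xi i)).
  apply/funext => i; rewrite /sec_dot rmorph_sum /=.
  by apply: eq_bigr => x _; rewrite hdotC.
exact: ccvg_conj (ultra_cvg_form Wz Wx).
Qed.

Lemma ultra_norm_cvg xi : ultra_dom xi ->
  sec_norm2 xi i @[i --> w] --> complex.Re (ultra_form xi xi).
Proof.
move=> Wx; have [+ _] := ultra_cvg_form Wx Wx.
by apply: near_eq_lim; apply: nearW => i; rewrite sec_dot_diag.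
Qed.

Lemma ultra_form_ge0 xi : ultra_dom xi -> 0 <= ultra_form xi xi.
Proof.
move=> Wx; have [_ im] := ultra_cvg_form Wx Wx.
have im0 : complex.Im (ultra_form xi xi) = 0.
  apply: (cvg_unique _ im) => //.
  have -> : (fun i => complex.Im (sec_dot xi xi i)) = (fun=> 0).
    by apply/funext => i; rewrite sec_dot_diag.
  exact: cvg_cst.
rewrite lecE im0 eqxx /=; apply: (cvgr_to_ge (ultra_norm_cvg Wx)).
by apply: nearW => i; exact: sec_norm2_ge0.
Qed.

Lemma ultra_domB xi ze : ultra_dom xi -> ultra_dom ze -> ultra_dom (xi - ze).
Proof.
by move=> Wx Wz; rewrite addrC -scaleN1r; exact: ultra_domP.
Qed.

(** Diagonal argument: pass to a subsequence [eta] with [1 / (j + 1)] as rate, and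
take [v] equal to [eta (J i)] on [X i], where [J] tends to infinity so slowly that
the inequalities between the first [J i] terms and the depth of the support of
[eta (J i)] are already visible at the index [i]. *)
Lemma ultra_complete (u : nat -> V) : (forall n, ultra_dom (u n)) ->
  (forall e : R, 0 < e -> exists N : nat, forall m n : nat,
    (N <= m)%N -> (N <= n)%N ->
    complex.Re (ultra_form (u m - u n) (u m - u n)) < e) ->
  exists2 v, ultra_dom v & forall e : R, 0 < e -> exists N : nat,
    forall n : nat, (N <= n)%N ->
    complex.Re (ultra_form (u n - v) (u n - v)) < e.
Proof.
move=> Wu cau; have wF : Filter w by exact: _.
pose eps (j : nat) : R := j.+1%:R^-1.
have eps0 j : 0 < eps j by rewrite invr_gt0.
have /choice[N NP] (j : nat) := cau (eps j) (eps0 j).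
pose k (j : nat) := (\max_(a < j.+1) N a)%N.
have Nk a j : (a <= j)%N -> (N a <= k j)%N.
  by rewrite -ltnS => aj; exact: (leq_bigmax (Ordinal aj)).
pose eta j := u (k j).
have Weta j : ultra_dom (eta j) by exact: Wu.
(* P j i holds for most i, since it states finitely many properties of sections
   whose limits are known. *)
pose P j i := (forall a, (a <= j)%N -> sec_norm2 (eta a - eta j) i <= eps a) /\
  forall x : X i, eta j (in_space x) <> 0 -> deep j x.
have evP j : \forall i \near w, P j i.
  suff cl : \forall i \near w, forall a, `I_j.+1 a -> sec_norm2 (eta a - eta j) i <= eps a.
    apply: filterS2 cl ((Weta j).2 j) => i h1 h2; by split=> // a aj; exact: h1.
  apply: (@near_finite_set _ w `I_j.+1 (fun a i => sec_norm2 (eta a - eta j) i <= eps a) wF).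
    exact: finite_II.
  move=> a /=; rewrite ltnS => aj.
  apply: cvgr_le (ultra_norm_cvg (ultra_domB (Weta a) (Weta j))) _ _.
  by apply: NP; [exact: Nk|exact: Nk].
have [J JP] := diagonal_index wF oow evP.
pose v : V := fun q => eta (J (tag q)) q.
have vE i (x : X i) : v (in_space x) = eta (J i) (in_space x) by [].
have sec_v xi i : sec_norm2 (xi - v) i = sec_norm2 (xi - eta (J i)) i.
  by apply: eq_bigr => x _.
have close a : \forall i \near w, sec_norm2 (eta a - v) i <= eps a.
  by apply: filterS (JP a) => i [aJ [cl _]]; rewrite sec_v; exact: cl.
have Wv : ultra_dom v.
  split; last first.
    move=> r; apply: filterS (JP r) => i [rJ [_ dp]] x; rewrite vE => /dp.
    exact: deep_mono.
  have [[M etaM] _] := Weta 0%N; exists (2 * M + 2 * eps 0).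
  apply: filterS2 etaM (close 0%N) => i hM hc.
  have -> : v = eta 0%N - (eta 0%N - v) by rewrite opprB addrC subrK.
  apply: le_trans (sec_norm2D _ _ _) _; rewrite sec_norm2N.
  by rewrite lerD // ler_wpM2l.
exists v => // e e0.
have [a ae] : exists a, eps a < e / 4.
  exists (Num.trunc (e / 4)^-1); rewrite /eps invf_plt ?posrE ?divr_gt0 //.
  exact: truncnS_gt.
exists (k a) => n kn.
have lt1 : complex.Re (ultra_form (u n - eta a) (u n - eta a)) < eps a.
  by apply: NP; [exact: leq_trans (Nk a a (leqnn a)) kn|exact: Nk].
have le2 : complex.Re (ultra_form (eta a - v) (eta a - v)) <= eps a.
  exact: (cvgr_to_le (ultra_norm_cvg (ultra_domB (Weta a) Wv)) (close a)).
suff : complex.Re (ultra_form (u n - v) (u n - v)) <=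
    2 * complex.Re (ultra_form (u n - eta a) (u n - eta a)) +
    2 * complex.Re (ultra_form (eta a - v) (eta a - v)).
  move: lt1 le2 ae; clear; lra.
have W1 := ultra_domB (Wu n) (Weta a); have W2 := ultra_domB (Weta a) Wv.
have W3 := ultra_domB (Wu n) Wv.
have lim12 : 2 * sec_norm2 (u n - eta a) i + 2 * sec_norm2 (eta a - v) i @[i --> w] -->
    2 * complex.Re (ultra_form (u n - eta a) (u n - eta a)) +
    2 * complex.Re (ultra_form (eta a - v) (eta a - v)).
  by apply: cvgD; apply: cvgMr; exact: ultra_norm_cvg.
apply: (ler_cvg_to (ultra_norm_cvg W3) lim12); apply: nearW => i.
have -> : u n - v = (u n - eta a) + (eta a - v) by rewrite addrA subrK.
exact: sec_norm2D.
Qed.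

Definition ultraproduct : prehilbert R :=
  Prehilbert ultra_dom0 ultra_domP ultra_formP ultra_formC ultra_form_ge0
    ultra_complete.

End Ultraproduct.

(** * The modulus as a real number *)

Section ComplexModulus.
Variable R : realType.
Implicit Types z : R[i].

Definition cabs z : R := complex.Re `|z|.

Lemma cabsE z : `|z| = (cabs z)%:C%C.
Proof. by rewrite /cabs RRe_real ?normr_real. Qed.

Lemma cabs_ge0 z : 0 <= cabs z.
Proof. by rewrite -ler0c -cabsE normr_ge0. Qed.

Lemma cabs0 : cabs 0 = 0.
Proof. by rewrite /cabs normr0. Qed.

Lemma cabsM z z' : cabs (z * z') = cabs z * cabs z'.
Proof. by apply: complexI; rewrite /= rmorphM /= -!cabsE normrM. Qed.

Lemma cabsD z z' : cabs (z + z') <= cabs z + cabs z'.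
Proof. by rewrite -lecR rmorphD /= -!cabsE ler_normD. Qed.

Lemma cabs_conj z : cabs (Num.conj z) = cabs z.
Proof. by rewrite /cabs norm_conjC. Qed.

Lemma cabs_sum (I : Type) (r : seq I) (P : pred I) (F : I -> R[i]) :
  cabs (\sum_(i <- r | P i) F i) <= \sum_(i <- r | P i) cabs (F i).
Proof.
elim/big_rec2: _ => [|i a b _ ab]; first by rewrite cabs0.
by apply: le_trans (cabsD _ _) _; rewrite lerD2l.
Qed.

End ComplexModulus.

(** * Points deep inside charts *)

Section Deep.
Variables (R : realType) (G : groupType) (S : set G).
Variables (X : nat -> finType) (sigma : forall i, G -> {perm X i}).
Arguments sigma : clear implicits.
Variables (m : nat -> nat) (Y : forall i, {set X i}).
Hypothesis fr : frame R S sigma m Y.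
Hypothesis conn : graphs_connected sigma S.
Variable d : graph_space X -> graph_space X -> R.
Hypothesis dP : space_metric sigma S d.

(** A point of the orbit of a good point from which [r] more steps stay in the
region described by the frame. *)
Definition deep_in r i (x : X i) : Prop := exists k g x0,
  [/\ x0 \in Y i, word_ball S k g, (k + r <= m i)%N & x = sigma i g x0].

Lemma deep_in_mono r s i (x : X i) : (r <= s)%N -> deep_in s x -> deep_in r x.
Proof.
move=> rs [k [g [x0 [Yx0 Bg ks xE]]]]; exists k, g, x0; split=> //.
by apply: leq_trans ks; rewrite leq_add2l.
Qed.

Lemma deep_chart a i (x y : X i) : deep_in a x ->
  d (in_space x) (in_space y) <= a%:R ->
  word_ball S a (chart S sigma m x y) /\ y = sigma i (chart S sigma m x y) x.
Proof.
move=> [k [g [x0 [Yx0 Bg ka ->]]]] dxy.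
have ka4 : (k + a <= 4 * m i)%N by lia.
have [h Bh ->] := orbit_dist fr conn dP Yx0 ka4 Bg dxy.
have Bg' : word_ball S (m i) g by apply: word_ball_sub Bg; lia.
have Bh' : word_ball S (m i) h by apply: word_ball_sub Bh; lia.
rewrite (chartE fr) //; split=> //.
by rewrite (frame_mul fr Yx0) //; apply: word_ball_sub; [|exact: Bh'| |exact: Bg']; lia.
Qed.

Lemma deep_move r a i (x y : X i) : deep_in (r + a) x ->
  d (in_space x) (in_space y) <= a%:R -> deep_in r y.
Proof.
move=> [k [g [x0 [Yx0 Bg ka ->]]]] dxy.
have ka4 : (k + a <= 4 * m i)%N by lia.
have [h Bh ->] := orbit_dist fr conn dP Yx0 ka4 Bg dxy.
exists (a + k)%N, (h * g)%g, x0; split=> //; first exact: word_ballM.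
by lia.
Qed.

(** All three points are in the orbit of one good point, where charts are quotients
of group elements. *)
Lemma chart_cocycle a b i (x y z : X i) : deep_in (a + b) x ->
  d (in_space x) (in_space y) <= a%:R -> d (in_space y) (in_space z) <= b%:R ->
  chart S sigma m x z = (chart S sigma m y z * chart S sigma m x y)%g.
Proof.
move=> [k [g [x0 [Yx0 Bg ka ->]]]] dxy.
have ka4 : (k + a <= 4 * m i)%N by lia.
have [h Bh ->] := orbit_dist fr conn dP Yx0 ka4 Bg dxy => dyz.
have Bhg : word_ball S (a + k) (h * g)%g by exact: word_ballM.
have kb4 : (a + k + b <= 4 * m i)%N by lia.
have [h' Bh' ->] := orbit_dist fr conn dP Yx0 kb4 Bhg dyz.
have Bm l e : word_ball S l e -> (l <= m i)%N -> word_ball S (m i) e.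
  by move=> Be lm; exact: word_ball_sub Be.
rewrite (chartE fr Yx0 (Bm _ _ Bhg _) (Bm _ _ Bh' _)); try lia.
rewrite (chartE fr Yx0 (Bm _ _ Bg _) (Bm _ _ Bh _)); try lia.
rewrite mulgA (chartE fr Yx0 (Bm _ _ Bg _)) //; first by lia.
by apply: (Bm (b + a)%N); [exact: word_ballM|lia].
Qed.

Lemma chart_inv a i (x y : X i) : deep_in a x ->
  d (in_space x) (in_space y) <= a%:R ->
  chart S sigma m y x = (chart S sigma m x y)^-1%g.
Proof.
move=> [k [g [x0 [Yx0 Bg ka ->]]]] dxy.
have ka4 : (k + a <= 4 * m i)%N by lia.
have [h Bh ->] := orbit_dist fr conn dP Yx0 ka4 Bg dxy.
have Bg' : word_ball S (m i) g by apply: word_ball_sub Bg; lia.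
have Bh' : word_ball S (m i) h by apply: word_ball_sub Bh; lia.
rewrite (chartE fr Yx0 Bg' Bh') -{2}(mulKg h g) (chartE fr Yx0) //.
  by apply: (@word_ball_sub _ _ (a + k)); [lia|exact: word_ballM].
exact: word_ballV.
Qed.

Lemma chart_orbit a i (x : X i) s : deep_in a x -> word_ball S a s ->
  chart S sigma m x (sigma i s x) = s.
Proof.
move=> [k [g [x0 [Yx0 Bg ka ->]]]] Bs.
have Bg' : word_ball S (m i) g by apply: word_ball_sub Bg; lia.
have Bs' : word_ball S (m i) s by apply: word_ball_sub Bs; lia.
have B4 h : word_ball S (m i) h -> word_ball S (4 * m i) h.
  by apply: word_ball_sub; lia.
by rewrite (frame_mul fr Yx0) ?(chartE fr Yx0) //; exact: B4.
Qed.

Lemma dist_deep a i (x : X i) s : deep_in a x -> word_ball S a s ->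
  d (in_space x) (in_space (sigma i s x)) <= a%:R.
Proof.
move=> [k [g [x0 [Yx0 Bg ka ->]]]] Bs.
rewrite (frame_mul fr Yx0); last 2 first.
- by apply: word_ball_sub Bs; lia.
- by apply: word_ball_sub Bg; lia.
by apply: (dist_orbit fr dP Yx0 _ Bg Bs); lia.
Qed.

Lemma sigma1_deep i (x : X i) : deep_in 0 x -> sigma i 1%g x = x.
Proof.
move=> [k [g [x0 [Yx0 Bg ka ->]]]]; rewrite (frame_mul fr Yx0) ?mul1g //.
  exact: word_ball_id.
by apply: word_ball_sub Bg; lia.
Qed.

Lemma chart_id i (x : X i) : deep_in 0 x -> chart S sigma m x x = 1%g.
Proof.
move=> dx; rewrite -{2}(sigma1_deep dx) (chart_orbit dx) //.
Qed.

End Deep.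

Lemma rdot_sum_le (R : realType) (H : hilbert R) (I : finType) (A : {set I}) (v : I -> H) :
  rdot (\sum_(x in A) v x) (\sum_(x in A) v x) <= #|A|%:R * \sum_(x in A) rdot (v x) (v x).
Proof.
have [/eqP|A0] := posnP #|A|.
  by rewrite cards_eq0 => /eqP ->; rewrite !big_set0 mulr0 /rdot linear0l.
pose n : R := #|A|%:R; have n0 : 0 < n by rewrite ltr0n.
set s := \sum_(x in A) v x.
have rdot_sumr u : rdot u s = \sum_(x in A) rdot u (v x).
  rewrite /s; elim/big_rec2: _ => [|x a b _ <-]; last by rewrite rdotDr.
  by rewrite rdotC /rdot linear0l.
have : 0 <= \sum_(x in A) rdot ((n%:C)%C *: v x - s) ((n%:C)%C *: v x - s).
  by apply: sumr_ge0 => x _; exact: rdot_ge0.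
rewrite (eq_bigr (fun x => n ^+ 2 * rdot (v x) (v x) - 2 * n * rdot s (v x) +
  rdot s s)); last first.
  by move=> x _; rewrite !rdotE (rdotC (v x) s); ring.
rewrite big_split /= sumrB -!mulr_sumr -rdot_sumr sumr_const -mulr_natl -/n.
set b := rdot s s; set c := \sum_(x in A) _ => h.
rewrite -(ler_pM2l n0); move: h; nra.
Qed.

(** * The action of matrices on sections *)

Section Operators.
Variables (R : realType) (G : groupType) (S : set G).
Variables (X : nat -> finType) (sigma : forall i, G -> {perm X i}).
Arguments sigma : clear implicits.
Variables (m : nat -> nat) (Y : forall i, {set X i}).
Hypothesis fr : frame R S sigma m Y.
Hypothesis finS : finite_set S.
Hypothesis conn : graphs_connected sigma S.
Variable d : graph_space X -> graph_space X -> R.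
Hypothesis dP : space_metric sigma S d.
Variable w : set_system nat.
Hypotheses (wU : UltraFilter w) (oow : \oo `<=` w).
Variables (H : hilbert R) (pi : G -> {linear H -> H}).
Hypothesis piU : unitary_rep pi.

Local Notation T := (graph_space X).
Local Notation V := (T -> H).
Local Notation chart := (chart S sigma m).
Local Notation deep := (deep_in S sigma m Y).
Local Notation dom := (ultra_dom w deep).
Implicit Types (t u : mat R T) (xi ze : V).

(** The matrix [t] acts as on l^2, except that the value at [x] is carried to [y] by
the representation along the chart from [x] to [y]. *)
Definition section_op t xi : V := fun q =>
  \sum_(x : X (tag q)) t (in_space x) q *: pi (chart x (tagged q)) (xi (in_space x)).

Lemma section_opE t xi i (y : X i) : section_op t xi (in_space y) =
  \sum_(x : X i) t (in_space x) (in_space y) *: pi (chart x y) (xi (in_space x)).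
Proof. by []. Qed.

(** What remains of membership in [C[X]] far out in the space: propagation at most
[r], entries of modulus at most [C], and no entries between different graphs. *)
Definition controlled t (r : nat) (C : R) i : Prop := forall x : X i,
  [/\ forall q, t (in_space x) q <> 0 ->
        exists2 y : X i, q = in_space y & d (in_space x) (in_space y) <= r%:R,
      forall q, t q (in_space x) <> 0 ->
        exists2 y : X i, q = in_space y & d (in_space x) (in_space y) <= r%:R
    & forall y : X i, cabs (t (in_space x) (in_space y)) <= C].

Definition asymp_controlled t : Prop :=
  exists r C, \forall i \near \oo, controlled t r C i.

(** The entries of a bounded operator are bounded by its norm, as its action on the
functions delta shows; and the entries within a bounded distance of [X i] stay in
[X i] for large [i]. *)
Lemma CX_controlled t : CX d t -> asymp_controlled t.
Proof.
move=> [[r0 tr0] [M tM]].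
have [r r0r] : exists r : nat, r0 <= r%:R.
  by exists (Num.trunc `|r0|).+1; rewrite (le_trans (ler_norm r0)) // ltW // truncnS_gt.
exists r, (Num.sqrt M); apply: filterS (near_separated dP r%:R) => i sep x; split.
- move=> q /tr0 dq; have dq' := le_trans dq r0r.
  by have [y qE] := sep x q dq'; exists y => //; rewrite -qE.
- move=> q /tr0 dq; have dq' : d (in_space x) q <= r%:R.
    by rewrite (dist_sym dP); exact: le_trans dq r0r.
  by have [y qE] := sep x q dq'; exists y => //; rewrite -qE.
move=> y; pose dlt : T -> R[i] := fun q => (q == in_space x)%:R.
have dltE q : (complex.Re `|dlt q| ^+ 2) = (q == in_space x)%:R :> R.
  by rewrite /dlt normr_nat; case: (q == _); rewrite ?expr1n // expr0n.
have norm1 : l2_sqnorm dlt = 1%E.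
  rewrite /l2_sqnorm (@esum_component X R i).
  - rewrite (bigD1 x) //= dltE eqxx big1 ?addr0 // => z zx.
    rewrite dltE; case: eqP => // /in_space_inj zx'.
    by rewrite zx' eqxx in zx.
  - by move=> q; rewrite dltE ler0n.
  - by move=> q; rewrite dltE; case: eqP => // -> _; exists x.
have appE q : mat_app t dlt q = t (in_space x) q.
  rewrite /mat_app (@fsbig_component X _ _ _ i) => [|z].
    rewrite (bigD1 x) //= /dlt eqxx mulr1 big1 ?addr0 // => z zx.
    by case: eqP => [/in_space_inj zx'|_]; [rewrite zx' eqxx in zx|rewrite mulr0].
  by rewrite /dlt; case: eqP => [-> _|_]; [exists x|rewrite mulr0].
have := tM dlt; rewrite norm1 mule1 ltry => /(_ isT) le1.
have : ((cabs (t (in_space x) (in_space y)) ^+ 2)%:E <= M%:E)%E.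
  apply: le_trans le1; rewrite /l2_sqnorm; apply: esum_ge.
  exists [set in_space y]; first by split=> //; exact: finite_set1.
  by rewrite fsbig_set1 appE.
rewrite lee_fin => le2; rewrite -(ger0_norm (cabs_ge0 _)) -sqrtr_sqr.
by rewrite ler_sqrt // (le_trans _ le2) // sqr_ge0.
Qed.

Lemma asymp_controlled_add t u :
  asymp_controlled t -> asymp_controlled u -> asymp_controlled (mat_add t u).
Proof.
move=> [r [C tC]] [s [D uD]]; exists (maxn r s), (C + D).
have mono (i : nat) (x : X i) (q : T) k l : (k <= l)%N ->
    (exists2 y : X i, q = in_space y & d (in_space x) (in_space y) <= k%:R) ->
    exists2 y : X i, q = in_space y & d (in_space x) (in_space y) <= l%:R.
  by move=> kl [y -> dy]; exists y => //; rewrite (le_trans dy) // ler_nat.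
apply: filterS2 tC uD => i tC uD x; have [t1 t2 t3] := tC x; have [u1 u2 u3] := uD x.
split=> [q|q|y]; last first.
  by apply: le_trans (cabsD _ _) _; rewrite lerD.
- rewrite /mat_add; have [->|/eqP/t2/mono hq _] := eqVneq (t q (in_space x)) 0.
    by rewrite add0r => /u2/mono; apply; rewrite leq_maxr.
  by apply: hq; rewrite leq_maxl.
- rewrite /mat_add; have [->|/eqP/t1/mono hq _] := eqVneq (t (in_space x) q) 0.
    by rewrite add0r => /u1/mono; apply; rewrite leq_maxr.
  by apply: hq; rewrite leq_maxl.
Qed.

Lemma asymp_controlled_scale a t :
  asymp_controlled t -> asymp_controlled (mat_scale a t).
Proof.
move=> [r [C tC]]; exists r, (cabs a * C); apply: filterS tC => i tC x.
have [t1 t2 t3] := tC x; split=> [q nz|q nz|y].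
- by apply: t1 => t0; apply: nz; rewrite /mat_scale t0 mulr0.
- by apply: t2 => t0; apply: nz; rewrite /mat_scale t0 mulr0.
- by rewrite cabsM ler_wpM2l ?cabs_ge0.
Qed.

Lemma asymp_controlled_adj t : asymp_controlled t -> asymp_controlled (mat_adj t).
Proof.
move=> [r [C tC]]; exists r, C; apply: filterS tC => i tC x.
have [t1 t2 t3] := tC x; split=> [q nz|q nz|y].
- by apply: t2 => t0; apply: nz; rewrite /mat_adj t0 rmorph0.
- by apply: t1 => t0; apply: nz; rewrite /mat_adj t0 rmorph0.
- by have [_ _ t3'] := tC y; rewrite cabs_conj.
Qed.

Lemma asymp_controlled_one : asymp_controlled (@mat_one R T).
Proof.
have d0 p : d p p = 0 by have [[_ d0 _ _] _ _] := dP; exact/d0.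
exists 0%N, 1; apply: nearW => i x; split=> [q|q|y]; rewrite /mat_one.
- by case: eqP => // <- _; exists x => //; rewrite d0.
- by case: eqP => // -> _; exists x => //; rewrite d0.
- by rewrite /cabs normr_nat; case: (_ == _) => /=; rewrite ?ler01.
Qed.

Lemma mat_subE t u : mat_sub t u = mat_add t (mat_scale (-1) u).
Proof.
by apply/funext => x; apply/funext => y; rewrite /mat_sub /mat_add /mat_scale mulN1r.
Qed.

Lemma asymp_controlled_sub t u :
  asymp_controlled t -> asymp_controlled u -> asymp_controlled (mat_sub t u).
Proof.
move=> tC uC; rewrite mat_subE; apply: asymp_controlled_add => //.
exact: asymp_controlled_scale.
Qed.

Lemma mat_mulE t u r C i (x : X i) q : controlled u r C i ->
  mat_mul t u (in_space x) q = \sum_(z : X i) u (in_space x) (in_space z) * t (in_space z) q.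
Proof.
move=> uC; have [u1 _ _] := uC x; apply: fsbig_component => z nz.
by have [|y -> _] := u1 z; [move=> u0; apply: nz; rewrite u0 mul0r|exists y].
Qed.

Lemma asymp_controlled_mul t u :
  asymp_controlled t -> asymp_controlled u -> asymp_controlled (mat_mul t u).
Proof.
move=> [r [C tC]] [s [C' uC']].
have [D DP] := card_metric_ball conn dP s finS.
have [[_ _ _ tri] _ _] := dP.
exists (s + r)%N, (D%:R * (C' * C)).
apply: filterS2 tC uC' => i tC uC' x; split=> [q nz|q nz|y].
- have [z uz tz] : exists2 z, u (in_space x) z <> 0 & t z q <> 0.
    apply: contrapT => nex; apply: nz; apply: fsbig1 => z _.
    have [->|/eqP uz] := eqVneq (u (in_space x) z) 0; first by rewrite mul0r.
    have [->|/eqP tz] := eqVneq (t z q) 0; first by rewrite mulr0.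
    by case: nex; exists z.
  have [u1 _ _] := uC' x; have [z' zE dz] := u1 z uz; subst z.
  have [t1 _ _] := tC z'; have [y -> dy] := t1 q tz; exists y => //.
  by rewrite natrD (le_trans (tri _ (in_space z') _)) // lerD.
- have [z uz tz] : exists2 z, u q z <> 0 & t z (in_space x) <> 0.
    apply: contrapT => nex; apply: nz; apply: fsbig1 => z _.
    have [->|/eqP uz] := eqVneq (u q z) 0; first by rewrite mul0r.
    have [->|/eqP tz] := eqVneq (t z (in_space x)) 0; first by rewrite mulr0.
    by case: nex; exists z.
  have [_ t2 _] := tC x; have [z' zE dz] := t2 z tz; subst z.
  have [_ u2 _] := uC' z'; have [y -> dy] := u2 q uz; exists y => //.
  by rewrite addnC natrD (le_trans (tri _ (in_space z') _)) // lerD.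
rewrite (mat_mulE _ _ _ uC'); apply: le_trans (cabs_sum _ _ _) _.
pose A := [set z : X i | d (in_space x) (in_space z) <= s%:R]%SET.
have C0 : 0 <= C by have [_ _ c] := tC x; exact: le_trans (cabs_ge0 _) (c x).
have C'0 : 0 <= C' by have [_ _ c] := uC' x; exact: le_trans (cabs_ge0 _) (c x).
rewrite (bigID (mem A)) /= [X in _ + X]big1 ?addr0; last first.
  move=> z /negP nA; have [u1 _ _] := uC' x.
  have [->|/eqP /u1[z' /in_space_inj <- dz]] := eqVneq (u (in_space x) (in_space z)) 0.
    by rewrite mul0r cabs0.
  by case: nA; rewrite inE.
apply: (@le_trans _ _ (\sum_(z in A) (C' * C))).
  apply: ler_sum => z _; rewrite cabsM; have [_ _ u3] := uC' x; have [_ _ t3] := tC z.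
  by apply: ler_pM; rewrite ?cabs_ge0.
by rewrite sumr_const -[leLHS]mulr_natl ler_wpM2r ?mulr_ge0 // ler_nat; exact: DP.
Qed.

Lemma rdot_pi g v1 v2 : rdot (pi g v1) (pi g v2) = rdot v1 v2.
Proof. by rewrite /rdot; have [_ _ ->] := piU. Qed.

Lemma section_opP t a xi ze : section_op t (a *: xi + ze) =
  a *: section_op t xi + section_op t ze.
Proof.
apply/funext => q; rewrite /section_op -[RHS]/(a *: _ + _) scaler_sumr -big_split /=.
apply: eq_bigr => x _; rewrite -[(a *: xi + ze) _]/(a *: xi _ + ze _).
by rewrite linearP scalerDr !scalerA [a * _]mulrC.
Qed.

Lemma section_op_add t u xi :
  section_op (mat_add t u) xi = section_op t xi + section_op u xi.
Proof.
apply/funext => q; rewrite /section_op -[RHS]/(_ + _) -big_split /=.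
by apply: eq_bigr => x _; rewrite -scalerDl.
Qed.

Lemma section_op_scale a t xi : section_op (mat_scale a t) xi = a *: section_op t xi.
Proof.
apply/funext => q; rewrite /section_op -[RHS]/(a *: _) scaler_sumr.
by apply: eq_bigr => x _; rewrite scalerA.
Qed.

(** The Schur test: the rows and the columns have at most [D] nonzero entries, of
modulus at most [C], and the charts act by isometries. *)
Lemma section_op_bound t r C i D xi : controlled t r C i ->
  (forall x : X i, (#|[set y : X i | (d (in_space x) (in_space y) <= r%:R)%R]%SET| <= D)%N) ->
  sec_norm2 (section_op t xi) i <= (C * D%:R) ^+ 2 * sec_norm2 xi i.
Proof.
move=> tC DP; pose A (y : X i) := [set x : X i | d (in_space y) (in_space x) <= r%:R]%SET.
have local y : rdot (section_op t xi (in_space y)) (section_op t xi (in_space y)) <=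
    D%:R * \sum_(x in A y) C ^+ 2 * rdot (xi (in_space x)) (xi (in_space x)).
  rewrite section_opE (bigID (mem (A y))) /= [X in _ + X]big1 ?addr0; last first.
    move=> x /negP nA; have [t1 _ _] := tC x.
    have [->|/eqP /t1[y' /in_space_inj <- dxy]] := eqVneq (t (in_space x) (in_space y)) 0.
      by rewrite scale0r.
    by case: nA; rewrite inE (dist_sym dP).
  apply: le_trans (rdot_sum_le _ _) _; apply: ler_pM; rewrite ?ler_nat ?DP //.
    by apply: sumr_ge0 => x _; exact: rdot_ge0.
  apply: ler_sum => x _; rewrite rdotZ_complex rdot_pi ler_wpM2r ?rdot_ge0 //.
  have [_ _ t3] := tC x; rewrite ler_pXn2r ?nnegrE ?cabs_ge0 //.
    exact: t3.
  by apply: le_trans (t3 x); exact: cabs_ge0.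
apply: le_trans (ler_sum _ (fun y _ => local y)) _.
rewrite -mulr_sumr (exchange_big_dep xpredT) //=.
have -> : (C * D%:R) ^+ 2 * sec_norm2 xi i = D%:R * (D%:R * (C ^+ 2 * sec_norm2 xi i)).
  by ring.
rewrite ler_wpM2l //.
rewrite /sec_norm2 !mulr_sumr; apply: ler_sum => x _.
rewrite sumr_const -[leLHS]mulr_natl.
apply: ler_wpM2r; first by rewrite mulr_ge0 ?sqr_ge0 ?rdot_ge0.
rewrite ler_nat; apply: leq_trans (DP x).
rewrite -[leqLHS]cardsE; apply: subset_leq_card; apply/fintype.subsetP => y.
by rewrite !inE unfold_in => Ayx; have : x \in A y by []; rewrite inE (dist_sym dP).
Qed.

Lemma section_op_dom t xi : asymp_controlled t -> dom xi -> dom (section_op t xi).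
Proof.
move=> [r [C tC]] [[M xiM] xid]; have [D DP] := card_metric_ball conn dP r finS.
split.
  exists ((C * D%:R) ^+ 2 * M); apply: filterS2 (oow tC) xiM => i tCi hM.
  apply: le_trans (section_op_bound xi tCi (DP i)) _.
  by rewrite ler_wpM2l ?sqr_ge0.
move=> s; apply: filterS2 (oow tC) (xid (s + r)%N) => i tCi dp y.
move=> nz; have [x tx xx] : exists2 x : X i, t (in_space x) (in_space y) <> 0 &
    xi (in_space x) <> 0.
  apply: contrapT => nex; apply: nz; rewrite section_opE big1 // => x _.
  have [->|/eqP tx] := eqVneq (t (in_space x) (in_space y)) 0; first by rewrite scale0r.
  have [->|/eqP xx] := eqVneq (xi (in_space x)) 0; first by rewrite linear0 scaler0.
  by case: nex; exists x.
have [t1 _ _] := tCi x; have [y' /in_space_inj yy dxy] := t1 _ tx.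
by rewrite -yy in dxy; exact: (deep_move fr conn dP (dp x xx) dxy).
Qed.

Lemma section_op_form_bound t : asymp_controlled t -> exists M : R,
  forall xi, dom xi -> complex.Re (ultra_form w (section_op t xi) (section_op t xi)) <=
    M * complex.Re (ultra_form w xi xi).
Proof.
move=> tA; have [r [C tC]] := tA; have [D DP] := card_metric_ball conn dP r finS.
exists ((C * D%:R) ^+ 2) => xi Wx.
have lim2 : (C * D%:R) ^+ 2 * sec_norm2 xi i @[i --> w] -->
    (C * D%:R) ^+ 2 * complex.Re (ultra_form w xi xi).
  by apply: cvgMr; exact: (ultra_norm_cvg wU Wx).
apply: (ler_cvg_to (ultra_norm_cvg wU (section_op_dom tA Wx)) lim2).
by apply: filterS (oow tC) => i tCi; exact: section_op_bound.
Qed.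

(** On the support of [xi], which is deep, charts compose; multiplicativity then
holds exactly on almost all graphs. *)
Lemma section_op_mul t u xi : asymp_controlled t -> asymp_controlled u -> dom xi ->
  \forall i \near w, forall y : X i, section_op (mat_mul t u) xi (in_space y) =
    section_op t (section_op u xi) (in_space y).
Proof.
move=> [r [C tC]] [s [C' uC]] [_ xid].
have [piM1 piM _] := piU.
apply: filterS3 (oow tC) (oow uC) (xid (s + r)%N) => i tCi uCi dp y.
rewrite !section_opE; under [RHS]eq_bigr do rewrite section_opE linear_sum scaler_sumr.
rewrite [RHS]exchange_big /=; apply: eq_bigr => x _.
rewrite (mat_mulE _ _ _ uCi) scaler_suml; apply: eq_bigr => z _.
rewrite linearZ_LR scalerA [t _ _ * _]mulrC.
have [->|/eqP uz] := eqVneq (u (in_space x) (in_space z)) 0.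
  by rewrite mul0r !scale0r.
have [->|/eqP tz] := eqVneq (t (in_space z) (in_space y)) 0.
  by rewrite mulr0 !scale0r.
have [->|/eqP xx] := eqVneq (xi (in_space x)) 0; first by rewrite !linear0.
have [u1 _ _] := uCi x; have [_ /in_space_inj <- dxz] := u1 _ uz.
have [t1 _ _] := tCi z; have [_ /in_space_inj <- dzy] := t1 _ tz.
by rewrite (chart_cocycle fr conn dP (dp x xx) dxz dzy) piM.
Qed.

(** The inverse of [chart x y] is [chart y x] near deep points, and [pi] is unitary. *)
Lemma section_op_adj t xi ze : asymp_controlled t -> dom xi -> dom ze ->
  \forall i \near w, sec_dot (section_op t xi) ze i =
    sec_dot xi (section_op (mat_adj t) ze) i.
Proof.
move=> [r [C tC]] [_ xid] [_ zed]; have [piM1 piM piI] := piU.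
apply: filterS2 (oow tC) (xid r) => i tCi dp; rewrite /sec_dot.
under eq_bigr do rewrite section_opE linear_sumlz.
under [RHS]eq_bigr do rewrite section_opE linear_sumr.
rewrite exchange_big /=; apply: eq_bigr => x _; apply: eq_bigr => y _.
rewrite linearZl_LR linearZr_LR /= /mat_adj conjCK.
have [->|/eqP tx] := eqVneq (t (in_space x) (in_space y)) 0; first by rewrite !mul0r.
have [->|/eqP xx] := eqVneq (xi (in_space x)) 0.
  by rewrite linear0 !linear0l.
have [t1 _ _] := tCi x; have [_ /in_space_inj <- dxy] := t1 _ tx.
rewrite (chart_inv fr conn dP (dp x xx) dxy); congr (_ * _).
by rewrite -(piI (chart x y)^-1%g) -piM mulVg piM1.
Qed.

Lemma section_op_one xi : dom xi -> \forall i \near w, forall y : X i,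
  section_op (@mat_one R T) xi (in_space y) = xi (in_space y).
Proof.
move=> [_ xid]; have [piM1 _ _] := piU; apply: filterS (xid 0%N) => i dp y.
rewrite section_opE (bigD1 y) //= /mat_one eqxx scale1r big1 ?addr0; last first.
  move=> x xy; case: eqP => [/in_space_inj xy'|_]; last by rewrite scale0r.
  by rewrite xy' eqxx in xy.
have [->|/eqP/dp xx] := eqVneq (xi (in_space y)) 0; first by rewrite linear0.
by rewrite (chart_id fr xx) piM1.
Qed.

(** A matrix with finitely many entries meets finitely many graphs. *)
Lemma section_op_finite t xi : finite_set [set p : T * T | t p.1 p.2 <> 0] ->
  \forall i \near w, forall y : X i, section_op t xi (in_space y) = 0.
Proof.
move=> fin; apply: oow.
have : \forall i \near \oo, forall p, [set p : T * T | t p.1 p.2 <> 0] p -> tag p.2 <> i.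
  apply: near_finite_set => // -[p q] _ /=.
  by apply: filterS (nbhs_infty_gt (tag q)) => i qi qE; rewrite qE ltnn in qi.
apply: filterS => i ti y; rewrite section_opE big1 // => x _.
have [->|/eqP tx] := eqVneq (t (in_space x) (in_space y)) 0; first by rewrite scale0r.
by case: (ti (in_space x, in_space y) tx).
Qed.

End Operators.

(** * The boundary representation *)

Section OperatorNorm.
Variables (R : realType) (K : hilbert R).

Lemma opnorm_le (A : {linear K -> K}) (h : K) :
  bounded_op A -> hnorm (A h) <= opnorm A * hnorm h.
Proof.
move=> [M AM]; have [h0|h0] := eqVneq (hnorm h) 0.
  by rewrite (hnorm_eq0 h0) linear0 !hnorm_sqrt /rdot !linear0l sqrtr0 mulr0.
have hp : 0 < hnorm h by rewrite lt_def h0 hnorm_ge0.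
have ub : has_ubound [set hnorm (A v) | v in [set v : K | hnorm v <= 1]].
  exists `|M| => _ [v v1 <-]; apply: le_trans (AM v) _.
  apply: (@le_trans _ _ (`|M| * hnorm v)); first by rewrite ler_wpM2r ?hnorm_ge0 ?ler_norm.
  by rewrite ler_piMr.
rewrite -ler_pdivrMr //; apply: (ub_le_sup ub).
exists (((hnorm h)^-1)%:C%C *: h).
  by rewrite /= hnorm_scale ger0_norm ?invr_ge0 ?hnorm_ge0 // mulVf.
by rewrite linearZ_LR hnorm_scale ger0_norm ?invr_ge0 ?hnorm_ge0 // mulrC.
Qed.

End OperatorNorm.

Section BoundaryRepresentation.
Variables (R : realType) (G : groupType) (S : set G).
Variables (X : nat -> finType) (sigma : forall i, G -> {perm X i}).
Arguments sigma : clear implicits.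
Variables (m : nat -> nat) (Y : forall i, {set X i}).
Hypothesis fr : frame R S sigma m Y.
Hypothesis finS : finite_set S.
Hypothesis conn : graphs_connected sigma S.
Variable d : graph_space X -> graph_space X -> R.
Hypothesis dP : space_metric sigma S d.
Variable w : set_system nat.
Hypotheses (wU : UltraFilter w) (oow : \oo `<=` w).
Variables (H : hilbert R) (pi : G -> {linear H -> H}).
Hypothesis piU : unitary_rep pi.

Local Notation T := (graph_space X).
Local Notation V := (T -> H).
Local Notation deep := (deep_in S sigma m Y).
Local Notation dom := (ultra_dom w deep).
Local Notation section_op := (section_op S sigma m pi).
Implicit Types (t u : mat R T) (xi ze : V).

Definition boundary_space : prehilbert R :=
  @ultraproduct R w wU oow X H deep (deep_in_mono (S := S) (sigma := sigma) (m := m) (Y := Y)).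

Lemma ultra_form_near_eq xi ze : dom xi -> dom ze ->
  (\forall i \near w, forall x : X i, xi (in_space x) = ze (in_space x)) ->
  ultra_form w (xi - ze) (xi - ze) = 0.
Proof.
move=> Wx Wz eqn; have W := ultra_domB wU Wx Wz.
apply: (ccvg_unique wU (ultra_cvg_form wU W W)).
apply: (@ccvg_near _ _ wU _ (fun=> 0)); last by split; exact: cvg_cst.
apply: filterS eqn => i eqx; rewrite /sec_dot big1 // => x _.
by rewrite -[(xi - ze) _]/(xi _ - ze _) eqx subrr linear0l.
Qed.

Variables (K : hilbert R) (q : V -> K).
Hypothesis q_surj : forall h, exists2 xi, dom xi & h = q xi.
Hypothesis qP : forall a xi ze, dom xi -> dom ze -> q (a *: xi + ze) = a *: q xi + q ze.
Hypothesis q_dot : forall xi ze, dom xi -> dom ze ->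
  hdot K (q xi) (q ze) = ultra_form w xi ze.

Lemma q_near_eq xi ze : dom xi -> dom ze ->
  (\forall i \near w, forall x : X i, xi (in_space x) = ze (in_space x)) ->
  q xi = q ze.
Proof.
move=> Wx Wz eqn; apply: (@quotient_class_eq _ boundary_space _ q) => //.
exact: ultra_form_near_eq.
Qed.

(** The laws hold for all asymptotically controlled matrices and not only on [C[X]],
which dispenses with the proof that the Laplacian and the products of matrices are
bounded on l^2. *)
Record asymptotic_rep (rho : mat R T -> {linear K -> K}) : Prop := {
  asymp_repE : forall t xi, asymp_controlled d t -> dom xi ->
    rho t (q xi) = q (section_op t xi);
  asymp_rep_bounded : forall t, asymp_controlled d t -> bounded_op (rho t);
  asymp_rep_add : forall t u h, asymp_controlled d t -> asymp_controlled d u ->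
    rho (mat_add t u) h = rho t h + rho u h;
  asymp_rep_scale : forall a t h, asymp_controlled d t ->
    rho (mat_scale a t) h = a *: rho t h;
  asymp_rep_mul : forall t u h, asymp_controlled d t -> asymp_controlled d u ->
    rho (mat_mul t u) h = rho t (rho u h);
  asymp_rep_adj : forall t h k, asymp_controlled d t ->
    hdot K (rho t h) k = hdot K h (rho (mat_adj t) k);
  asymp_rep_one : forall h, rho (@mat_one R T) h = h;
  asymp_rep_finite : forall t h, asymp_controlled d t ->
    finite_set [set p : T * T | t p.1 p.2 <> 0] -> rho t h = 0 }.

Lemma exists_asymptotic_rep : exists rho, asymptotic_rep rho.
Proof.
have op_dom t xi : asymp_controlled d t -> dom xi -> dom (section_op t xi).
  exact: (section_op_dom fr finS conn dP wU oow piU).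
have ex_op t : exists L : {linear K -> K}, asymp_controlled d t ->
    forall xi, dom xi -> L (q xi) = q (section_op t xi).
  have [tA|ntA] := pselect (asymp_controlled d t); last by exists \0 => /ntA.
  have [L HL] := @quotient_operator _ boundary_space _ q q_surj qP q_dot (section_op t)
    (fun xi => op_dom t xi tA)
    (fun a x y _ _ => section_opP S sigma m pi t a x y)
    (section_op_form_bound fr finS conn dP wU oow piU tA).
  by exists L.
have [rho rhoP] := choice ex_op.
have rhoE t xi : asymp_controlled d t -> dom xi -> rho t (q xi) = q (section_op t xi).
  by move=> tA; exact: rhoP.
exists rho; split=> //.
- move=> t tA.
  have [M HM] := section_op_form_bound fr finS conn dP wU oow piU tA.
  exists (Num.sqrt `|M|) => h; have [xi Wx ->] := q_surj h.
  rewrite !hnorm_sqrt -sqrtrM ?normr_ge0 // ler_sqrt ?mulr_ge0 ?rdot_ge0 //.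
  rewrite rhoE // /rdot !q_dot //; try exact: op_dom.
  apply: le_trans (HM _ Wx) _; rewrite ler_wpM2r ?ler_norm //.
  by rewrite -q_dot // rdot_ge0.
- move=> t u h tA uA; have [xi Wx ->] := q_surj h.
  rewrite !rhoE //; last exact: asymp_controlled_add.
  rewrite section_op_add (@quotient_classD _ boundary_space _ q) //; exact: op_dom.
- move=> a t h tA; have [xi Wx ->] := q_surj h.
  rewrite !rhoE //; last exact: asymp_controlled_scale.
  rewrite section_op_scale (@quotient_classZ _ boundary_space _ q) //; exact: op_dom.
- move=> t u h tA uA; have [xi Wx ->] := q_surj h.
  have tuA := asymp_controlled_mul finS conn dP tA uA.
  rewrite (rhoE u) // (rhoE t) ?(rhoE (mat_mul t u)) //; last exact: op_dom.
  have Wu := op_dom _ _ uA Wx; have Wtu := op_dom _ _ tA Wu.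
  apply: (q_near_eq (op_dom _ _ tuA Wx) Wtu).
  exact: (section_op_mul fr conn dP wU oow piU tA uA).
- move=> t h k tA; have [xi Wx ->] := q_surj h; have [ze Wz ->] := q_surj k.
  have tA' := asymp_controlled_adj tA.
  rewrite !rhoE // !q_dot //; try exact: op_dom.
  apply: (ccvg_unique wU (ultra_cvg_form wU (op_dom _ _ tA Wx) Wz)).
  apply: (@ccvg_near _ _ wU); last exact: (ultra_cvg_form wU Wx (op_dom _ _ tA' Wz)).
  exact: (section_op_adj fr conn dP wU oow piU tA Wx Wz).
- move=> h; have [xi Wx ->] := q_surj h.
  have A1 := asymp_controlled_one dP; rewrite rhoE //.
  apply: (q_near_eq (op_dom _ _ A1 Wx) Wx).
  exact: (section_op_one fr wU piU Wx).
- move=> t h tA fin; have [xi Wx ->] := q_surj h.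
  rewrite rhoE // -(@quotient_class0 _ boundary_space _ q) //.
  apply: q_near_eq; [exact: op_dom|exact: (pre_dom0 boundary_space)|].
  by apply: section_op_finite fin.
Qed.

Lemma asymptotic_rep_boundary rho : asymptotic_rep rho -> boundary_rep d rho.
Proof.
move=> rP; have CA t : CX d t -> asymp_controlled d t by exact: (CX_controlled dP).
split; first split.
- by move=> t /CA; exact: asymp_rep_bounded.
- by move=> t u h /CA tA /CA uA; exact: asymp_rep_add.
- by move=> a t h /CA; exact: asymp_rep_scale.
- by move=> t u h /CA tA /CA uA; exact: asymp_rep_mul.
- by move=> t h k /CA; exact: asymp_rep_adj.
- by move=> t /CA tA fin h; exact: asymp_rep_finite.
Qed.

(** If [t - l] is invertible in the completion, then some matrix [v n] satisfies
[||v n (t - l) - 1|| <= 1/2] in every boundary representation; hence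
[||h|| / 2 <= ||v n|| ||(t - l) h||]. *)
Lemma resolvent_below rho t (l : R) : asymptotic_rep rho -> asymp_controlled d t ->
  ~ boundary_spec d t (l%:C)%C ->
  exists2 e : R, 0 < e & forall h, e * rdot h h <=
    rdot (rho t h - (l%:C)%C *: h) (rho t h - (l%:C)%C *: h).
Proof.
move=> rP tA /contrapT[v [[vCX _] _ inv]].
pose s := mat_sub t (mat_scale (l%:C)%C (@mat_one R T)).
have A1 := asymp_controlled_one dP.
have sA : asymp_controlled d s.
  by apply: asymp_controlled_sub => //; exact: asymp_controlled_scale.
have sE h : rho s h = rho t h - (l%:C)%C *: h.
  rewrite /s mat_subE (asymp_rep_add rP) //; last first.
    by do 2?apply: asymp_controlled_scale.
  rewrite (asymp_rep_scale rP); last exact: asymp_controlled_scale.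
  by rewrite (asymp_rep_scale rP) // (asymp_rep_one rP) scaleN1r.
have [n nlt] : exists n, (boundary_norm d
    (mat_sub (mat_mul (v n) s) (@mat_one R T)) < (2^-1)%:E)%E.
  have half : (0%E < (2^-1 : R)%:E)%E by rewrite lte_fin invr_gt0.
  by have [n _ /(_ n (leqnn n))] := inv _ (open_ereal_lt' half); exists n.
have vA : asymp_controlled d (v n) by exact: (CX_controlled dP).
have vsA := asymp_controlled_mul finS conn dP vA sA.
pose r := mat_sub (mat_mul (v n) s) (@mat_one R T).
have rA : asymp_controlled d r by exact: asymp_controlled_sub.
have rE h : rho r h = rho (v n) (rho s h) - h.
  rewrite /r mat_subE (asymp_rep_add rP) //; last exact: asymp_controlled_scale.
  by rewrite (asymp_rep_scale rP) // (asymp_rep_one rP) scaleN1r (asymp_rep_mul rP).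
have r2 : opnorm (rho r) <= 2^-1.
  rewrite -lee_fin; apply: le_trans (ltW nlt).
  apply: ereal_sup_ubound; exists K, rho; split=> //.
  exact: asymptotic_rep_boundary.
have [M HM] := asymp_rep_bounded rP vA.
pose N := `|M| + 1; have N0 : 0 < N by rewrite ltr_wpDl.
exists (4^-1 / N ^+ 2); first by rewrite divr_gt0 ?exprn_gt0.
move=> h; rewrite -sE.
have half : 2^-1 * hnorm h <= N * hnorm (rho s h).
  have h1 := opnorm_le h (asymp_rep_bounded rP rA).
  have h2 : opnorm (rho r) * hnorm h <= 2^-1 * hnorm h.
    by rewrite ler_wpM2r ?hnorm_ge0.
  have h3 := HM (rho s h).
  have h4 : M * hnorm (rho s h) <= N * hnorm (rho s h).
    by rewrite ler_wpM2r ?hnorm_ge0 // /N ler_wpDr // ler_norm.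
  have h5 : hnorm h <= hnorm (rho (v n) (rho s h)) + hnorm (rho r h).
    rewrite -[hnorm (rho r h)]hnorm_opp rE opprB.
    have -> : hnorm h = hnorm (rho (v n) (rho s h) + (h - rho (v n) (rho s h))).
      by rewrite addrC subrK.
    exact: hnorm_triangle.
  move: h1 h2 h3 h4 h5; lra.
rewrite -!sqr_hnorm mulrAC ler_pdivrMr ?exprn_gt0 //.
have := hnorm_ge0 h; move: half (hnorm_ge0 (rho s h)).
set a := hnorm h; set b := hnorm _; move=> ab b0 a0.
have : (2^-1 * a) ^+ 2 <= (N * b) ^+ 2.
  by rewrite ler_pXn2r ?nnegrE ?mulr_ge0 ?(ltW N0).
by rewrite !exprMn [b ^+ 2 * _]mulrC => h2; apply: le_trans h2;
  rewrite le_eqVlt; apply/orP; left; apply/eqP; field.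
Qed.

End BoundaryRepresentation.

(** * Translates and constant sections *)

Section Sections.
Variables (R : realType) (G : groupType) (S : set G).
Variables (X : nat -> finType) (sigma : forall i, G -> {perm X i}).
Arguments sigma : clear implicits.
Variables (m : nat -> nat) (Y : forall i, {set X i}).
Hypothesis fr : frame R S sigma m Y.
Hypothesis finS : finite_set S.
Hypothesis genS : generates S.
Hypothesis conn : graphs_connected sigma S.
Variable d : graph_space X -> graph_space X -> R.
Hypothesis dP : space_metric sigma S d.
Variable w : set_system nat.
Hypotheses (wU : UltraFilter w) (oow : \oo `<=` w).
Variables (H : hilbert R) (pi : G -> {linear H -> H}).
Hypothesis piU : unitary_rep pi.

Local Notation T := (graph_space X).
Local Notation V := (T -> H).
Local Notation deep := (deep_in S sigma m Y).
Local Notation dom := (ultra_dom w deep).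
Local Notation chart := (chart S sigma m).
Local Notation section_op := (section_op S sigma m pi).
Implicit Types (t u : mat R T) (xi ze : V).

Let rpi g v1 v2 : rdot (pi g v1) (pi g v2) = rdot v1 v2 := rdot_pi piU g v1 v2.

(** The diagonal action of [G]: it moves the points and the values at the same time. *)
Definition translate g xi : V :=
  fun p => pi g (xi (in_space ((sigma (tag p) g)^-1%g (tagged p)))).

Lemma translateE g xi i (y : X i) :
  translate g xi (in_space y) = pi g (xi (in_space ((sigma i g)^-1%g y))).
Proof. by []. Qed.

Lemma sec_dot_translate g xi ze i :
  sec_dot (translate g xi) (translate g ze) i = sec_dot xi ze i.
Proof.
rewrite [RHS](reindex_inj (@perm_inj _ (sigma i g)^-1%g)).
by apply: eq_bigr => x _; rewrite !translateE; have [_ _ ->] := piU.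
Qed.

Lemma sec_norm2_dot xi i : sec_norm2 xi i = complex.Re (sec_dot xi xi i).
Proof. by rewrite sec_dot_diag. Qed.

Lemma translate_dom g xi : dom xi -> dom (translate g xi).
Proof.
move=> [[M xiM] xid]; split.
  by exists M; apply: filterS xiM => i; rewrite !sec_norm2_dot sec_dot_translate.
have [k Bg] := word_ball_cover g genS.
move=> r; apply: filterS (xid (r + k)%N) => i dp y nz.
pose x := (sigma i g)^-1%g y; have yE : y = sigma i g x by rewrite /x permKV.
have dx : deep (r + k)%N x.
  by apply: dp => x0; apply: nz; rewrite translateE -/x x0 linear0.
apply: (deep_move fr conn dP dx); rewrite yE.
apply: (dist_deep fr dP) => //.
by apply: deep_in_mono dx; rewrite leq_addl.
Qed.

(** Normalised so that [v |-> constant_section v] is isometric in the limit, and cut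
off outside of [Y i] so that the support is deep. *)
Definition constant_section (v : H) : V := fun p =>
  if tagged p \in Y (tag p) then ((Num.sqrt #|X (tag p)|%:R)^-1)%:C%C *: v else 0.

Lemma constant_sectionE v i (y : X i) : constant_section v (in_space y) =
  if y \in Y i then ((Num.sqrt #|X i|%:R)^-1)%:C%C *: v else 0.
Proof. by []. Qed.

Let X0 i : (0 : R) < #|X i|%:R.
Proof. by rewrite ltr0n (frame_card fr). Qed.

Let inv_sqrt_card i : (Num.sqrt #|X i|%:R)^-1 * (Num.sqrt #|X i|%:R)^-1 = #|X i|%:R^-1 :> R.
Proof. by rewrite -expr2 exprVn sqr_sqrtr // ltW. Qed.

Lemma sec_dot_constant v1 v2 i : sec_dot (constant_section v1) (constant_section v2) i =
  (#|Y i|%:R / #|X i|%:R)%:C%C * hdot H v1 v2.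
Proof.
rewrite /sec_dot (bigID (mem (Y i))) /= [X in _ + X]big1 ?addr0; last first.
  by move=> x /negbTE nY; rewrite constant_sectionE nY linear0l.
rewrite (eq_bigr (fun=> (#|X i|%:R^-1)%:C%C * hdot H v1 v2)) => [|x Yx].
  by rewrite sumr_const -[LHS]mulr_natl mulrA rmorphM /= rmorph_nat.
rewrite !constant_sectionE Yx linearZl_LR linearZr_LR /= mulrA.
rewrite -inv_sqrt_card rmorphM /=; congr (_ * _ * _).
exact: conjc_real.
Qed.

Lemma constant_dom v : dom (constant_section v).
Proof.
split.
  exists (rdot v v); apply: nearW => i; rewrite sec_norm2_dot sec_dot_constant.
  rewrite hdot_rdot -rmorphM /= ler_piMl ?rdot_ge0 // ler_pdivrMr // mul1r.
  by rewrite ler_nat max_card.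
move=> r; apply: filterS (oow (frame_radius fr r)) => i rm y.
rewrite constant_sectionE; case: ifP => // Yy _.
exists 0%N, 1%g, y; split=> //; first by rewrite (frame_id fr Yy).
Qed.

Lemma constant_sectionP a v1 v2 :
  constant_section (a *: v1 + v2) = a *: constant_section v1 + constant_section v2.
Proof.
apply/funext => p; rewrite -[RHS]/(a *: constant_section v1 p + constant_section v2 p).
rewrite /constant_section; case: ifP => _; last by rewrite scaler0 addr0.
by rewrite scalerDr !scalerA [a * _]mulrC.
Qed.

Let dens_cvg : #|~: Y i|%:R / #|X i|%:R @[i --> w] --> (0 : R).
Proof. by apply: cvg_trans (frame_density fr); exact: cvg_app. Qed.

Let densE i : #|Y i|%:R / #|X i|%:R = 1 - #|~: Y i|%:R / #|X i|%:R :> R.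
Proof.
apply/eqP; rewrite eq_sym subr_eq -mulrDl -natrD cardsC divff // gt_eqF //.
Qed.

Lemma ultra_form_constant v1 v2 :
  ultra_form w (constant_section v1) (constant_section v2) = hdot H v1 v2.
Proof.
apply: (ccvg_unique wU (ultra_cvg_form wU (constant_dom v1) (constant_dom v2))).
have lim1 : #|Y i|%:R / #|X i|%:R @[i --> w] --> (1 : R).
  have -> : (fun i => #|Y i|%:R / #|X i|%:R) = (fun i => 1 - #|~: Y i|%:R / #|X i|%:R : R).
    by apply/funext => i; rewrite densE.
  by rewrite -[X in _ --> X]subr0; apply: cvgB => //; exact: cvg_cst.
have limM (a : R) : (#|Y i|%:R / #|X i|%:R) * a @[i --> w] --> a.
  by rewrite -[X in _ --> X]mul1r; apply: cvgMl.
split; [move: (limM (complex.Re (hdot H v1 v2)))|move: (limM (complex.Im (hdot H v1 v2)))];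
  apply: near_eq_lim; apply: nearW => i; rewrite sec_dot_constant;
  by case: (hdot H v1 v2) => a b /=; rewrite mul0r ?subr0 ?addr0.
Qed.

(** The translate of a constant section is the constant section of [pi g v1], up to
the points [y] for which [y] or [g^-1 y] is outside of [Y i]. *)
Lemma translate_constant_le g v1 v2 :
  complex.Re (ultra_form w (translate g (constant_section v1) - constant_section v2)
    (translate g (constant_section v1) - constant_section v2)) <=
  rdot (pi g v1 - v2) (pi g v1 - v2).
Proof.
have W1 := translate_dom g (constant_dom v1); have W2 := constant_dom v2.
have W := ultra_domB wU W1 W2.
pose N := rdot (pi g v1 - v2) (pi g v1 - v2).
have lim2 : N + #|~: Y i|%:R / #|X i|%:R * (rdot v1 v1 + rdot v2 v2) @[i --> w] --> N.
  rewrite -[X in _ --> X]addr0 -[X in _ --> _ + X](mul0r (rdot v1 v1 + rdot v2 v2)).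
  by apply: cvgD; [exact: cvg_cst|exact: cvgMl].
apply: (ler_cvg_to (ultra_norm_cvg wU W) lim2); apply: nearW => i.
pose n : R := #|X i|%:R^-1; pose b (x : X i) : R := (x \notin Y i)%:R.
pose x (y : X i) := (sigma i g)^-1%g y.
have n0 : 0 <= n by rewrite invr_ge0 ltW.
apply: (@le_trans _ _ (\sum_(y : X i) (n * N + (n * rdot v1 v1 * b y + n * rdot v2 v2 * b (x y))))).
  apply: ler_sum => y _.
  rewrite -[(translate g _ - _) _]/(translate g _ _ - constant_section v2 _).
  rewrite translateE !constant_sectionE -/(x y) /b.
  have nN : 0 <= n * N by rewrite mulr_ge0 ?rdot_ge0.
  have n1 : 0 <= n * rdot v1 v1 by rewrite mulr_ge0 ?rdot_ge0.
  have n2 : 0 <= n * rdot v2 v2 by rewrite mulr_ge0 ?rdot_ge0.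
  case: (x y \in Y i); case: (y \in Y i) => /=; rewrite ?mulr0 ?mulr1 ?addr0 ?add0r.
  - by rewrite linearZ_LR -scalerBr rdotZl rdotZr mulrA inv_sqrt_card.
  - rewrite subr0 linearZ_LR rdotZl rdotZr mulrA inv_sqrt_card rpi -/n; lra.
  - rewrite linear0 sub0r rdotNl rdotNr opprK rdotZl rdotZr mulrA inv_sqrt_card -/n; lra.
  - rewrite linear0 subr0 /rdot linear0l /=; lra.
have sb : \sum_(y : X i) b y = #|~: Y i|%:R.
  rewrite /b -natr_sum; congr _%:R; rewrite -sum1_card [RHS]big_mkcond /=.
  by apply: eq_bigr => y _; rewrite inE; case: (y \in Y i).
have sbx : \sum_(y : X i) b (x y) = #|~: Y i|%:R.
  by rewrite -sb [RHS](reindex_inj (@perm_inj _ (sigma i g)^-1%g)).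
rewrite !big_split /= -!mulr_sumr sb sbx sumr_const -[N *+ _]mulr_natl.
have -> : n * (#|X i|%:R * N) = N by rewrite mulrA mulVf ?mul1r ?gt_eqF.
by rewrite -/n le_eqVlt; apply/orP; left; apply/eqP; ring.
Qed.

End Sections.

(** * Energy along an entourage *)

Section Energy.
Variables (R : realType) (G : groupType) (S : set G).
Variables (X : nat -> finType) (sigma : forall i, G -> {perm X i}).
Arguments sigma : clear implicits.
Variables (m : nat -> nat) (Y : forall i, {set X i}).
Hypothesis fr : frame R S sigma m Y.
Hypothesis finS : finite_set S.
Hypothesis genS : generates S.
Hypothesis conn : graphs_connected sigma S.
Variable d : graph_space X -> graph_space X -> R.
Hypothesis dP : space_metric sigma S d.
Variable w : set_system nat.
Hypotheses (wU : UltraFilter w) (oow : \oo `<=` w).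
Variables (H : hilbert R) (pi : G -> {linear H -> H}).
Hypothesis piU : unitary_rep pi.

Local Notation T := (graph_space X).
Local Notation V := (T -> H).
Local Notation deep := (deep_in S sigma m Y).
Local Notation dom := (ultra_dom w deep).
Local Notation chart := (chart S sigma m).
Local Notation section_op := (section_op S sigma m pi).
Implicit Types (E F : set (T * T)) (xi ze : V).

Let rpi g v1 v2 : rdot (pi g v1) (pi g v2) = rdot v1 v2 := rdot_pi piU g v1 v2.

Definition adjacent_in E i (x y : X i) : bool := `[< E (in_space x, in_space y) >].

(** The failure of [xi] to be parallel along the chart from [x] to [y]. *)
Definition jump xi i (x y : X i) : R :=
  rdot (xi (in_space y) - pi (chart x y) (xi (in_space x)))
       (xi (in_space y) - pi (chart x y) (xi (in_space x))).

Definition energy E xi i : R :=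
  \sum_(x : X i) \sum_(y : X i | adjacent_in E x y) jump xi x y.

Lemma jump_ge0 xi i (x y : X i) : 0 <= jump xi x y.
Proof. exact: rdot_ge0. Qed.

Lemma energy_ge0 E xi i : 0 <= energy E xi i.
Proof. by do 2?[apply: sumr_ge0 => ? _]; exact: jump_ge0. Qed.

Lemma energy_sub E F xi i :
  (forall x y : X i, E (in_space x, in_space y) -> jump xi x y <> 0 ->
    F (in_space x, in_space y)) ->
  energy E xi i <= energy F xi i.
Proof.
move=> EF; apply: ler_sum => x _; rewrite big_mkcond [leRHS]big_mkcond /=.
apply: ler_sum => y _; rewrite /adjacent_in.
case: asboolP => [Exy|_]; case: asboolP => [Fxy|nF] //.
  have [->//|/eqP nz] := eqVneq (jump xi x y) 0; case: nF; exact: EF.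
exact: jump_ge0.
Qed.

Lemma jump_diag xi : dom xi -> \forall i \near w, forall x : X i, jump xi x x = 0.
Proof.
move=> [_ xid]; have [pi1 _ _] := piU; apply: filterS (xid 0%N) => i dp x.
rewrite /jump; have [->|/eqP/dp xx] := eqVneq (xi (in_space x)) 0.
  by rewrite linear0 subr0 /rdot linear0l.
by rewrite (chart_id fr xx) pi1 subrr /rdot linear0l.
Qed.

(** If [x] is deep, then the charts compose. Otherwise the three points are too close
to a shallow one for [xi] to be nonzero at [x] or at [z]. *)
Lemma jump_triangle xi (a b : nat) : dom xi -> \forall i \near w, forall x y z : X i,
  d (in_space x) (in_space y) <= a%:R -> d (in_space y) (in_space z) <= b%:R ->
  jump xi x z <= 2 * jump xi y z + 2 * jump xi x y.
Proof.
move=> [_ xid]; have [_ piM _] := piU.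
apply: filterS (xid ((a + b) + (a + b))%N) => i dp x y z dxy dyz.
have tri := (let: And3 (And4 _ _ _ tri) _ _ := dP in tri).
have [dx|ndx] := pselect (deep (a + b)%N x).
  have cE := chart_cocycle fr conn dP dx dxy dyz.
  set c1 := chart y z in cE *; set c2 := chart x y in cE *.
  have -> : jump xi x z = rdot
      ((xi (in_space z) - pi c1 (xi (in_space y))) +
        pi c1 (xi (in_space y) - pi c2 (xi (in_space x))))
      ((xi (in_space z) - pi c1 (xi (in_space y))) +
        pi c1 (xi (in_space y) - pi c2 (xi (in_space x)))).
    by rewrite /jump cE piM linearB addrA subrK.
  by apply: le_trans (rdotD_le _ _) _; rewrite rpi.
have zero (x' : X i) : d (in_space x') (in_space x) <= (a + b)%:R -> xi (in_space x') = 0.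
  move=> dx'; apply: contrapT => /dp dpx'; apply: ndx.
  exact: (deep_move fr conn dP dpx' dx').
have dxx : d (in_space x) (in_space x) <= (a + b)%:R.
  by have [[_ d0 _ _] _ _] := dP; rewrite (d0 _ _).2.
have x0 := zero x dxx; have z0 : xi (in_space z) = 0.
  apply: zero; rewrite (dist_sym dP) natrD.
  by apply: le_trans (tri _ (in_space y) _) _; rewrite lerD.
by rewrite {1}/jump x0 z0 linear0 subr0 {1}/rdot linear0l /= addr_ge0 ?mulr_ge0 ?jump_ge0.
Qed.

Lemma card_adjacent E (r : nat) : E `<=` tube d r%:R -> exists D : nat, forall i (x : X i),
  (#|[set y : X i | adjacent_in E x y]%SET| <= D)%N /\
  (#|[set y : X i | adjacent_in E y x]%SET| <= D)%N.
Proof.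
move=> Er; have [D DP] := card_metric_ball conn dP r finS; exists D => i x.
split; apply: leq_trans (DP i x); apply: subset_leq_card;
  apply/fintype.subsetP => y; rewrite !inE => Exy; have := Er _ Exy.
  by [].
by rewrite /tube /= (dist_sym dP).
Qed.

(** A pair [(x, z)] of the composite is assigned to one intermediate point [y]; a pair
[(y, z)] of [F] is reached from at most [D] points [x], and a pair [(x, y)] of [E]
from at most [D'] points [z]. *)
Lemma energy_comp E F xi (a b : nat) : dom xi ->
  E `<=` tube d a%:R -> F `<=` tube d b%:R ->
  energy E xi i @[i --> w] --> (0 : R) -> energy F xi i @[i --> w] --> (0 : R) ->
  energy (F \; E)%relation xi i @[i --> w] --> (0 : R).
Proof.
move=> Wx Ea Fb E0 F0.
have wF : Filter w by exact: _.
have [D DP] := card_adjacent Ea; have [D' DP'] := card_adjacent Fb.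
have lim2 : 2 * D%:R * energy F xi i + 2 * D'%:R * energy E xi i @[i --> w] --> (0 : R).
  have -> : (0 : R) = 2 * D%:R * 0 + 2 * D'%:R * 0 by rewrite !mulr0 addr0.
  by apply: cvgD; [exact: cvgMr F0|exact: cvgMr E0].
apply: (@squeeze_cvgr _ _ _ _ (fun=> 0) _ _ _ _ (cvg_cst _) lim2).
apply: filterS2 (jump_triangle a b Wx) (oow (near_separated dP a%:R)) => i tri sep.
rewrite energy_ge0 /=.
have step (x z : X i) : (if adjacent_in (F \; E)%relation x z then jump xi x z else 0) <=
    \sum_(y : X i | adjacent_in E x y && adjacent_in F y z) (2 * jump xi y z + 2 * jump xi x y).
  have pos (P : pred (X i)) : 0 <= \sum_(y | P y) (2 * jump xi y z + 2 * jump xi x y).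
    by apply: sumr_ge0 => y _; rewrite addr_ge0 ?mulr_ge0 ?jump_ge0.
  rewrite {1}/adjacent_in; case: asboolP => // -[p /= Exp Fpz].
  have [y yE] := sep x p (Ea _ Exp); subst p.
  rewrite (bigD1 y) /=; last by rewrite /adjacent_in !asboolT.
  apply: le_trans (tri x y z (Ea _ Exp) (Fb _ Fpz)) _.
  by rewrite lerDl.
rewrite /energy; under eq_bigr do rewrite big_mkcond /=.
apply: (@le_trans _ _ (\sum_(x : X i) \sum_(z : X i)
    \sum_(y | adjacent_in E x y && adjacent_in F y z)
    (2 * jump xi y z + 2 * jump xi x y))).
  by apply: ler_sum => x _; apply: ler_sum => z _; exact: step.
have split_sum : \sum_(x : X i) \sum_(z : X i)
    \sum_(y : X i | adjacent_in E x y && adjacent_in F y z)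
    (2 * jump xi y z + 2 * jump xi x y) =
  \sum_(y : X i) \sum_(z : X i | adjacent_in F y z)
    2 * #|[set x | adjacent_in E x y]%SET|%:R * jump xi y z +
  \sum_(x : X i) \sum_(y : X i | adjacent_in E x y)
    2 * #|[set z | adjacent_in F y z]%SET|%:R * jump xi x y.
  pose e (x y : X i) : R := (adjacent_in E x y)%:R.
  pose f (y z : X i) : R := (adjacent_in F y z)%:R.
  have cardE (P : pred (X i)) : #|[set x | P x]%SET|%:R = \sum_x (P x)%:R :> R.
    rewrite -sum1_card natr_sum big_mkcond /=; apply: eq_bigr => x _.
    by rewrite inE; case: (P x).
  have condE (P : pred (X i)) (h : X i -> R) : \sum_(x | P x) h x = \sum_x (P x)%:R * h x.
    by rewrite big_mkcond; apply: eq_bigr => x _; case: (P x); rewrite ?mul1r ?mul0r.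
  transitivity (\sum_x \sum_z \sum_y e x y * (f y z * (2 * jump xi y z)) +
                \sum_x \sum_z \sum_y f y z * (e x y * (2 * jump xi x y))).
    symmetry; rewrite -big_split /=; apply: eq_bigr => x _; rewrite -big_split /=.
    apply: eq_bigr => z _; rewrite -big_split [RHS]condE; apply: eq_bigr => y _ /=.
    by rewrite -mulnb natrM -/(e x y) -/(f y z); ring.
  congr (_ + _).
    rewrite exchange_big /=; under eq_bigr do rewrite exchange_big /=.
    rewrite exchange_big /=; apply: eq_bigr => y _; rewrite [RHS]condE; apply: eq_bigr => z _.
    by rewrite -mulr_suml cardE -/(f y z); ring.
  apply: eq_bigr => x _; rewrite exchange_big [RHS]condE /=; apply: eq_bigr => y _.
  by rewrite -mulr_suml cardE -/(e x y); ring.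
rewrite split_sum; apply: lerD; rewrite mulr_sumr; apply: ler_sum => x _;
  rewrite mulr_sumr; apply: ler_sum => y _; rewrite ler_wpM2r ?jump_ge0 //
    ler_wpM2l // ler_nat.
  by have [] := DP i x.
by have [] := DP' i y.
Qed.

Lemma energy_diagonal xi : dom xi -> energy diagonal xi i @[i --> w] --> (0 : R).
Proof.
move=> Wx; have wF : Filter w by exact: _.
apply: near_eq_lim (cvg_cst 0); apply: filterS (jump_diag Wx) => i j0.
rewrite /energy big1 // => x _; rewrite big1 // => y /asboolP.
by rewrite /diagonal /= => /in_space_inj <-; exact: j0.
Qed.

Lemma energy_relpow E xi (a n : nat) : dom xi -> E `<=` tube d a%:R ->
  energy E xi i @[i --> w] --> (0 : R) ->
  energy (relpow E n) xi i @[i --> w] --> (0 : R).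
Proof.
move=> Wx Ea E0; have [[_ d0 _ tri] _ _] := dP.
suff [] : relpow E n `<=` tube d (n * a)%:R /\
    energy (relpow E n) xi i @[i --> w] --> (0 : R) by [].
elim: n => [|n [sub IH]].
  split; last exact: energy_diagonal.
  by move=> [p q]; rewrite /relpow /diagonal /tube /= mul0n => ->; rewrite (d0 _ _).2.
split; last exact: (energy_comp Wx sub Ea IH E0).
move=> [p q] [z /= pz zq]; rewrite /tube /= mulSn natrD addrC.
apply: le_trans (tri _ z _) _; rewrite lerD //; first exact: (sub _ pz).
exact: (Ea _ zq).
Qed.

(** Finitely many pairs meet finitely many graphs, hence no graph far along [w]. *)
Lemma energy_cofinite E F A xi : finite_set A -> E `<=` F `|` A ->
  energy F xi i @[i --> w] --> (0 : R) -> energy E xi i @[i --> w] --> (0 : R).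
Proof.
move=> finA EFA F0; have wF : Filter w by exact: _.
apply: (@squeeze_cvgr _ _ _ _ (fun=> 0) _ _ _ _ (cvg_cst _) F0).
have : \forall i \near \oo, forall p, A p -> tag p.1 <> i.
  apply: near_finite_set => // p _.
  by apply: filterS (nbhs_infty_gt (tag p.1)) => i pi0 pE; rewrite pE ltnn in pi0.
move=> /oow; apply: filterS => i Ai; rewrite energy_ge0 /=.
by apply: energy_sub => x y /EFA[//|/Ai].
Qed.

Definition translate_jump xi g i (x : X i) : R :=
  rdot (xi (in_space (sigma i g x)) - pi g (xi (in_space x)))
       (xi (in_space (sigma i g x)) - pi g (xi (in_space x))).

Lemma sec_norm2_translate xi g i :
  sec_norm2 (translate sigma pi g xi - xi) i = \sum_(x : X i) translate_jump xi g x.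
Proof.
rewrite /sec_norm2 (reindex_inj (@perm_inj _ (sigma i g))); apply: eq_bigr => x _.
rewrite -[(translate _ _ _ _ - xi) _]/(translate sigma pi g xi _ - xi _) translateE permK.
by rewrite -opprB rdotNl rdotNr opprK.
Qed.

(** The generator [s] moves points along edges of length at most 1, and the chart of
such an edge at a deep point is [s]. *)
Lemma translate_invariant xi s : dom xi -> S s ->
  energy (tube d 1) xi i @[i --> w] --> (0 : R) ->
  ultra_form w (translate sigma pi s xi - xi) (translate sigma pi s xi - xi) = 0.
Proof.
move=> Wx Ss E0; have wF : Filter w by exact: _.
have Wd := ultra_domB wU (translate_dom fr genS conn dP wU piU s Wx) Wx.
have Re0 : complex.Re (ultra_form w (translate sigma pi s xi - xi)
    (translate sigma pi s xi - xi)) = 0.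
  apply: (cvg_unique _ (ultra_norm_cvg wU Wd)) => //.
  apply: (@squeeze_cvgr _ _ _ _ (fun=> 0) _ _ _ _ (cvg_cst _) E0).
  have [_ xid] := Wx; apply: filterS (xid (1 + 1)%N) => i dp.
  rewrite sec_norm2_ge0 /= sec_norm2_translate; apply: ler_sum => x _.
  have dxs : d (in_space x) (in_space (sigma i s x)) <= 1.
    apply: (@dist_path _ _ _ _ _ _ dP i x [:: sigma i s x]) => /=; rewrite andbT.
    by apply/asboolP; exists s => //; left.
  apply: (@le_trans _ _ (jump xi x (sigma i s x))).
    have [dx|ndx] := pselect (deep 1%N x).
      rewrite /jump (chart_orbit fr dx) //.
      by apply: word_ball_letter; right; left.
    have x0 : xi (in_space x) = 0.
      by apply: contrapT => /dp dx; apply: ndx; exact: deep_in_mono dx.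
    have y0 : xi (in_space (sigma i s x)) = 0.
      apply: contrapT => /dp dy; apply: ndx; apply: (deep_move fr conn dP dy).
      by rewrite (dist_sym dP).
    by rewrite /translate_jump x0 y0 linear0 subr0 {1}/rdot linear0l jump_ge0.
  rewrite (bigD1 (sigma i s x)) /=; last exact/asboolP.
  by rewrite lerDl sumr_ge0 // => y _; exact: jump_ge0.
have := ultra_form_ge0 wU Wd; move: Re0; case: (ultra_form _ _ _) => a b /= ->.
by rewrite lecE /= => /andP[/eqP -> _].
Qed.

(** At a deep point [x], an edge of [E] leads to [sigma i g x] with [g] in the ball of
radius [r], and the jump along it is the displacement by [g]. *)
Lemma energy_le_translates E xi (r : nat) (l : seq G) : dom xi ->
  E `<=` tube d r%:R -> (forall g, word_ball S r g -> g \in l) ->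
  \forall i \near w, energy E xi i <=
    \sum_(g <- l) sec_norm2 (translate sigma pi g xi - xi) i.
Proof.
move=> [_ xid] Er lP; apply: filterS (xid (r + r)%N) => i dp.
under [leRHS]eq_bigr do rewrite sec_norm2_translate.
rewrite exchange_big /=; apply: ler_sum => x _.
have [dx|ndx] := pselect (deep r x); last first.
  rewrite big1 ?sumr_ge0 // => [g _|y /asboolP /Er dxy]; first exact: rdot_ge0.
  have zero (x' : X i) : d (in_space x') (in_space x) <= r%:R -> xi (in_space x') = 0.
    move=> dx'; apply: contrapT => /dp dpx'; apply: ndx.
    exact: (deep_move fr conn dP dpx' dx').
  have [[_ d0 _ _] _ _] := dP.
  rewrite /jump (zero x) ?(d0 _ _).2 // (zero y) 1?(dist_sym dP) //.
  by rewrite linear0 subr0 /rdot linear0l.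
apply: (@le_trans _ _ (\sum_(y : X i) \sum_(g <- l)
    (y == sigma i g x)%:R * translate_jump xi g x)).
  rewrite big_mkcond /=; apply: ler_sum => y _.
  have pos (l' : seq G) : 0 <= \sum_(g <- l') (y == sigma i g x)%:R * translate_jump xi g x.
    by apply: sumr_ge0 => g _; rewrite mulr_ge0 ?rdot_ge0.
  rewrite /adjacent_in; case: asboolP => // /Er dxy.
  have [Bc yE] := deep_chart fr conn dP dx dxy.
  rewrite (big_rem (chart x y)) /=; last exact: lP.
  rewrite -yE eqxx mul1r -[leLHS]addr0 lerD // /translate_jump -yE.
  exact: lexx.
rewrite exchange_big /=; apply: ler_sum => g _.
rewrite (bigD1 (sigma i g x)) //= eqxx mul1r big1 ?addr0 // => y.
by move=> /negbTE ->; rewrite mul0r.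
Qed.

End Energy.

(** * The Laplacian and its energy *)

Section Laplacian.
Variables (R : realType) (G : groupType) (S : set G).
Variables (X : nat -> finType) (sigma : forall i, G -> {perm X i}).
Arguments sigma : clear implicits.
Variables (m : nat -> nat) (Y : forall i, {set X i}).
Hypothesis fr : frame R S sigma m Y.
Hypothesis finS : finite_set S.
Hypothesis conn : graphs_connected sigma S.
Variable d : graph_space X -> graph_space X -> R.
Hypothesis dP : space_metric sigma S d.
Variable w : set_system nat.
Hypotheses (wU : UltraFilter w) (oow : \oo `<=` w).
Variables (H : hilbert R) (pi : G -> {linear H -> H}).
Hypothesis piU : unitary_rep pi.

Local Notation T := (graph_space X).
Local Notation V := (T -> H).
Local Notation deep := (deep_in S sigma m Y).
Local Notation dom := (ultra_dom w deep).
Local Notation chart := (chart S sigma m).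
Local Notation section_op := (section_op S sigma m pi).
Local Notation energy := (energy S sigma m pi).
Local Notation jump := (jump S sigma m pi).
Implicit Types (E : set (T * T)) (xi : V).

Definition offdiagonal E : set (T * T) := symmetrized E `\` diagonal.

Lemma symmetrizedC E (p q : T) : symmetrized E (p, q) -> symmetrized E (q, p).
Proof. by move=> [Epq|Epq]; [right|left]. Qed.

Lemma symmetrized_tube E : entourage_of d E ->
  exists r : nat, symmetrized E `<=` tube d r%:R.
Proof.
move=> [r0 Er0]; exists (Num.trunc `|r0|).+1.
have r0r : r0 <= (Num.trunc `|r0|).+1%:R.
  by rewrite (le_trans (ler_norm r0)) // ltW // truncnS_gt.
move=> [p q] [/Er0|/Er0] /=; rewrite /tube /= => dpq; last rewrite (dist_sym dP).
  exact: le_trans dpq r0r.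
exact: le_trans dpq r0r.
Qed.

Lemma adjacent_offdiagonalC E i (x y : X i) :
  adjacent_in (offdiagonal E) x y = adjacent_in (offdiagonal E) y x.
Proof.
apply/asboolP/asboolP => -[Exy nd]; split; try exact: symmetrizedC.
  by move=> yx; apply: nd; rewrite /diagonal /= in yx *.
by move=> yx; apply: nd; rewrite /diagonal /= in yx *.
Qed.

Lemma laplacian_diag E (r : nat) i (x : X i) : symmetrized E `<=` tube d r%:R ->
  (forall (x : X i) q, d (in_space x) q <= r%:R -> exists y : X i, q = in_space y) ->
  laplacian R E (in_space x) (in_space x) =
    #|[set y : X i | adjacent_in (offdiagonal E) x y]%SET|%:R.
Proof.
move=> Er sep; rewrite /laplacian eqxx fsbig_mkcond (@fsbig_component X _ _ _ i); last first.
  move=> q; rewrite /patch; case: ifPn => // /set_mem [/Er dxq _] _; exact: sep dxq.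
rewrite -sum1_card natr_sum [RHS]big_mkcond /=; apply: eq_bigr => y _.
rewrite /patch inE /adjacent_in; case: asboolP => [Exy|nE].
  by rewrite mem_set.
by rewrite memNset.
Qed.

Lemma laplacian_offdiag E (p q : T) : p <> q ->
  laplacian R E p q = if `[< symmetrized E (p, q) >] then -1 else 0.
Proof. by move=> /eqP/negbTE pq; rewrite /laplacian pq. Qed.

Lemma laplacian_adj E : mat_adj (laplacian R E) = laplacian R E.
Proof.
apply/funext => p; apply/funext => q; rewrite /mat_adj.
have [->|pq] := eqVneq p q.
  rewrite /laplacian eqxx rmorph_sum; apply: eq_bigr => z _.
  exact: rmorph1.
rewrite !laplacian_offdiag; [|exact/eqP|by apply/eqP; rewrite eq_sym].
have -> : `[< symmetrized E (q, p) >] = `[< symmetrized E (p, q) >].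
  by apply: asbool_equiv_eq; split; exact: symmetrizedC.
by case: ifP => _; rewrite ?rmorphN ?rmorph1 ?rmorph0.
Qed.

(** The degrees are bounded, since the balls of the graphs are uniformly finite. *)
Lemma laplacian_controlled E : entourage_of d E -> asymp_controlled d (laplacian R E).
Proof.
move=> /symmetrized_tube[r Er]; have [[_ d0 _ _] _ _] := dP.
have [|D DP] := @card_adjacent R G S X sigma finS conn d dP (offdiagonal E) r.
  by move=> p [/Er].
have lap0 (p q : T) : laplacian R E p q <> 0 -> d p q <= r%:R.
  have [->|/eqP pq] := eqVneq p q; first by rewrite (d0 _ _).2.
  by rewrite laplacian_offdiag //; case: asboolP => // /Er.
exists r, (D%:R + 1); apply: filterS (near_separated dP r%:R) => i sep x; split.
- by move=> q /lap0 dxq; have [y yE] := sep x q dxq; exists y => //; rewrite -yE.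
- move=> q /lap0; rewrite (dist_sym dP) => dxq; have [y yE] := sep x q dxq.
  by exists y => //; rewrite -yE.
move=> y; have [->|xy] := eqVneq x y.
  rewrite (laplacian_diag y Er sep) /cabs normr_nat.
  rewrite -[(_%:R : R[i])](rmorph_nat (real_complex R)) /=.
  by rewrite ler_wpDr // ler_nat; have [] := DP i y.
rewrite laplacian_offdiag; last first.
  by move=> /in_space_inj; exact/eqP.
case: ifP => _; last by rewrite cabs0 addr_ge0.
by rewrite /cabs normrN normr1 /= lerDr.
Qed.

(** The usual integration by parts; it involves the charts only through
[chart x x = 1], the isometry of [pi] and the symmetry of the set of edges. The
factor 2 is there because each edge occurs in both directions. *)
Lemma laplacian_energy E xi : entourage_of d E -> dom xi ->
  \forall i \near w, 2 * complex.Re (sec_dot (section_op (laplacian R E) xi) xi i) =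
    energy (offdiagonal E) xi i.
Proof.
move=> /symmetrized_tube[r Er] [_ xid]; have [pi1 _ _] := piU.
apply: filterS2 (oow (near_separated dP r%:R)) (xid 0%N) => i sep dp.
pose adj (x y : X i) := adjacent_in (offdiagonal E) x y.
pose deg (x : X i) : R := #|[set y : X i | adj x y]%SET|%:R.
have adjC x y : adj x y = adj y x by exact: adjacent_offdiagonalC.
have adj_irr x : adj x x = false by apply/asboolP => -[_]; apply.
have opE (y : X i) : section_op (laplacian R E) xi (in_space y) =
    (deg y)%:C%C *: xi (in_space y) - \sum_(x | adj y x) pi (chart x y) (xi (in_space x)).
  rewrite section_opE (bigD1 y) //= (laplacian_diag y Er sep); congr (_ + _).
    rewrite /deg rmorph_nat; congr (_ *: _).
    have [->|/eqP/dp xx] := eqVneq (xi (in_space y)) 0; first by rewrite linear0.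
    by rewrite (chart_id fr xx) pi1.
  rewrite -sumrN big_mkcond [RHS]big_mkcond /=; apply: eq_bigr => x _.
  have [->|xy] := eqVneq x y; first by rewrite adj_irr.
  rewrite laplacian_offdiag; last by move=> /in_space_inj; exact/eqP.
  have -> : `[< symmetrized E (in_space x, in_space y) >] = adj y x.
    rewrite adjC; apply: asbool_equiv_eq; split=> [Exy|[]//]; split=> //.
    by rewrite /diagonal /= => /in_space_inj; exact/eqP.
  by case: (adj y x); rewrite ?scaleN1r ?scale0r.
have dotE : complex.Re (sec_dot (section_op (laplacian R E) xi) xi i) =
    \sum_(y : X i) (deg y * rdot (xi (in_space y)) (xi (in_space y)) -
      \sum_(x | adj y x) rdot (pi (chart x y) (xi (in_space x))) (xi (in_space y))).
  rewrite /sec_dot raddf_sum; apply: eq_bigr => y _.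
  transitivity (rdot (section_op (laplacian R E) xi (in_space y)) (xi (in_space y))).
    by [].
  rewrite opE rdotDl rdotZl rdotNl; congr (_ - _).
  by rewrite /rdot linear_sumlz raddf_sum.
rewrite dotE /energy.
have jumpE x y : jump xi x y = rdot (xi (in_space y)) (xi (in_space y)) +
    rdot (xi (in_space x)) (xi (in_space x)) -
    2 * rdot (pi (chart x y) (xi (in_space x))) (xi (in_space y)).
  rewrite /jump !rdotE (rdot_pi piU) (rdotC (xi (in_space y)) (pi _ _)); ring.
under [RHS]eq_bigr do under eq_bigr do rewrite jumpE.
under [RHS]eq_bigr do rewrite sumrB big_split /= -mulr_sumr.
rewrite !sumrB big_split /= mulrBr; congr (_ - _); last first.
  rewrite -mulr_sumr; congr (2 * _); rewrite [RHS](exchange_big_dep xpredT) //=.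
  by apply: eq_bigr => y _; apply: eq_bigl => x; exact: adjC.
have degE (x : X i) (a : R) : \sum_(y | adj x y) a = deg x * a.
  by rewrite sumr_const mulr_natl /deg cardsE.
rewrite mulr_natl mulr2n; congr (_ + _); last first.
  by apply: eq_bigr => x _; rewrite -degE.
rewrite [RHS](exchange_big_dep xpredT) //=; apply: eq_bigr => y _.
by rewrite -degE; apply: eq_bigl => x; exact: adjC.
Qed.

End Laplacian.

(** * Property (T) *)

Section PropertyT.
Variables (R : realType) (G : groupType) (S : set G).
Variables (X : nat -> finType) (sigma : forall i, G -> {perm X i}).
Arguments sigma : clear implicits.
Variables (m : nat -> nat) (Y : forall i, {set X i}).
Hypothesis fr : frame R S sigma m Y.
Hypothesis finS : finite_set S.
Hypothesis genS : generates S.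
Hypothesis conn : graphs_connected sigma S.
Variable d : graph_space X -> graph_space X -> R.
Hypothesis dP : space_metric sigma S d.
Variable w : set_system nat.
Hypotheses (wU : UltraFilter w) (oow : \oo `<=` w).

Local Notation T := (graph_space X).
Local Notation deep := (deep_in S sigma m Y).
Local Notation dom := (ultra_dom w deep).

Lemma hnorm_pi_ball (H : hilbert R) (pi : G -> {linear H -> H}) (e : R) (v : H) :
  unitary_rep pi -> (forall s, S s -> hnorm (pi s v - v) <= e) -> 0 <= e ->
  forall k g, word_ball S k g -> hnorm (pi g v - v) <= k%:R * e.
Proof.
move=> piU sv e0; have [pi1 piM _] := piU.
have isom g u : hnorm (pi g u) = hnorm u by rewrite !hnorm_sqrt (rdot_pi piU).
have letter_le t : letter S t -> hnorm (pi t v - v) <= e.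
  move=> [->|[/sv//|/sv tv]]; first by rewrite pi1 subrr hnorm_sqrt /rdot linear0l sqrtr0.
  rewrite -(isom t^-1%g) linearB -piM mulVg pi1 hnorm_distC //.
elim=> [|k IH] g /=; first by move=> ->; rewrite pi1 subrr hnorm_sqrt /rdot linear0l sqrtr0 mul0r.
move=> [t Lt [g' Bg' <-]].
have -> : pi (t * g')%g v - v = pi t (pi g' v - v) + (pi t v - v).
  by rewrite piM linearB addrA subrK.
apply: le_trans (hnorm_triangle _ _) _; rewrite isom -natr1 mulrDl mul1r.
by apply: lerD; [exact: IH|exact: letter_le].
Qed.

Lemma rdot_separates (H : hilbert R) (u v : H) : (forall z, rdot u z = rdot v z) -> u = v.
Proof.
move=> uv; apply/eqP; rewrite -subr_eq0; apply/eqP; apply: rdot_eq0.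
by rewrite rdotDl rdotNl uv subrr.
Qed.

Theorem property_T_of_boundary_T : boundary_geometric_T d -> property_T R S.
Proof.
move=> [E [c [[entE genE] c0 specE]]] H pi piU almost.
have [pi1 piM piI] := piU.
have [r Er] := symmetrized_tube dP entE.
have Er' : offdiagonal E `<=` tube d r%:R by move=> p [/Er].
have [l lE] : exists l : seq G, word_ball S r = [set` l].
  exact/finite_seqP/finite_word_ball.
pose P := boundary_space S sigma m Y wU oow H.
have [K [q [q_surj qP q_dot]]] := exists_hilbert_quotient P.
have [rho rhoP] := exists_asymptotic_rep fr finS conn dP wU oow piU q_surj qP q_dot.
pose lap := laplacian R E.
have lapA : asymp_controlled d lap by exact: (laplacian_controlled finS conn dP entE).
pose D : K -> K := rho lap.
have Dsym : sym_op D.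
  split=> [a u v|u v|].
  - by rewrite /D linearP.
  - by rewrite /rdot /D (asymp_rep_adj rhoP) // laplacian_adj.
  have [M HM] := asymp_rep_bounded rhoP lapA.
  exists (`|M| + 1); first by rewrite ltr_wpDl.
  move=> u; rewrite -!sqr_hnorm -exprMn.
  have le1 : hnorm (D u) <= (`|M| + 1) * hnorm u.
    apply: le_trans (HM u) _; rewrite ler_wpM2r ?hnorm_ge0 //.
    by rewrite ler_wpDr // ler_norm.
  rewrite ler_pXn2r ?nnegrE ?hnorm_ge0 //.
  exact: le_trans (hnorm_ge0 _) le1.
have below (a : R) : a < c -> a != 0 -> exists2 e : R, 0 < e & forall u,
    e * rdot u u <= rdot (D u - (a%:C)%C *: u) (D u - (a%:C)%C *: u).
  move=> ac a0; apply: (resolvent_below finS conn dP rhoP lapA).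
  move=> /specE[aC0|]; first by move: a0; rewrite (complexI aC0) eqxx.
  by rewrite lecR leNgt ac.
have domP xi : dom xi -> dom (section_op S sigma m pi lap xi).
  exact: (section_op_dom fr finS conn dP wU oow piU).
have DE xi : dom xi -> D (q xi) = q (section_op S sigma m pi lap xi).
  exact: (asymp_repE rhoP).
have energy_cvg xi : dom xi ->
    energy S sigma m pi (offdiagonal E) xi i @[i --> w] --> 2 * rdot (D (q xi)) (q xi).
  move=> Wx; have [lim _] := ultra_cvg_form wU (domP _ Wx) Wx.
  rewrite DE // /rdot (q_dot _ _ (domP _ Wx) Wx).
  apply: (near_eq_lim _ _ (cvgMr lim)).
  have lapE := laplacian_energy fr dP wU oow piU entE Wx.
  by apply: filterS lapE => i ->.
have Dpos h : 0 <= rdot (D h) h.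
  have [xi Wx ->] := q_surj h.
  rewrite -(@pmulr_rge0 _ 2) //; apply: (cvgr_to_ge (energy_cvg _ Wx)).
  by apply: nearW => i; exact: energy_ge0.
have [L L0 DL] := sym_op_bounded Dsym.
(* The energy along E of a vector killed by D tends to 0; E being generating, so
   does the energy along the edges of the graphs. *)
pose U g (xi : T -> H) := translate sigma pi g xi.
have Udom g xi : dom xi -> dom (U g xi) by exact: (translate_dom fr genS conn dP wU piU).
have UE g xi ze : dom xi -> dom ze ->
    hdot K (q (U g xi)) (q (U g ze)) = hdot K (q xi) (q ze).
  move=> Wx Wz; rewrite !q_dot //; try exact: Udom.
  rewrite -[LHS]/(clim w (sec_dot (U g xi) (U g ze))) -[RHS]/(clim w (sec_dot xi ze)).
  congr (clim w _).
  by apply/funext => i; exact: sec_dot_translate.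
have inv xi s : dom xi -> D (q xi) = 0 -> S s -> q (U s xi) = q xi.
  move=> Wx D0 Ss; apply: (@quotient_class_eq _ P _ q) => //; first exact: Udom.
  apply: (translate_invariant fr genS conn dP wU piU) => //.
  have E0 : energy S sigma m pi (offdiagonal E) xi i @[i --> w] --> (0 : R).
    by have := energy_cvg _ Wx; rewrite D0 /rdot linear0l mulr0.
  have [n [A [finA sub]]] := genE 1 ltr01.
  apply: (energy_cofinite wU oow finA sub).
  apply: (energy_relpow fr finS conn dP wU oow piU (a := r) n Wx).
    move=> [p p'] [/Er//|]; rewrite /diagonal /tube /= => ->.
    by have [[_ d0 _ _] _ _] := dP; rewrite (d0 _ _).2.
  have wF : Filter w by exact: _.
  apply: (@squeeze_cvgr _ _ _ _ (fun=> 0) _ _ _ _ (cvg_cst _) E0).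
  apply: filterS (jump_diag fr wU piU Wx) => i j0; rewrite energy_ge0 /=.
  apply: energy_sub => x y Exy nz.
  have xy : x <> y by move=> xy; apply: nz; rewrite xy j0.
  have nd : ~ diagonal (in_space x, in_space y).
    by rewrite /diagonal /= => /in_space_inj.
  by case: Exy.
(* C * e ^+ 2 bounds the energy of an e-invariant unit vector, and e is chosen so
   that L * (C * e ^+ 2) < c ^+ 2, whence a kernel vector at distance less than 1. *)
pose C := 2^-1 * ((size l)%:R * r%:R ^+ 2) : R.
have C0 : 0 <= C by rewrite mulr_ge0 // mulr_ge0 // sqr_ge0.
pose e := c / (2 * (L * (C + 1) + 1)).
have den0 : 0 < L * (C + 1) + 1 by rewrite ltr_wpDl // mulr_ge0 ?(ltW L0) // addr_ge0.
have e0 : 0 < e by rewrite divr_gt0 // mulr_gt0.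
have [v [v1 sv]] := almost e e0.
pose cst u := constant_section Y u : T -> H.
have cst_dom u : dom (cst u) by exact: (constant_dom fr wU oow).
have cst_dot u1 u2 : hdot K (q (cst u1)) (q (cst u2)) = hdot H u1 u2.
  rewrite (q_dot _ _ (cst_dom u1) (cst_dom u2)).
  exact: (ultra_form_constant fr wU oow).
have Ucst g u : q (U g (cst u)) = q (cst (pi g u)).
  apply: (@quotient_class_eq _ P _ q) => //; [exact: Udom|exact: cst_dom|].
  set z := U g (cst u) - cst (pi g u).
  have Wz : dom z := ultra_domB wU (Udom g _ (cst_dom u)) (cst_dom (pi g u)).
  have le0 : complex.Re (ultra_form w z z) <= 0.
    apply: le_trans (translate_constant_le fr genS conn dP wU oow piU g u (pi g u)) _.
    by rewrite subrr /rdot linear0l.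
  rewrite -[LHS]/(ultra_form w z z); have := ultra_form_ge0 wU Wz; rewrite lecE.
  case: (ultra_form w z z) le0 => a b /= a0 /andP[/eqP -> a0'].
  by apply/eqP; rewrite eq_complex /= eqxx andbT eq_le a0 a0'.
pose xi := q (cst v).
have xi1 : rdot xi xi = 1 by rewrite /rdot cst_dot -[LHS]sqr_hnorm v1 expr1n.
have Dxi : rdot (D xi) xi <= C * e ^+ 2.
  have bd g : word_ball S r g -> complex.Re (ultra_form w (U g (cst v) - cst v)
      (U g (cst v) - cst v)) <= r%:R ^+ 2 * e ^+ 2.
    move=> Bg; apply: le_trans (translate_constant_le fr genS conn dP wU oow piU g v v) _.
    rewrite -sqr_hnorm -exprMn ler_pXn2r ?nnegrE ?hnorm_ge0 //.
      exact: hnorm_pi_ball piU sv (ltW e0) _ _ Bg.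
    by rewrite mulr_ge0 // ltW.
  have lim2 : (\sum_(g <- l) sec_norm2 (U g (cst v) - cst v) i) @[i --> w] -->
      \sum_(g <- l) complex.Re (ultra_form w (U g (cst v) - cst v) (U g (cst v) - cst v)).
    apply: cvg_big; first exact: add_continuous.
    move=> g _; apply: (ultra_norm_cvg wU); apply: (ultra_domB wU) => //; exact: Udom.
  have le1 : 2 * rdot (D xi) xi <=
      \sum_(g <- l) complex.Re (ultra_form w (U g (cst v) - cst v) (U g (cst v) - cst v)).
    apply: (ler_cvg_to (energy_cvg _ (cst_dom v)) lim2).
    apply: (energy_le_translates fr conn dP wU pi (cst_dom v) Er').
    by move=> g; rewrite lE.
  have le2 : \sum_(g <- l) complex.Re (ultra_form w (U g (cst v) - cst v)
      (U g (cst v) - cst v)) <= (size l)%:R * (r%:R ^+ 2 * e ^+ 2).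
    rewrite big_seq; apply: le_trans (ler_sum _ (fun g gl => bd g _)) _.
      by rewrite lE.
    by rewrite -big_seq big_const_seq count_predT iter_addr addr0 mulr_natl.
  have := le_trans le1 le2; rewrite /C; lra.
have [k Dk0 kxi] := kernel_vector_near Dsym c0 below xi.
have close : rdot (xi - k) (xi - k) < 1.
  have h1 := le_trans (positive_op_le Dsym L0 DL Dpos xi) (ler_wpM2l (ltW L0) Dxi).
  have h2 : c ^+ 2 * rdot (xi - k) (xi - k) <= rdot (D xi) (D xi).
    by rewrite -!sqr_hnorm -exprMn ler_pXn2r ?nnegrE ?mulr_ge0 ?hnorm_ge0 ?(ltW c0).
  have h3 : L * (C * e ^+ 2) < c ^+ 2.
    set Q := L * (C + 1) + 1 in den0 *.
    have Q1 : 1 <= Q by rewrite lerDr mulr_ge0 ?(ltW L0) // addr_ge0.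
    have LCQ : L * C <= Q by rewrite /Q mulrDr; have := L0; lra.
    have -> : L * (C * e ^+ 2) = L * C / Q / Q / 4 * c ^+ 2.
      by rewrite /e -/Q; field; rewrite gt_eqF.
    rewrite -[ltRHS]mul1r ltr_pM2r ?exprn_gt0 //.
    have a1 : L * C / Q <= 1 by rewrite ler_pdivrMr ?mul1r.
    have a2 : L * C / Q / Q <= 1 by rewrite ler_pdivrMr ?mul1r //; exact: le_trans a1 Q1.
    by rewrite ltr_pdivrMr // mul1r (le_lt_trans a2) // ltr1n.
  rewrite -(@ltr_pM2l _ (c ^+ 2)) ?exprn_gt0 // mulr1.
  exact: le_lt_trans (le_trans h2 h1) h3.
(* The constant sections form a closed subspace, a copy of H stable under
   translations; hence the projection of k to it inherits the invariance of k. *)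
have cstP a u1 u2 : q (cst (a *: u1 + u2)) = a *: q (cst u1) + q (cst u2).
  by rewrite /cst constant_sectionP qP //; exact: cst_dom.
have cstB u1 u2 : q (cst (u1 - u2)) = q (cst u1) - q (cst u2).
  by rewrite addrC -scaleN1r cstP scaleN1r addrC.
have [||p [z zR zp] ort] := @orthogonal_projection R K (range (fun u => q (cst u))) k.
- exists 0 => //; have := cstB 0 0; rewrite !subrr => ->.
  by [].
- by move=> a x y [u1 _ <-] [u2 _ <-]; exists ((a%:C)%C *: u1 + u2).
have [u0 pE] : exists u0, p = q (cst u0).
  have /choice[u uE] n : exists u, z n = q (cst u).
    by have [u _ <-] := zR n; exists u.
  have dist_cst a b : hnorm (q (cst a) - q (cst b)) = hnorm (a - b).
    by rewrite -cstB !hnorm_sqrt /rdot cst_dot.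
  have [e1 e10|u0 uu0] := @hcomplete _ H u.
    have se : 0 < Num.sqrt e1 by rewrite sqrtr_gt0.
    have [N HN] := zp (Num.sqrt e1 / 2) (divr_gt0 se (ltr0Sn _ 1)).
    exists N => i j /HN hi /HN hj.
    have lt : hnorm (u i - u j) < Num.sqrt e1.
      rewrite -dist_cst -!uE.
      have -> : z i - z j = (z i - p) + (p - z j) by rewrite addrA subrK.
      apply: le_lt_trans (hnorm_triangle _ _) _; rewrite (hnorm_distC p).
      by move: hi hj; lra.
    rewrite -sqr_hnorm -[ltRHS](sqr_sqrtr (ltW e10)).
    by rewrite ltr_pXn2r ?nnegrE ?hnorm_ge0 // ltW.
  exists u0; apply/eqP; rewrite -subr_eq0; apply/eqP/hnorm_eq0/eqP.
  rewrite eq_le hnorm_ge0 andbT; apply/ler_addgt0Pr => e1 e10; rewrite add0r.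
  have e2 : 0 < e1 / 2 by rewrite divr_gt0.
  have [N1 HN1] := zp _ e2; have [N2 HN2] := uu0 _ e2.
  have h1 := HN1 _ (leq_maxl N1 N2); have h2 := HN2 _ (leq_maxr N1 N2).
  have -> : p - q (cst u0) = (p - z (maxn N1 N2)) + (z (maxn N1 N2) - q (cst u0)).
    by rewrite addrA subrK.
  apply: le_trans (hnorm_triangle _ _) _; rewrite hnorm_distC uE dist_cst.
  by rewrite -uE; move: h1 h2; lra.
have inner u : rdot k (q (cst u)) = rdot (q (cst u0)) (q (cst u)).
  apply/eqP; rewrite -subr_eq0 -rdotNl -rdotDl -pE; apply/eqP; apply: ort.
  by exists u.
have [ze Wze kE] := q_surj k.
have fixed s : S s -> pi s u0 = u0.
  move=> Ss; apply: rdot_separates => u.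
  have cst_rdot u1 u2 : rdot u1 u2 = rdot (q (cst u1)) (q (cst u2)) by rewrite /rdot cst_dot.
  transitivity (rdot u0 (pi s^-1%g u)).
    by rewrite -(rdot_pi piU s u0) -piM mulgV pi1.
  have cu : q (cst u) = q (U s (cst (pi s^-1%g u))) by rewrite Ucst -piM mulgV pi1.
  have kz : q ze = q (U s ze) by rewrite inv // -kE.
  rewrite !cst_rdot -!inner kE [in RHS]cu [in RHS]kz /rdot.
  by rewrite (UE s ze (cst (pi s^-1%g u)) Wze (cst_dom _)).
exists u0; split.
  move=> u00; move: close; rewrite !rdotE (rdotC k xi) xi1.
  have -> : rdot xi k = 0.
    rewrite rdotC /xi inner u00; have := cstB 0 0; rewrite !subrr => ->.
    by rewrite /rdot linear0l.
  by have := rdot_ge0 k; lra.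
suff all : forall g, [set g | pi g u0 = u0] g by exact: all.
apply: genS.
- exact: pi1.
- exact: fixed.
- by move=> g1 g2 /= gu hu; rewrite piM hu.
- by move=> g1 /= gu; rewrite -{1}gu -piM mulVg pi1.
Qed.
End PropertyT.

(** * The theorem *)

Theorem theorem1p1 (R : realType) (G : groupType) (S : set G)
    (X : nat -> finType) (sigma : forall i : nat, G -> {perm X i})
    (d : graph_space X -> graph_space X -> R) :
  finite_set S -> generates S ->
  sofic R G ->
  sofic_approximation R sigma ->
  graphs_connected sigma S ->
  space_metric sigma S d ->
  [/\ property_A d -> amenable R G,
      asymptotic_coarse_embedding d -> a_T_menable R G
    & boundary_geometric_T d -> property_T R S].
Proof.
move=> finS genS _ approx conn dP.
have [m [Y fr]] := exists_frame finS approx.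
have [w [wU oow]] := @ultraFilterLemma nat \oo _.
split.
- exact: (amenable_of_property_A fr genS conn dP wU oow).
- exact: (a_T_menable_of_embedding fr finS genS conn dP wU oow).
- exact: (property_T_of_boundary_T fr finS genS conn dP wU oow).
Qed.
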